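(* Let $z_0\in\mathcal Z$ be given and assume that there exists $\ell_0\in\mathcal V^*$ such that $-D_z\mathcal I(\ell_0,z_0)\in\partial\mathcal R(0)$. Then, for every $\epsilon>0$ and every $\delta>0$, problem (vOCP$_{\epsilon,\delta}$) (defined in the context) admits a globally optimal solution.
   Context: Standing assumptions. $T>0$; $\mathcal Z,\mathcal V$ are real Hilbert spaces and $\mathcal X,\mathcal W$ Banach spaces such that $\mathcal Z\hookrightarrow\mathcal V$ densely and compactly, $\mathcal V\hookrightarrow\mathcal X$ continuously, $\mathcal Z\hookrightarrow\mathcal W$ compactly and $\mathcal W\hookrightarrow\mathcal V$ continuously. Elements of $\mathcal V$ are identified with elements of $\mathcal V^*\hookrightarrow\mathcal Z^*$ via the Riesz isomorphism of $\mathcal V$. The energy is $\mathcal I(\ell,z)=\frac12\langle Az,z\rangle_{\mathcal Z^*,\mathcal Z}+\mathcal F(z)-\langle\ell,z\rangle_{\mathcal V^*,\mathcal V}$ for $\ell\in\mathcal V^*$, $z\in\mathcal Z$, so $D_z\mathcal I(\ell,z)=Az+D_z\mathcal F(z)-\ell\in\mathcal Z^*$. $A\in L(\mathcal Z,\mathcal Z^* )$ is symmetric and coercive: $\langle Az,w\rangle=\langle Aw,z\rangle$, $\langle Az,z\rangle\ge\alpha\|z\|_{\mathcal Z}^2$ for some $\alpha>0$; $|z|_{\mathcal Z}:=\langle Az,z\rangle^{1/2}$. $\mathcal F:\mathcal Z\to\mathbb R$ satisfies: $\mathcal F\in C^2(\mathcal Z;\mathbb R)$, $\mathcal F\ge0$;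 $D_z\mathcal F\in C^1(\mathcal Z;\mathcal V^* )$ with $\|D_z^2\mathcal F(z)v\|_{\mathcal V^*}\le\gamma(1+\|z\|_{\mathcal Z}^q)\|v\|_{\mathcal Z}$ for all $v,z\in\mathcal Z$, with some $q\in[0,1/2)$, $\gamma>0$; $z_k\rightharpoonup z$ in $\mathcal Z$ implies $D_z\mathcal F(z_k)\rightharpoonup D_z\mathcal F(z)$ in $\mathcal Z^*$; $D_z^2\mathcal F$ extends to $\mathcal W$ with values in $L(\mathcal Z,\mathcal V^* )$ and the extension is continuous from $\mathcal W$ to $L(\mathcal Z,\mathcal V^* )$; $D_z^2\mathcal F:\mathcal Z\to L(\mathcal Z,\mathcal Z^* )$ is Lipschitz continuous on bounded sets. The dissipation $\mathcal R:\mathcal Z\to[0,\infty)$ is proper, convex, lower semicontinuous, positively 1-homogeneous, and $\underline c\|z\|_{\mathcal X}\le\mathcal R(z)\le\overline c\|z\|_{\mathcal V}$ for all $z\in\mathcal Z$ with constants $\underline c,\overline c>0$. $\partial$ denotes the convex subdifferential. $\mathrm{dist}_X(x,M)=\inf_{m\in M}\|x-m\|_X$. $j:\mathcal V\to\mathbb R$ is continuous and bounded from below, $\beta>0$. (vOCP$_{\epsilon,\delta}$): minimize $j(z(T))+\frac\beta2\|\ell\|^2_{H^1(0,T;\mathcal V^* )}$ over $\ell\in H^1(0,T;\mathcal V^* )$, $z\in H^2(0,T;\mathcal Z)$ subject to $z'(t)=\partial\mathcal R_{\epsilon,\delta}^*(-D_z\mathcal I(\ell(t),z(t)))$ for a.a.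 $t\in(0,T)$ (equivalently $0\in\partial\mathcal R_{\epsilon,\delta}(z'(t))+D_z\mathcal I(\ell(t),z(t))$), $z(0)=z_0$, where $\mathcal R_{\epsilon,\delta}(z)=\mathcal R(z)+\frac\epsilon2\|z\|_{\mathcal V}^2+\frac\delta2|z|_{\mathcal Z}^2$ and $\mathcal R_{\epsilon,\delta}^*:\mathcal Z^*\to\mathbb R$ is its Fenchel conjugate (with single-valued subdifferential in $\mathcal Z$), and $-D_z\mathcal I(\ell(0),z_0)\in\partial\mathcal R(0)$, $\mathrm{dist}_{\mathcal Z^*}(-D_z\mathcal I(\ell(T),z(T)),\partial\mathcal R(0))\le\epsilon^{1/4}+\delta^{1/4}$. *)

(* Defs.v *)
From HB Require Import structures.
From mathcomp Require Import all_boot all_order all_algebra.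
From mathcomp Require Import all_classical all_reals all_analysis.

Set Implicit Arguments.
Unset Strict Implicit.
Unset Printing Implicit Defensive.

Import Order.TTheory GRing.Theory Num.Theory.
Import numFieldNormedType.Exports.

Local Open Scope classical_set_scope.
Local Open Scope ring_scope.

Section Linop.
Context {R : realType} {E F : normedModType R}.

Definition is_linop : {pred E -> F} :=
  fun f => `[< (forall a u v, f (a *: u + v) = a *: f u + f v) /\
               continuous f >].

Record linop := Linop { linop_fun :> E -> F; linop_prop : is_linop linop_fun }.

HB.instance Definition _ := [isSub of linop for linop_fun].
HB.instance Definition _ := [Choice of linop by <:].

Lemma linop_linear (f : linop) a u v : f (a *: u + v) = a *: f u + f v.
Proof. by case: f => f /= /asboolP[]. Qed.

Lemma linop_continuous (f : linop) : continuous f.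
Proof. by case: f => f /= /asboolP[]. Qed.

HB.instance Definition _ (f : linop) :=
  GRing.isLinear.Build R E F *:%R (linop_fun f) (linop_linear f).

Lemma is_linop_submod : submod_closed is_linop.
Proof.
split=> [|a f g /asboolP[fl fc] /asboolP[gl gc]]; apply/asboolP; split.
- by move=> a u v; rewrite /GRing.zero /= scaler0 addr0.
- by move=> x; apply: cvg_cst.
- move=> b u v; change (a *: f (b *: u + v) + g (b *: u + v) =
    b *: (a *: f u + g u) + (a *: f v + g v)).
  by rewrite fl gl !scalerDr !scalerA (mulrC a b) addrACA.
- move=> x; apply: (@cvgD _ _ _ _ _ (a \*: f) g); last exact: gc.
  by apply: cvgZr; exact: fc.
Qed.

HB.instance Definition _ :=
  GRing.isSubmodClosed.Build R (E -> F) is_linop is_linop_submod.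
HB.instance Definition _ := [SubChoice_isSubLmodule of linop by <:].

Definition opnorm (f : linop) : R :=
  sup [set `|f x| | x in [set x | `|x| <= 1]].

Lemma opnorm_has_sup (f : linop) :
  has_sup [set `|f x| | x in [set x : E | `|x| <= 1]].
Proof.
split; first by exists `|f 0|, 0 => //=; rewrite normr0.
have /linear_boundedP/pinfty_ex_gt0[M M0 fM] :=
  continuous_linear_bounded 0 (@linop_continuous f 0).
exists M => _ [x /= x1 <-]; rewrite (le_trans (fM x))//.
by rewrite ler_piMr// ltW.
Qed.

Lemma opnorm_ge0 (f : linop) : 0 <= opnorm f.
Proof.
apply: le_trans (ub_le_sup (opnorm_has_sup f).2 _); last first.
  by exists 0 => //=; rewrite normr0.
exact: normr_ge0.
Qed.

Lemma le_opnorm (f : linop) x : `|f x| <= opnorm f * `|x|.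
Proof.
have [->|x0] := eqVneq x 0; first by rewrite linear0 !normr0 mulr0.
rewrite -ler_pdivrMr ?normr_gt0//.
apply: le_trans (ub_le_sup (opnorm_has_sup f).2 _); last first.
  exists (`|x|^-1 *: x) => //=.
  by rewrite normrZ gtr0_norm ?invr_gt0 ?normr_gt0// mulVf// normr_eq0.
by rewrite linearZ normrZ gtr0_norm ?invr_gt0 ?normr_gt0// mulrC.
Qed.

Lemma opnorm_le (f : linop) M :
  (forall x, `|x| <= 1 -> `|f x| <= M) -> opnorm f <= M.
Proof.
move=> fM; apply: ge_sup => [|_ [x /= x1 <-]]; last exact: fM.
exact: (opnorm_has_sup f).1.
Qed.

Lemma opnormD (f g : linop) : opnorm (f + g) <= opnorm f + opnorm g.
Proof.
apply: opnorm_le => x x1; rewrite (le_trans (ler_normD _ _))// lerD//.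
- by rewrite (le_trans (le_opnorm f x))// ler_piMr// opnorm_ge0.
- by rewrite (le_trans (le_opnorm g x))// ler_piMr// opnorm_ge0.
Qed.

Lemma opnormZ (a : R) (f : linop) : opnorm (a *: f) = `|a| * opnorm f.
Proof.
have le b g : opnorm (b *: g) <= `|b| * opnorm g.
  apply: opnorm_le => x x1; rewrite [leLHS](normrZ b (g x)) ler_wpM2l//.
  by rewrite (le_trans (le_opnorm g x))// ler_piMr// opnorm_ge0.
apply/eqP; rewrite eq_le le/=.
have [->|a0] := eqVneq a 0; first by rewrite normr0 mul0r opnorm_ge0.
rewrite -ler_pdivlMl ?normr_gt0// -normfV.
by rewrite -{1}[f](scalerK a0) le.
Qed.

Lemma opnorm_eq0 (f : linop) : opnorm f = 0 -> f = 0.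
Proof.
move=> f0; apply/val_inj/funext => x /=; apply/eqP.
by rewrite -normr_le0 (le_trans (le_opnorm f x))// f0 mul0r.
Qed.

HB.instance Definition _ :=
  Lmodule_isNormed.Build R linop opnormD opnormZ opnorm_eq0.

End Linop.

Arguments linop {R} E F.

Notation dual E := (linop E _^o).

Definition is_hilbert {R : realType} (E : completeNormedModType R) : Prop :=
  exists ip : E -> E -> R,
    [/\ forall x y, ip x y = ip y x,
        forall a x y z, ip (a *: x + y) z = a * ip x z + ip y z &
        forall x, ip x x = `|x| ^+ 2].

Definition embedding {R : realType} {E F : normedModType R} (i : linop E F) :=
  injective i.

Definition compact_op {R : realType} {E F : normedModType R} (i : linop E F) :=
  precompact (i @` [set x | `|x| <= 1]).

Definition weakly_cvg {R : realType} {E : normedModType R}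
    (u : nat -> E) (l : E) : Prop :=
  forall xi : dual E, xi (u n) @[n --> \oo] --> xi l.

Section Frechet.
Context {R : realType} {E F : normedModType R}.

(* Equal to 0 where f is not differentiable. *)
Definition frechet (f : E -> F) (x : E) : linop E F :=
  xget 0 [set L : linop E F | is_diff x f L].

Definition C1 (f : E -> F) : Prop :=
  (forall x, differentiable f x) /\ continuous (frechet f).

End Frechet.

Definition C2 {R : realType} {E F : normedModType R} (f : E -> F) : Prop :=
  C1 f /\ C1 (frechet f).

(* The bilinear pairing is a parameter so that the subdifferential of a function
   on Z is a subset of Z^*, and that of a function on Z^* a subset of Z. *)
Definition subdifferential {R : realType} {E E' : lmodType R}
    (pairing : E -> E' -> R) (f : E -> \bar R) (x : E) : set E' :=
  [set p | f x \is a fin_num /\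
           forall y, (f x + (pairing (y - x) p)%:E <= f y)%E].

Definition conjugate {R : realType} {E : normedModType R} (f : E -> \bar R)
    (xi : dual E) : \bar R :=
  ereal_sup (range (fun x => (xi x)%:E - f x)%E).

Definition dist {R : realType} {E : normedModType R} (x : E) (M : set E) : R :=
  inf [set `|x - m| | m in M].

Section Bochner.
Context {R : realType} {E : normedModType R}.

Record simple_fun := SimpleFun {
  sf_size : nat;
  sf_set : 'I_sf_size -> set R;
  sf_val : 'I_sf_size -> E;
  sf_measurable : forall i, measurable (sf_set i) }.

Definition sf_eval (s : simple_fun) (t : R) : E :=
  \sum_(i < sf_size s) \1_(sf_set i) t *: sf_val i.

Variable T : R.

Definition sf_integral (s : simple_fun) : E :=
  \sum_(i < sf_size s)
    fine (lebesgue_measure (`[0, T] `&` sf_set i)) *: sf_val i.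

(* Strong (Borel) measurability; every class of a.e. equal strongly
   Lebesgue-measurable functions has such a representative. *)
Definition strongly_measurable (f : R -> E) : Prop :=
  exists s : nat -> simple_fun,
    forall t, t \in `[0, T] -> sf_eval (s n) t @[n --> \oo] --> f t.

Definition is_bochner_integral (f : R -> E) (x : E) : Prop :=
  strongly_measurable f /\
  exists s : nat -> simple_fun,
    (\int[lebesgue_measure]_(t in `[0%R, T]) (`|f t - sf_eval (s n) t|%R)%:E)%E
      @[n --> \oo] --> 0%E /\
    sf_integral (s n) @[n --> \oo] --> x.

Definition L2normsq (f : R -> E) : \bar R :=
  (\int[lebesgue_measure]_(t in `[0%R, T]) (`|f t| ^+ 2)%R%:E)%E.

Definition L2 (f : R -> E) : Prop :=
  strongly_measurable f /\ (L2normsq f < +oo)%E.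

(* Testing with C^1_c(0,T) gives the same weak derivatives as testing with
   smooth compactly supported functions (mollify). *)
Definition test_fun (phi : R -> R) : Prop :=
  [/\ forall t, derivable phi t 1, continuous (derive1 phi) &
      exists a b, [/\ 0 < a, b < T & forall t, t \notin `[a, b] -> phi t = 0]].

Definition is_wderiv (f g : R -> E) : Prop :=
  forall phi, test_fun phi ->
    exists x, is_bochner_integral (fun t => derive1 phi t *: f t) x /\
              is_bochner_integral (fun t => phi t *: g t) (- x).

(* sobolev k is H^k(0,T;E). *)
Fixpoint sobolev (k : nat) (f : R -> E) : Prop :=
  L2 f /\ if k is k'.+1 then exists2 g, is_wderiv f g & sobolev k' g else True.

(* A representative of the weak derivative, which is unique up to a.e.
   equality; only a.e.-invariant properties of it are used. *)
Definition wderiv (f : R -> E) : R -> E :=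
  xget (cst 0) [set g | L2 g /\ is_wderiv f g].

Definition H1normsq (f : R -> E) : \bar R :=
  (L2normsq f + L2normsq (wderiv f))%E.

End Bochner.

Section System.
Context {R : realType} {Z V X W : completeNormedModType R}.

(* The embeddings stand for inclusions, whence the compatibility of Z -> W -> V
   with Z -> V. *)
Definition embeddings (iZV : linop Z V) (iVX : linop V X)
    (iZW : linop Z W) (iWV : linop W V) : Prop :=
  [/\ embedding iZV /\ embedding iVX, embedding iZW /\ embedding iWV,
      forall z, iWV (iZW z) = iZV z,
      dense (range iZV) & compact_op iZV /\ compact_op iZW].

Definition symmetric_op (A : linop Z (dual Z)) : Prop :=
  forall z w, A z w = A w z.

Definition coercive_op (A : linop Z (dual Z)) : Prop :=
  exists2 alpha : R, 0 < alpha & forall z, alpha * `|z| ^+ 2 <= A z z.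

Definition Anorm (A : linop Z (dual Z)) (z : Z) : R := Num.sqrt (A z z).

(* [DF] is D_z F seen as a map into V^*, where V^* is embedded in Z^* by
   restriction. *)
Definition nonlinearity (iZV : linop Z V) (iZW : linop Z W)
    (F : Z -> R^o) : Prop :=
  [/\ C2 F,
      forall z, 0 <= F z,
      exists DF : Z -> dual V,
        [/\ forall z v, frechet F z v = DF z (iZV v),
            C1 DF,
            exists q gamma : R,
              [/\ 0 <= q < 2^-1, 0 < gamma &
                  forall v z, `|frechet DF z v| <=
                    gamma * (1 + `|z| `^ q) * `|v|] &
            exists D2F : W -> linop Z (dual V),
              (forall z, D2F (iZW z) = frechet DF z) /\ continuous D2F],
      forall (u : nat -> Z) (z : Z), weakly_cvg u z ->
        weakly_cvg (fun n => frechet F (u n)) (frechet F z) &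
      forall B : set Z, bounded_set B ->
        exists k : R, k.-lipschitz_B (frechet (frechet F))].

(* A real-valued functional is automatically proper. *)
Definition dissipation (iZV : linop Z V) (iVX : linop V X)
    (D : Z -> R) : Prop :=
  [/\ forall z, 0 <= D z,
      convex_function setT (D : convex_lmodType Z -> R^o),
      lower_semicontinuous (EFin \o D),
      forall (a : R) z, 0 < a -> D (a *: z) = a * D z &
      exists c C : R, [/\ 0 < c, 0 < C &
        forall z, c * `|iVX (iZV z)| <= D z <= C * `|iZV z|]].

Definition energy (iZV : linop Z V) (A : linop Z (dual Z)) (F : Z -> R^o)
    (l : dual V) (z : Z) : R^o :=
  2^-1 * A z z + F z - l (iZV z).

Definition DzI (iZV : linop Z V) (A : linop Z (dual Z)) (F : Z -> R^o)
    (l : dual V) (z : Z) : dual Z :=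
  frechet (energy iZV A F l) z.

Definition subdiff (f : Z -> \bar R) : Z -> set (dual Z) :=
  subdifferential (fun z (xi : dual Z) => xi z) f.

Definition subdiff_dual (f : dual Z -> \bar R) : dual Z -> set Z :=
  subdifferential (fun (xi : dual Z) (z : Z) => xi z) f.

Definition visc (iZV : linop Z V) (A : linop Z (dual Z)) (D : Z -> R)
    (eps delta : R) (z : Z) : R :=
  D z + eps / 2 * `|iZV z| ^+ 2 + delta / 2 * Anorm A z ^+ 2.

(* Elements of H^1(0,T; dual V) and H^2(0,T;Z) are represented by functions on R
   of which only the restriction to [0,T] matters, continuous on [0,T] so that
   the values at 0 and T are the traces. *)
Definition feasible (T : R) (iZV : linop Z V) (A : linop Z (dual Z))
    (F : Z -> R^o) (D : Z -> R) (z0 : Z) (eps delta : R)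
    (l : R -> dual V) (z : R -> Z) : Prop :=
  [/\ sobolev T 1%N l /\ {within `[0, T], continuous l},
      sobolev T 2%N z /\ {within `[0, T], continuous z},
      {ae lebesgue_measure, forall t, t \in `]0, T[ ->
        subdiff_dual (conjugate (EFin \o visc iZV A D eps delta))
          (- DzI iZV A F (l t) (z t)) = [set wderiv T z t]},
      z 0 = z0 &
      subdiff (EFin \o D) 0 (- DzI iZV A F (l 0) z0) /\
      dist (- DzI iZV A F (l T) (z T)) (subdiff (EFin \o D) 0)
        <= eps `^ 4^-1 + delta `^ 4^-1].

Definition cost (T : R) (iZV : linop Z V) (j : V -> R) (beta : R)
    (l : R -> dual V) (z : R -> Z) : R :=
  j (iZV (z T)) + beta / 2 * fine (H1normsq T l).

End System.

(* Main.v *)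
Require Import Defs.
From HB Require Import structures.
From mathcomp Require Import all_boot all_order all_algebra.
From mathcomp Require Import all_classical all_reals all_analysis.
From mathcomp Require Import measurable_realfun.
From mathcomp Require Import ring lra.
Set Implicit Arguments.
Unset Strict Implicit.
Unset Printing Implicit Defensive.
Import Order.TTheory GRing.Theory Num.Theory.
Import numFieldNormedType.Exports.
Local Open Scope classical_set_scope.
Local Open Scope ring_scope.

(** The proof is the direct method of the calculus of variations.

    The state equation. The regularized potential is strongly convex, so that the
    subdifferential of its conjugate at a force xi is the single point
    [resolvent xi], the minimizer of the potential tilted by xi, and [resolvent]
    is Lipschitz continuous ([subdiff_conjugate_visc], [resolvent_lip]). The
    constraint is therefore the ordinary differential equation
    z' = [speed l z] with a locally Lipschitz right-hand side, an equation that
    only sees the load through its pullback to the dual of [Z]. Testing it with the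
    velocity bounds the state ([state_bound]), and Gronwall's lemma makes the
    state depend Lipschitz continuously on the pullback of the load
    ([state_dependence]). The constant pair (l0, z0) is feasible because z0
    is stationary under l0 ([resolvent_stationary]).

    Compactness. Along a minimizing sequence the cost bounds the H^1 norms of the
    loads, whence a common Hoelder modulus ([H1_holder]); stability at time 0
    bounds the initial loads ([stationary_load_bound]). The loads then converge
    weakly at each time along an ultrafilter, and since [Z] embeds compactly into
    [V], their pullbacks converge in norm, uniformly in time ([load_limit]). Hence
    the states and their velocities converge uniformly ([state_limit]), and the
    equation, the initial conditions and the condition at the final time pass to
    the limit.

    Weak derivatives. What remains is that the limit load is of class H^1 with a
    norm not exceeding the limit of the norms, and that the limit state is of
    class H^2. Both rest on one criterion: a continuous function has a square
    integrable weak derivative if and only if its discrete energies, the sums of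
    |u(t_{k+1}) - u(t_k)|^2 / (t_{k+1} - t_k) over uniform partitions, are
    bounded, and the bound then bounds the squared norm of the derivative
    ([discrete_energy_le], [wderiv_of_bounded_energy]). A discrete energy involves
    finitely many increments, so that its lower semicontinuity is immediate
    ([H1_lsc]), and the velocity inherits bounded energy from the load through the
    Lipschitz resolvent ([state_sobolev]). The parallelogram law is what makes
    difference quotients of bounded energy converge, whence the use of Hilbert
    spaces and of their duals. *)

(** * Limits and continuous linear maps *)

Lemma gt0_half (R : realType) (e : R) : 0 < e -> 0 < e / 2.
Proof. by move=> e0; rewrite divr_gt0. Qed.

Lemma cvgr_to_le (R : realType) (I : Type) (G : set_system I)
    (GF : ProperFilter G) (f : I -> R) (l c : R) :
  f @ G --> l -> (\forall k \near G, f k <= c) -> l <= c.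
Proof.
move=> fl fc; rewrite -(cvg_lim (@Rhausdorff R) fl).
by apply: limr_le => //; apply/cvg_ex; exists l.
Qed.

Lemma bounded_linear_is_linop (R : realType) (E F : normedModType R)
    (f : E -> F) (M : R) :
  (forall a u v, f (a *: u + v) = a *: f u + f v) ->
  (forall x, `|f x| <= M * `|x|) -> f \in is_linop.
Proof.
move=> flin fM; apply/asboolP; split => // x.
have fB u v : f (u - v) = f u - f v.
  by rewrite -{1}[v]scale1r -scaleNr addrC flin scaleN1r addrC.
apply/cvgrPdist_le => e e0; near=> y.
rewrite -fB (le_trans (fM _))//.
have M1 : 0 < `|M| + 1 by rewrite ltr_wpDl.
apply: (@le_trans _ _ ((`|M| + 1) * `|x - y|)).
  by rewrite ler_wpM2r// (le_trans (ler_norm _))// lerDl.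
rewrite -ler_pdivlMl// mulrC; near: y.
by apply: cvgr_dist_le; [exact: cvg_id|rewrite divr_gt0].
Unshelve. all: by end_near. Qed.

Lemma cauchy_cvg_dist (R : realType) (E : completeNormedModType R) (I : Type)
    (G : set_system I) (u : I -> E) : ProperFilter G ->
  (forall e : R, 0 < e -> exists y, \forall k \near G, `|y - u k| <= e) ->
  cvg (u k @[k --> G]).
Proof.
move=> GF uc; apply: cauchy_cvg; apply: cauchy_exP => e e0.
have [y yu] := uc (e / 2) (gt0_half e0).
exists y; rewrite /nbhs/=; near=> k; rewrite -ball_normE /ball_/=.
have /le_lt_trans : `|y - u k| <= e / 2 by near: k.
by apply; rewrite ltr_pdivrMr// ltr_pMr// ltr1n.
Unshelve. all: by end_near. Qed.

Section LinopComplete.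
Context {R : realType} {E : normedModType R} {F : completeNormedModType R}.

Lemma le_norm_linop (f : linop E F) x : `|f x| <= `|f| * `|x|.
Proof. exact: le_opnorm. Qed.

Lemma linop_norm_le (f : linop E F) (M : R) : 0 <= M ->
  (forall x, `|f x| <= M * `|x|) -> `|f| <= M.
Proof.
move=> M0 fM; apply: opnorm_le => x x1.
by rewrite (le_trans (fM x))// ler_piMr.
Qed.

(** The limit is taken pointwise; it is bounded because a Cauchy filter
    eventually stays at distance at most 1 from a fixed operator. This makes
    the dual of a Banach space a Banach space, hence loads live in a space to
    which the results on weak derivatives apply. *)
Lemma linop_cauchy_cvg (G : set_system (linop E F)) :
  ProperFilter G -> cauchy G -> cvg G.
Proof.
move=> GF /cauchyP Gc.
have Ge e : 0 < e -> exists f0, \forall f \near G, `|f0 - f| <= e.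
  move=> e0; have [f0 Gf0] := Gc _ e0; exists f0.
  by apply: filterS Gf0 => f; rewrite -ball_normE => /ltW.
pose ev x (f : linop E F) := f x.
have Gpt x : cvg (ev x @ G).
  apply: cauchy_cvg_dist => e e0.
  have x1 : 0 < `|x| + 1 by rewrite ltr_wpDl.
  have [f0 Gf0] := Ge _ (divr_gt0 e0 x1).
  exists (f0 x); apply: filterS Gf0 => f f0f.
  rewrite -[f0 x - f x]/((f0 - f) x) (le_trans (le_norm_linop _ _))//.
  rewrite (le_trans (ler_wpM2r _ f0f))//.
  by rewrite -mulrA ler_piMr ?(ltW e0)// ler_pdivrMl// mulr1 lerDl.
pose L x := lim (ev x @ G).
have Llin a u v : L (a *: u + v) = a *: L u + L v.
  apply: cvg_lim => //.
  rewrite (_ : ev _ = (fun f => a *: ev u f + ev v f)); last first.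
    by apply/funext => f; exact: linearP.
  by apply: cvgD; [apply: cvgZr|]; exact: Gpt.
have Lle f0 e x : (\forall f \near G, `|f0 - f| <= e) ->
    `|f0 x - L x| <= e * `|x|.
  move=> Gf0.
  have cv : `|f0 x - ev x f| @[f --> G] --> `|f0 x - L x|.
    by apply: cvg_norm; apply: cvgB; [exact: cvg_cst|exact: Gpt].
  apply: (cvgr_to_le _ cv); apply: filterS Gf0 => f f0f.
  rewrite -[f0 x - f x]/((f0 - f) x) (le_trans (le_norm_linop _ _))//.
  by rewrite ler_wpM2r.
have [f1 Gf1] := Ge 1 ltr01.
have LP : L \in is_linop.
  apply: (@bounded_linear_is_linop _ _ _ _ (`|f1| + 1)) => // x.
  rewrite mulrDl -[L x](subKr (f1 x)).
  by rewrite (le_trans (ler_normB _ _))// lerD ?le_norm_linop// Lle.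
apply/cvg_ex; exists (Linop LP); apply/cvgrPdist_le => e e0.
have [f0 Gf0] := Ge _ (gt0_half e0).
have f0L : `|f0 - Linop LP| <= e / 2.
  apply: linop_norm_le; first by rewrite divr_ge0// ltW.
  by move=> x; exact: Lle.
apply: filterS Gf0 => f f0f.
rewrite -[Linop LP - f](subrKA f0) (le_trans (ler_normD _ _))//.
by rewrite (splitr e) lerD// distrC.
Qed.

HB.instance Definition _ := Uniform_isComplete.Build (linop E F) linop_cauchy_cvg.

End LinopComplete.

(** * Parallelogram law and norming functionals *)

(** Stated as an inequality because in this form the law passes directly from a
    Hilbert space to its dual. *)
Definition parallelogram_le {R : realType} (E : normedModType R) :=
  forall x y : E,
    `|x + y| ^+ 2 + `|x - y| ^+ 2 <= 2 * `|x| ^+ 2 + 2 * `|y| ^+ 2.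

(** The conclusion of the Hahn-Banach theorem up to an arbitrarily small error:
    enough to test vector-valued identities by functionals, and elementary for
    Hilbert spaces and for duals, the only spaces considered here. *)
Definition norming_dual {R : realType} (E : normedModType R) :=
  forall (x : E) (e : R), 0 < e -> exists xi : dual E,
    (forall y, xi y <= `|y|) /\ `|x| <= xi x + e.

Section Hilbert.
Context {R : realType} {E : completeNormedModType R}.

Lemma hilbert_parallelogram : is_hilbert E -> parallelogram_le E.
Proof.
move=> [ip [ipC ipl ipn]] x y.
have ipD u v w : ip (u + v) w = ip u w + ip v w.
  by rewrite -[u]scale1r ipl mul1r scale1r.
have ip0 w : ip 0 w = 0 by apply: (addrI (ip 0 w)); rewrite -ipD !addr0.
have ipN u w : ip (- u) w = - ip u w.
  by rewrite -scaleN1r -[_ *: u]addr0 ipl ip0 mulN1r addr0.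
rewrite -!ipn !(ipD, ipN) ![ip _ (_ + _)]ipC !(ipD, ipN) (ipC y x).
by lra.
Qed.

(** The functional is the inner product with the normalized vector; its bound is
    the Cauchy-Schwarz inequality. *)
Lemma hilbert_norming : is_hilbert E -> norming_dual E.
Proof.
move=> [ip [ipC ipl ipn]] x e e0.
have ipD u v w : ip (u + v) w = ip u w + ip v w.
  by rewrite -[u]scale1r ipl mul1r scale1r.
have ip0 w : ip 0 w = 0 by apply: (addrI (ip 0 w)); rewrite -ipD !addr0.
have ipN u w : ip (- u) w = - ip u w.
  by rewrite -scaleN1r -[_ *: u]addr0 ipl ip0 mulN1r addr0.
have ipZ a u w : ip (a *: u) w = a * ip u w.
  by rewrite -[_ *: u]addr0 ipl ip0 addr0.
have [->|x0] := eqVneq x 0.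
  exists 0; split=> [y|]; first exact: normr_ge0.
  by rewrite normr0 linear0 add0r ltW.
have nx : 0 < `|x| by rewrite normr_gt0.
have CS y : ip y x <= `|y| * `|x|.
  have [->|y0] := eqVneq y 0; first by rewrite ip0 normr0 mul0r.
  have ny : 0 < `|y| by rewrite normr_gt0.
  set a := `|x| in nx *; set b := `|y| in ny *.
  have : 0 <= `|a *: y - b *: x| ^+ 2 by rewrite sqr_ge0.
  rewrite -ipn ipD ipN ![ip _ (_ - _)]ipC !ipD !ipN !ipZ ![ip _ (_ *: _)]ipC.
  rewrite !ipZ !ipn (ipC x y) -/a -/b => H.
  rewrite -subr_ge0 -(pmulr_rge0 _ (mulr_gt0 nx ny)); nra.
pose f y : R^o := `|x|^-1 * ip y x.
have fP : f \in is_linop.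
  apply: (@bounded_linear_is_linop _ _ _ f 1).
    by move=> a u v; rewrite /f ipl mulrDr mulrCA.
  move=> y; rewrite mul1r /f normrM normfV normr_id ler_pdivrMl// mulrC.
  by rewrite ler_norml CS andbT lerNl -ipN (le_trans (CS _))// normrN.
exists (Linop fP); split => /= [y|]; rewrite /f; last first.
  by rewrite ipn expr2 mulKf ?gt_eqF// lerDl ltW.
by rewrite ler_pdivrMl// mulrC.
Qed.

End Hilbert.

Section DualOfHilbert.
Context {R : realType} {V : normedModType R}.

Lemma dual_norm_approx (xi : dual V) e : 0 < e ->
  exists2 v, `|v| <= 1 & `|xi| <= xi v + e.
Proof.
move=> e0.
have [_ [v /= v1 <-] xiv] := sup_adherent e0 (opnorm_has_sup xi).
have [xv|xv] := leP 0 (xi v).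
  exists v => //; rewrite -lerBlDr; apply: ltW.
  by move: xiv; rewrite [`|xi v|]ger0_norm.
exists (- v); first by rewrite normrN.
rewrite -lerBlDr; apply: ltW.
by move: xiv; rewrite [`|xi v|]ltr0_norm// linearN.
Qed.

(** Evaluation at an almost maximizing unit vector. *)
Lemma dual_norming : norming_dual (dual V).
Proof.
move=> xi e e0; have [v v1 xiv] := dual_norm_approx xi e0.
have ble (eta : dual V) : `|eta v| <= `|eta|.
  by rewrite (le_trans (le_norm_linop eta v))// ler_piMr.
have evP : (fun eta : dual V => eta v) \in
    (is_linop : pred (dual V -> R^o)).
  by apply: (@bounded_linear_is_linop _ _ _ _ 1) => // eta; rewrite mul1r.
exists (Linop evP); split => //= eta.
by rewrite (le_trans (ler_norm _)).
Qed.

(** For unit vectors v, w and a, b >= 0, regroup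
    a (xi + eta) v + b (xi - eta) w = xi (a v + b w) + eta (a v - b w)
    and bound the right-hand side by Young's inequality and the parallelogram law
    of [V]. Choosing v, w almost maximizing and a, b the two norms yields the law
    in the dual. *)
Lemma dual_parallelogram : parallelogram_le V -> parallelogram_le (dual V).
Proof.
move=> pV xi eta.
set S := `|xi + eta|; set D := `|xi - eta|.
pose Q := `|xi| ^+ 2 + `|eta| ^+ 2.
have Q0 : 0 <= Q by rewrite addr_ge0 ?sqr_ge0.
have key v w (a b : R) : 0 <= a -> 0 <= b -> `|v| <= 1 -> `|w| <= 1 ->
    a * (xi + eta) v + b * (xi - eta) w <= Q + (a ^+ 2 + b ^+ 2) / 2.
  move=> a0 b0 v1 w1; pose x := a *: v; pose y := b *: w.
  have -> : a * (xi + eta) v + b * (xi - eta) w = xi (x + y) + eta (x - y).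
    rewrite -[(xi + eta) v]/(xi v + eta v) -[(xi - eta) w]/(xi w - eta w).
    by rewrite !linearD !linearN !linearZ/= /GRing.scale/=; lra.
  have h1 : xi (x + y) <= `|xi| * `|x + y|.
    by rewrite (le_trans (ler_norm _))// le_norm_linop.
  have h2 : eta (x - y) <= `|eta| * `|x - y|.
    by rewrite (le_trans (ler_norm _))// le_norm_linop.
  have := pV x y.
  have nx : `|x| ^+ 2 <= a ^+ 2.
    by rewrite lerXn2r ?nnegrE// /x normrZ ger0_norm// ler_piMr.
  have ny : `|y| ^+ 2 <= b ^+ 2.
    by rewrite lerXn2r ?nnegrE// /y normrZ ger0_norm// ler_piMr.
  have := sqr_ge0 (`|xi| - `|x + y| / 2).
  have := sqr_ge0 (`|eta| - `|x - y| / 2).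
  rewrite /Q; nra.
have S0 : 0 <= S by exact: normr_ge0.
have D0 : 0 <= D by exact: normr_ge0.
suff : forall e, 0 < e -> S ^+ 2 + D ^+ 2 <= 2 * Q + e.
  by move=> H; rewrite -mulrDr -/Q; apply/ler_addgt0Pr.
move=> e e0.
pose d := e / (2 * (S + D + 1)).
have SD : 0 < S + D + 1 by rewrite ltr_wpDl// addr_ge0.
have d0 : 0 < d by rewrite divr_gt0// mulr_gt0.
have [v v1 hv] := dual_norm_approx (xi + eta) d0.
have [w w1 hw] := dual_norm_approx (xi - eta) d0.
have := key v w S D S0 D0 v1 w1.
rewrite -/S in hv; rewrite -/D in hw.
have : S * S <= S * ((xi + eta) v + d) by rewrite ler_wpM2l.
have : D * D <= D * ((xi - eta) w + d) by rewrite ler_wpM2l.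
have : (S + D) * d <= e / 2.
  have -> : e / 2 = (S + D + 1) * d by rewrite /d; field; rewrite gt_eqF.
  by rewrite ler_wpM2r ?(ltW d0)// lerDl.
nra.
Qed.

End DualOfHilbert.

(** * Uniform partitions and simple functions *)

Section UniformContinuity.
Context {R : realType} {E : normedModType R}.
Variable T : R.

Lemma heine_itv (u : R -> E) : {within `[0, T], continuous u} ->
  forall e : R, 0 < e -> exists2 d : R, 0 < d &
  forall s t : R, s \in `[0, T] -> t \in `[0, T] -> `|s - t| < d ->
    `|u s - u t| <= e.
Proof.
move=> /subspace_continuousP uc e e0.
pose P d s := forall t, t \in `[0, T] -> `|s - t| < d -> `|u s - u t| <= e.
have cover x : x \in `[0, T] ->
    \forall s \near x & d \near (0:R)^'+, `[0, T]%classic s -> P d s.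
  move=> xT.
  have /uc/cvgrPdist_le/(_ _ (gt0_half e0)) : `[0, T]%classic x by [].
  rewrite near_withinE => /nbhs_ballP[r /= r0 xr].
  have r2 := gt0_half r0.
  near=> s d => sT t tT std.
  have sx : `|x - s| < r / 2.
    by near: s; apply: nbhsx_ballx.
  have dr : d < r / 2 by near: d; apply: nbhs_right_lt.
  have hs : `|u x - u s| <= e / 2.
    by apply: xr => //; rewrite /ball/= (lt_trans sx)// ltr_pdivrMr// ltr_pMr// ltr1n.
  have ht : `|u x - u t| <= e / 2.
    apply: xr => //; rewrite /ball/=.
    rewrite -(subrKA s) (le_lt_trans (ler_normD _ _))// (splitr r) ltrD//.
    exact: lt_trans std dr.
  rewrite -(subrKA (u x)) (le_trans (ler_normD _ _))// (splitr e) lerD//.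
  by rewrite distrC.
have /compact_near_coveringP/near_covering_withinP cov := @segment_compact R 0 T.
have [d /= d0 H] := cov _ _ P _ cover.
exists (d / 2); first exact: gt0_half.
move=> s t sT tT st; apply: (H (d / 2)) => //=.
- by rewrite sub0r normrN gtr0_norm ?gt0_half// ltr_pdivrMr// ltr_pMr// ltr1n.
- exact: gt0_half.
Unshelve. all: by end_near. Qed.

Lemma unif_within_continuous (u : R -> E) :
  (forall e : R, 0 < e -> exists2 d : R, 0 < d &
   forall s t : R, s \in `[0, T] -> t \in `[0, T] -> `|s - t| < d ->
    `|u s - u t| <= e) -> {within `[0, T], continuous u}.
Proof.
move=> H; apply/subspace_continuousP => x xT.
apply/cvgrPdist_le => e e0; have [d d0 ud] := H e e0.
rewrite near_withinE; apply/nbhs_ballP; exists d => //= s xs sT.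
exact: ud.
Qed.

End UniformContinuity.

Section SimpleFunctions.
Context {R : realType}.
Implicit Type E : normedModType R.

(** Simple functions over an arbitrary finite index type, so that differences
    and products of simple functions can be indexed by sums and products of
    types. *)
Definition sf_of E (I : finType) (A : I -> set R) (v : I -> E)
    (mA : forall i, measurable (A i)) : simple_fun :=
  @SimpleFun R E #|I| (fun k => A (enum_val k)) (fun k => v (enum_val k))
    (fun k => mA (enum_val k)).

Lemma sf_eval_of E (I : finType) (A : I -> set R) (v : I -> E) mA t :
  sf_eval (@sf_of E I A v mA) t = \sum_i \1_(A i) t *: v i.
Proof.
rewrite /sf_eval /=; apply/esym.
by rewrite (reindex (@enum_val I predT))//; exact/onW_bij/enum_val_bij.
Qed.

Lemma sf_sub_ex E (s r : @simple_fun R E) : exists q : simple_fun,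
  forall t, sf_eval q t = sf_eval s t - sf_eval r t.
Proof.
pose A (i : 'I_(sf_size s) + 'I_(sf_size r)) :=
  match i with inl i => sf_set i | inr i => sf_set i end.
pose v (i : 'I_(sf_size s) + 'I_(sf_size r)) :=
  match i with inl i => sf_val i | inr i => - sf_val i end.
have mA i : measurable (A i) by case: i => i; exact: sf_measurable.
exists (@sf_of E _ A v mA) => t.
rewrite sf_eval_of big_sumType /= /sf_eval -sumrN.
by congr (_ + _); apply: eq_bigr => i _; rewrite scalerN.
Qed.

Lemma sf_scale_ex E (s : @simple_fun R R^o) (r : @simple_fun R E) :
  exists q : simple_fun, forall t, sf_eval q t = sf_eval s t *: sf_eval r t.
Proof.
pose A (i : 'I_(sf_size s) * 'I_(sf_size r)) := sf_set i.1 `&` sf_set i.2.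
pose v (i : 'I_(sf_size s) * 'I_(sf_size r)) := sf_val i.1 *: sf_val i.2.
have mA i : measurable (A i) by apply: measurableI; exact: sf_measurable.
exists (@sf_of E _ A v mA) => t.
rewrite sf_eval_of /sf_eval scaler_suml -(pair_bigA _ (fun i j => \1_(A (i, j)) t *: v (i, j)))/=.
apply: eq_bigr => i _; rewrite scaler_sumr; apply: eq_bigr => j _.
rewrite /A /v/= indicI/= !scalerA; congr (_ *: _).
by rewrite [_ *: sf_val i]/GRing.scale/=; ring.
Qed.

Lemma measurable_sf_eval E (psi : E -> R) (s : @simple_fun R E) D :
  measurable D -> measurable_fun D (fun t => psi (sf_eval s t)).
Proof.
move=> mD; apply: (@measurable_funS _ _ _ _ setT) => //.
case: s => n; rewrite /sf_eval /=.
elim: n psi => [|n IH] psi A v mA.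
  by under eq_fun do rewrite big_ord0; exact: measurable_cst.
under eq_fun do rewrite big_ord_recl.
have -> : (fun t => psi (\1_(A ord0) t *: v ord0 +
     \sum_(i < n) \1_(A (lift ord0 i)) t *: v (lift ord0 i))) =
   (fun t => \1_(A ord0) t * psi (v ord0 +
       \sum_(i < n) \1_(A (lift ord0 i)) t *: v (lift ord0 i)) +
     \1_(~` A ord0) t * psi
       (\sum_(i < n) \1_(A (lift ord0 i)) t *: v (lift ord0 i))).
  apply/funext => t; rewrite !indicE in_setC.
  by case: (t \in A ord0); rewrite /= ?(scale1r, scale0r, mul0r, mul1r, addr0, add0r).
apply: measurable_funD; apply: measurable_funM.
- exact: measurable_indic.
- exact: (IH (fun x => psi (v ord0 + x))).
- by apply: measurable_indic; exact: measurableC.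
- exact: (IH psi).
Qed.

End SimpleFunctions.

Section Partition.
Context {R : realType}.
Variable T : R.
Hypothesis T0 : 0 < T.
Local Notation mu := (@lebesgue_measure R).

Definition mesh N : R := T / N%:R.
Definition node N k : R := k%:R * mesh N.
(** Cells are half-open, so that each nonnegative time has a unique index, and
    the final time T gets the extra index N: step functions below carry N.+1
    values, the last one on a null set. *)
Definition cell N k : set R := `[node N k, node N k.+1[%classic.
Definition cell_index N t : nat := Num.trunc (t / mesh N).

Lemma mesh_gt0 N : (0 < N)%N -> 0 < mesh N.
Proof. by move=> N0; rewrite divr_gt0// ltr0n. Qed.

Lemma mesh_natmul N : (0 < N)%N -> N%:R * mesh N = T.
Proof. by move=> N0; rewrite mulrC divfK// pnatr_eq0 -lt0n. Qed.

Lemma nodeS N k : node N k.+1 = node N k + mesh N.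
Proof. by rewrite /node -natr1 mulrDl mul1r. Qed.

Lemma node0 N : node N 0 = 0. Proof. by rewrite /node mul0r. Qed.

Lemma node_last N : (0 < N)%N -> node N N = T.
Proof. exact: mesh_natmul. Qed.

Lemma node_le N : {homo node N : i j / (i <= j)%N >-> i <= j}.
Proof.
move=> i j ij; rewrite ler_wpM2r ?ler_nat//.
by rewrite divr_ge0// ltW.
Qed.

Lemma node_itv N k : (0 < N)%N -> (k <= N)%N -> node N k \in `[0, T].
Proof.
move=> N0 kN; rewrite in_itv/= -{1}(node0 N) node_le//=.
by rewrite -(node_last N0) node_le.
Qed.

Lemma measurable_cell N k : measurable (cell N k).
Proof. exact: measurable_itv. Qed.

Lemma in_cellE N k t : (0 < N)%N -> 0 <= t ->
  (t \in cell N k) = (k == cell_index N t).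
Proof.
move=> N0 t0; have m0 := mesh_gt0 N0.
rewrite eq_sym truncn_eq; last by rewrite divr_ge0// ltW.
by apply/idP/idP; rewrite inE /cell/= in_itv/= ler_pdivlMr// ltr_pdivrMr.
Qed.

Lemma cell_index_itv N t : (0 < N)%N -> 0 <= t ->
  node N (cell_index N t) <= t < node N (cell_index N t).+1.
Proof.
move=> N0 t0; have : t \in cell N (cell_index N t) by rewrite in_cellE.
by rewrite inE /cell/= in_itv.
Qed.

Lemma cell_index_le N t : (0 < N)%N -> t \in `[0, T] -> (cell_index N t <= N)%N.
Proof.
move=> N0; rewrite in_itv/= => /andP[t0 tT].
rewrite truncn_le_nat ltr_pdivrMr ?mesh_gt0// (le_lt_trans tT)//.
by rewrite -{1}(mesh_natmul N0) ltr_pM2r ?mesh_gt0// ltr_nat.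
Qed.

Lemma cell_index_dist N t : (0 < N)%N -> 0 <= t ->
  `|t - node N (cell_index N t)| <= mesh N.
Proof.
move=> N0 t0; have /andP[h1 h2] := cell_index_itv N0 t0.
rewrite ger0_norm ?subr_ge0// lerBlDl (le_trans (ltW h2))//.
by rewrite nodeS.
Qed.

(** Nested partitions: compatibility of the indices is what allows difference
    quotients on a partition and on a refinement of it to be compared cellwise. *)
Lemma cell_index_refine N p t : (0 < N)%N -> (0 < p)%N -> 0 <= t ->
  cell_index N t = (cell_index (N * p) t %/ p)%N.
Proof.
move=> N0 p0 t0; have Np0 : (0 < N * p)%N by rewrite muln_gt0 N0.
have mp : mesh N = p%:R * mesh (N * p).
  rewrite /mesh natrM invfM mulrCA !mulrA mulrAC mulfK ?pnatr_eq0 -?lt0n//.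
have /andP[h1 h2] := cell_index_itv Np0 t0.
apply: truncn_def.
set q := cell_index (N * p) t in h1 h2 *.
have m0 := mesh_gt0 Np0.
have m1 := mesh_gt0 N0.
have mE k : k%:R * mesh N = (k * p)%N%:R * mesh (N * p).
  by rewrite mp [in RHS]natrM -[RHS]mulrA.
rewrite ler_pdivlMr// ltr_pdivrMr// !mE.
rewrite (le_trans _ h1)/=; last by rewrite ler_wpM2r ?(ltW m0)// ler_nat leq_divM.
by rewrite (lt_le_trans h2)// /node ler_wpM2r ?(ltW m0)// ler_nat ltn_ceil.
Qed.

Definition step (E : normedModType R) N (v : nat -> E) : simple_fun :=
  @SimpleFun R E N.+1 (fun i => cell N i) (fun i => v i)
    (fun i => measurable_cell N i).

Lemma sf_eval_step (E : normedModType R) N (v : nat -> E) t :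
  (0 < N)%N -> t \in `[0, T] -> sf_eval (step N v) t = v (cell_index N t).
Proof.
move=> N0 tT; have t0 : 0 <= t by move: tT; rewrite in_itv/= => /andP[].
have kN : (cell_index N t < N.+1)%N by rewrite ltnS cell_index_le.
rewrite /sf_eval /= (bigD1 (Ordinal kN))//= big1 ?addr0; last first.
  move=> i ik; rewrite indicE in_cellE// (_ : (_ == _) = false) ?scale0r//.
  by apply: contraNF ik => /eqP e; apply/eqP/val_inj.
by rewrite indicE in_cellE// eqxx scale1r.
Qed.

Lemma measure_cell N k : (0 < N)%N -> (k < N)%N ->
  mu (`[0, T] `&` cell N k) = (mesh N)%:E.
Proof.
move=> N0 kN; rewrite setIidr; last first.
  move=> t; rewrite /cell /= !in_itv/= => /andP[a b].
  have /itvP H := node_itv N0 (ltnW kN); have /itvP H' := node_itv N0 kN.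
  by rewrite (le_trans _ a) ?H// (le_trans (ltW b)) ?H'.
rewrite lebesgue_measure_itv/= lte_fin nodeS ltrDl mesh_gt0//.
by rewrite -EFinB addrAC subrr add0r.
Qed.

Lemma measure_cell_last N : (0 < N)%N -> mu (`[0, T] `&` cell N N) = 0%E.
Proof.
move=> N0; rewrite (_ : _ `&` _ = [set T]) ?lebesgue_measure_set1//.
apply/seteqP; split => t; rewrite /cell /= !in_itv/= nodeS node_last//.
  by move=> [/andP[a b] /andP[c d]]; apply/eqP; rewrite eq_le b c.
by move=> ->; rewrite lexx ltW//= ltrDl mesh_gt0.
Qed.

Lemma sf_integral_step (E : normedModType R) N (v : nat -> E) : (0 < N)%N ->
  sf_integral T (step N v) = \sum_(i < N) mesh N *: v i.
Proof.
move=> N0; rewrite /sf_integral /= big_ord_recr/= measure_cell_last//=.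
rewrite scale0r addr0; apply: eq_bigr => i _.
by rewrite measure_cell.
Qed.

Lemma integral_scaled_indic (c : R) N k : 0 <= c ->
  (\int[mu]_(t in `[0%R, T]) (c%:E * (\1_(cell N k) t)%:E))%E =
  (c%:E * mu (`[0%R, T] `&` cell N k))%E.
Proof.
move=> c0; rewrite ge0_integralZl_EFin//=; last 1 first.
- by apply/measurable_EFinP; apply: measurable_indic; exact: measurable_cell.
- by rewrite integral_indic//= 1?setIC//; exact: measurable_cell.
Qed.

Lemma integral_step N (f : nat -> R) : (0 < N)%N -> (forall k, 0 <= f k) ->
  (\int[mu]_(t in `[0%R, T]) (f (cell_index N t))%:E)%E =
  (\sum_(i < N) mesh N * f i)%:E.
Proof.
move=> N0 f0.
transitivity (\int[mu]_(t in `[0%R, T])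
    \sum_(i < N.+1) ((f i)%:E * (\1_(cell N i) t)%:E))%E.
  apply: eq_integral => t; rewrite inE/= => tT.
  have := sf_eval_step (E := R^o) f N0 tT; rewrite /sf_eval /= => <-.
  by rewrite -sumEFin; apply: eq_bigr => i _; rewrite -EFinM mulrC.
rewrite ge0_integral_sum//=; last 2 first.
- move=> i; apply: emeasurable_funM; first exact: measurable_cst.
  by apply/measurable_EFinP; apply: measurable_indic; exact: measurable_cell.
- by move=> i t _; rewrite mule_ge0// lee_fin.
rewrite big_ord_recr/= -sumEFin.
rewrite integral_scaled_indic//= measure_cell_last// mule0 adde0.
apply: eq_bigr => i _; rewrite integral_scaled_indic// measure_cell//.
by rewrite EFinM muleC.
Qed.

Lemma mesh_cvg0 (e : R) : 0 < e -> \forall N \near \oo, mesh N <= e.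
Proof.
move=> e0; exists (Num.trunc (T / e)).+1 => // N /= H.
have N0 : (0 < N)%N by exact: leq_ltn_trans H.
rewrite /mesh ler_pdivrMr ?ltr0n// mulrC -ler_pdivrMr//.
by rewrite (le_trans (ltW (truncnS_gt _)))// ler_nat.
Qed.

End Partition.

(** * Strong measurability and the Bochner integral *)

Section StrongMeasurability.
Context {R : realType}.
Variable T : R.
Hypothesis T0 : 0 < T.
Local Notation mu := (@lebesgue_measure R).

Lemma mu_itv0T : mu ([set` `[0%R, T]] : set R) = T%:E.
Proof. by rewrite lebesgue_measure_itv/= lte_fin T0 -EFinB subr0. Qed.

Lemma integrable_bounded (f : R -> R) (M : R) : measurable_fun `[0, T] f ->
  (forall t : R, t \in `[0, T] -> `|f t| <= M) -> mu.-integrable `[0, T] (EFin \o f).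
Proof.
move=> mf fM; apply: (@le_integrable _ _ _ _ _ _ _ (EFin \o cst M)) => //=.
- exact/measurable_EFinP.
- by move=> t tT; rewrite lee_fin (le_trans (fM t tT))// ler_norm.
- apply: measurable_bounded_integrable => //.
    by rewrite [ltLHS]mu_itv0T ltry.
  by exists `|M|; split => // x Mx t _ /=; exact: ltW.
Qed.

Lemma strongly_measurable_comp (E : normedModType R) (f : R -> E) (psi : E -> R) :
  continuous psi -> strongly_measurable T f ->
  measurable_fun `[0, T] (fun t => psi (f t)).
Proof.
move=> psic [s sf].
apply: (@measurable_fun_cvg _ _ _ _ (fun n t => psi (sf_eval (s n) t))) => [m|t tT].
  exact: measurable_sf_eval.
by apply: (@continuous_cvg _ _ _ _ _ _ psi); [exact: psic|exact: sf].
Qed.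

Lemma strongly_measurable_norm (E : normedModType R) (f : R -> E) :
  strongly_measurable T f -> measurable_fun `[0, T] (fun t => `|f t|).
Proof. by apply: strongly_measurable_comp; exact: norm_continuous. Qed.

Lemma strongly_measurable_sf (E : normedModType R) (s : @simple_fun R E) :
  strongly_measurable T (sf_eval s).
Proof. by exists (fun=> s) => t _; exact: cvg_cst. Qed.

Lemma strongly_measurableB (E : normedModType R) (f g : R -> E) :
  strongly_measurable T f -> strongly_measurable T g ->
  strongly_measurable T (fun t => f t - g t).
Proof.
move=> [s sf] [r rg].
have [q qE] := choice (fun n => sf_sub_ex (s n) (r n)).
exists q => t tT; under eq_fun do rewrite qE.
by apply: cvgB; [exact: sf|exact: rg].
Qed.

Lemma strongly_measurableZ (E : normedModType R) (phi : R -> R^o) (f : R -> E) :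
  strongly_measurable T phi -> strongly_measurable T f ->
  strongly_measurable T (fun t => phi t *: f t).
Proof.
move=> [s sf] [r rg].
have [q qE] := choice (fun n => sf_scale_ex (s n) (r n)).
exists q => t tT; under eq_fun do rewrite qE.
by apply: cvgZ; [exact: sf|exact: rg].
Qed.

Lemma step_unif_cvg (E : normedModType R) (u : R -> E) :
  {within `[0, T], continuous u} -> forall e : R, 0 < e ->
  \forall N \near \oo, forall t : R, t \in `[0, T] ->
    `|u t - u (node T N (cell_index T N t))| <= e.
Proof.
move=> /heine_itv uc e e0; have [d d0 ud] := uc e e0.
have := mesh_cvg0 T (gt0_half d0); apply: filter_app.
exists 1%N => // N /= N1 md t tT.
have t0 : 0 <= t by move: tT; rewrite in_itv/= => /andP[].
apply: ud => //.
- by apply: node_itv => //; exact: cell_index_le.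
- rewrite (le_lt_trans (cell_index_dist T0 _ _))// (le_lt_trans md)//.
  by rewrite ltr_pdivrMr// ltr_pMr// ltr1n.
Qed.

Lemma continuous_strongly_measurable (E : normedModType R) (u : R -> E) :
  {within `[0, T], continuous u} -> strongly_measurable T u.
Proof.
move=> uc; exists (fun N => step T N.+1 (fun k => u (node T N.+1 k))) => t tT.
apply/cvgrPdist_le => e e0.
have [N _ HN] := step_unif_cvg uc e0.
exists N => // n /= Nn; rewrite sf_eval_step//.
by apply: HN => //=; exact: leqW.
Qed.

Lemma continuous_bounded_itv (E : normedModType R) (u : R -> E) :
  {within `[0, T], continuous u} ->
  exists2 M, 0 <= M & forall t : R, t \in `[0, T] -> `|u t| <= M.
Proof.
move=> uc.
have := @step_unif_cvg _ _ uc 1 ltr01.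
case=> N _ /(_ N.+1 (leqnSn _)) H.
exists (1 + \sum_(k < N.+2) `|u (node T N.+1 k)|).
  by rewrite addr_ge0// sumr_ge0.
move=> t tT; rewrite -[u t](subrK (u (node T N.+1 (cell_index T N.+1 t)))).
rewrite (le_trans (ler_normD _ _))// lerD//; first exact: H.
have kN : (cell_index T N.+1 t < N.+2)%N by rewrite ltnS cell_index_le.
by rewrite (bigD1 (Ordinal kN))//= lerDl sumr_ge0.
Qed.

Lemma sf_functional (E : normedModType R) (xi : dual E) (s : @simple_fun R E) :
  mu.-integrable `[0, T] (EFin \o (fun t => xi (sf_eval s t))) /\
  \int[mu]_(t in `[0, T]) xi (sf_eval s t) = xi (sf_integral T s).
Proof.
have finA (A : set R) : measurable A -> mu (`[0, T] `&` A) \is a fin_num.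
  move=> mA; rewrite ge0_fin_numE//.
  rewrite (@le_lt_trans _ _ (mu `[0, T]))//.
    by apply: le_measure; rewrite ?inE//; exact: measurableI.
  by rewrite [ltLHS]mu_itv0T ltry.
have eE t : (xi (sf_eval s t))%:E =
    (\sum_(i < sf_size s) ((xi (sf_val i) : R)%:E * (\1_(sf_set i) t)%:E))%E.
  rewrite /sf_eval linear_sum/= -sumEFin; apply: eq_bigr => i _.
  by rewrite linearZ/= -EFinM mulrC.
have intA (i : 'I_(sf_size s)) :
    mu.-integrable `[0, T] (fun t => (xi (sf_val i) : R)%:E * (\1_(sf_set i) t)%:E)%E.
  apply: integrableZl => //.
  apply: (@integrable_bounded _ 1).
    by apply: measurable_indic; exact: sf_measurable.
  by move=> t _; rewrite indicE; case: (_ \in _); rewrite ?normr0 ?normr1.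
have int : mu.-integrable `[0, T] (EFin \o (fun t => xi (sf_eval s t))).
  have -> : EFin \o (fun t => xi (sf_eval s t)) = (fun t =>
      \sum_(i < sf_size s) ((xi (sf_val i) : R)%:E * (\1_(sf_set i) t)%:E))%E.
    by apply/funext => t; exact: eE.
  by apply: integrable_sum => // i _; exact: intA.
split => //.
rewrite /Rintegral; under eq_integral do rewrite eE.
rewrite integral_sum//= /sf_integral linear_sum/=.
rewrite -sum_fine; last first.
  by move=> i _; apply: integrable_fin_num => //; exact: intA.
apply: eq_bigr => i _; rewrite linearZ/=.
rewrite integralZl//=; last first.
  apply: (@integrable_bounded _ 1).
    by apply: measurable_indic; exact: sf_measurable.
  by move=> t _; rewrite indicE; case: (_ \in _); rewrite ?normr0 ?normr1.
rewrite integral_indic//; last exact: sf_measurable.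
rewrite setIC fineM//; last by apply: finA; exact: sf_measurable.
by rewrite mulrC.
Qed.

(** Vector integrals are only ever evaluated through functionals, which reduce
    every identity to a Lebesgue integral of real functions. *)
Lemma bochner_functional (E : normedModType R) (f : R -> E) (x : E)
    (xi : dual E) : is_bochner_integral T f x ->
  mu.-integrable `[0, T] (EFin \o (fun t => xi (f t))) /\
  \int[mu]_(t in `[0, T]) xi (f t) = xi x.
Proof.
move=> [smf [s [sf sx]]].
have xic : continuous (xi : E -> R) := @linop_continuous _ _ _ xi.
have mn n : measurable_fun `[0, T] (fun t => `|f t - sf_eval (s n) t|).
  apply: strongly_measurable_norm.
  by apply: strongly_measurableB => //; exact: strongly_measurable_sf.
have mxi n : measurable_fun `[0, T] (fun t => xi (f t - sf_eval (s n) t)).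
  apply: strongly_measurable_comp => //.
  by apply: strongly_measurableB => //; exact: strongly_measurable_sf.
have mxin n : measurable_fun `[0, T] (fun t => `|xi (f t - sf_eval (s n) t)|).
  by apply: measurableT_comp (mxi n); exact: normr_measurable.
have dle n (t : R) : `|xi (f t - sf_eval (s n) t)| <=
    `|xi| * `|f t - sf_eval (s n) t| by exact: le_norm_linop.
pose a n := (\int[mu]_(t in `[0%R, T]) (`|f t - sf_eval (s n) t|)%:E)%E.
have xile n : (\int[mu]_(t in `[0%R, T]) (`|xi (f t - sf_eval (s n) t)|)%:E <=
   (`|xi|)%:E * a n)%E.
  rewrite -ge0_integralZl//=; last by apply/measurable_EFinP; exact: mn.
  apply: ge0_le_integral => //=.
  - by apply/measurable_EFinP; exact: mxin.
  - by apply/measurable_EFinP; apply: measurable_funM => //; exact: mn.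
  - by move=> t _; rewrite -EFinM lee_fin.
have intd n : (a n < +oo)%E ->
    mu.-integrable `[0, T] (EFin \o (fun t => xi (f t - sf_eval (s n) t))).
  move=> an; apply/integrableP; split.
    by apply/measurable_EFinP; exact: mxi.
  rewrite (le_lt_trans (xile n))// lte_mul_pinfty// lee_fin//.
have xiE n t : xi (f t) = xi (f t - sf_eval (s n) t) + xi (sf_eval (s n) t).
  by rewrite -linearD subrK.
have afin : \forall n \near \oo, a n \is a fin_num.
  by move/fine_cvgP : sf => [].
have int : mu.-integrable `[0, T] (EFin \o (fun t => xi (f t))).
  have [n _ /(_ n (leqnn _)) an] := afin.
  pose g1 t : R := xi (f t - sf_eval (s n) t).
  pose g2 t : R := xi (sf_eval (s n) t).
  have -> : EFin \o (fun t => xi (f t)) = ((EFin \o g1) \+ (EFin \o g2))%E.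
    by apply/funext => t /=; rewrite -EFinD -xiE.
  apply: integrableD => //; last exact: (sf_functional _ _).1.
  by apply: intd; rewrite -ge0_fin_numE// integral_ge0.
split => //.
have c1 : xi (sf_integral T (s n)) @[n --> \oo] --> (xi x : R).
  by apply: (@continuous_cvg _ _ _ _ _ _ (xi : E -> R)); [exact: xic|exact: sx].
have c2 : xi (sf_integral T (s n)) @[n --> \oo] -->
    (\int[mu]_(t in `[0, T]) xi (f t)).
  move/fine_cvgP : sf => [_ /cvgrPdist_le sf].
  apply/cvgrPdist_le => e e0.
  have e1 : 0 < e / (`|xi| + 1) by rewrite divr_gt0// ltr_wpDl.
  near=> n.
  have an : a n \is a fin_num by near: n.
  have h : `|fine (a n)| <= e / (`|xi| + 1).
    by rewrite -normrN -sub0r; near: n; exact: sf.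
  rewrite -(sf_functional xi (s n)).2 -RintegralB//; last exact: (sf_functional _ _).1.
  have intn := intd n; rewrite -ge0_fin_numE ?integral_ge0// in intn.
  rewrite (_ : (fun t => xi (f t) - xi (sf_eval (s n) t)) =
    (fun t => xi (f t - sf_eval (s n) t))); last first.
    by apply/funext => t; rewrite linearB.
  rewrite (le_trans (le_normr_Rintegral _ (intn an)))//.
  rewrite (@le_trans _ _ (`|xi| * fine (a n)))//.
    rewrite /Rintegral -[leRHS]/(fine (EFin `|xi|) * _) -fineM// fine_le//.
    - by rewrite ge0_fin_numE ?integral_ge0// (le_lt_trans (xile n))// ltey_eq fin_numM.
    - by rewrite fin_numM.
  rewrite ger0_norm ?fine_ge0 ?integral_ge0// in h.
  rewrite (@le_trans _ _ ((`|xi| + 1) * fine (a n)))//.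
    by rewrite ler_wpM2r ?lerDl// fine_ge0// integral_ge0.
  by rewrite mulrC -ler_pdivlMr// ltr_wpDl.
exact: (cvg_unique (@Rhausdorff R) c2 c1).
Unshelve. all: by end_near. Qed.

End StrongMeasurability.

(** * The weak derivative determines the increments *)

Section QuadraticRemainder.
Context {R : realType}.

(** A remainder bounded by a square identifies the derivative; this spares a
    case analysis at the knots of the piecewise quadratic functions below. *)
Lemma quadratic_remainder_derive (f : R -> R) (x d C : R) :
  (forall k, `|f (x + k) - f x - d * k| <= C * k ^+ 2) ->
  is_derive x 1 f d.
Proof.
move=> fC.
have C0 : 0 <= C by have := fC 1; rewrite expr1n [leRHS]mulr1; exact: le_trans.
have C1 : 0 < C + 1 by rewrite ltr_wpDl.
have cv : h^-1 *: (f (h *: 1 + x) - f x) @[h --> 0^'] --> d.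
  apply/cvgrPdist_le => e e0; near=> h.
  have h0 : h != 0 by near: h; exact: nbhs_dnbhs_neq.
  rewrite /GRing.scale/= mulr1 addrC (addrC h).
  have -> : - (h^-1 * (f (x + h) - f x)) + d = - (h^-1 * (f (x + h) - f x - d * h)).
    by field.
  rewrite normrN normrM normfV ler_pdivrMl ?normr_gt0//.
  rewrite (le_trans (fC h))// -(real_normK (num_real h)) expr2 mulrA mulrC.
  rewrite ler_wpM2l//.
  rewrite (@le_trans _ _ ((C + 1) * `|h|))// ?ler_wpM2r// ?lerDl//.
  rewrite -ler_pdivlMl// mulrC ltW//; near: h; apply: dnbhs0_lt.
  by rewrite divr_gt0.
apply: DeriveDef; first by apply/cvg_ex; exists d.
by apply/cvg_lim.
Unshelve. all: by end_near. Qed.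

Definition posq (x : R) : R := (Num.max x 0) ^+ 2.

Lemma posq_remainder (x k : R) :
  0 <= posq (x + k) - posq x - 2 * Num.max x 0 * k <= k ^+ 2.
Proof.
rewrite /posq; have [h1|h1] := leP (x + k) 0; have [h2|h2] := leP x 0.
- by apply/andP; split; nra.
- by apply/andP; split; nra.
- by apply/andP; split; nra.
- by apply/andP; split; nra.
Qed.

(** A C^1 transition from 0 to 1 on [-h, h], the primitive of the hat function
    [tent]. Being a second difference of [posq], it inherits its derivative and
    its remainder. *)
Definition bstep (h x : R) : R :=
  (posq (x + h) - 2 * posq x + posq (x - h)) / (2 * h ^+ 2).

Definition tent (h x : R) : R :=
  (Num.max (x + h) 0 - 2 * Num.max x 0 + Num.max (x - h) 0) / h ^+ 2.

Lemma is_derive_bstep (h c x : R) : 0 < h ->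
  is_derive x 1 (fun y => bstep h (y - c)) (tent h (x - c)).
Proof.
move=> h0; apply: (@quadratic_remainder_derive _ _ _ (4 / (2 * h ^+ 2))) => k.
have hh : 0 < h ^+ 2 by rewrite exprn_gt0.
set y := x - c; have -> : x + k - c = y + k by rewrite /y; ring.
have /andP[a1 a2] := posq_remainder (y + h) k.
have /andP[b1 b2] := posq_remainder y k.
have /andP[c1 c2] := posq_remainder (y - h) k.
have -> : bstep h (y + k) - bstep h y - tent h y * k =
   ((posq (y + h + k) - posq (y + h) - 2 * Num.max (y + h) 0 * k)
   - 2 * (posq (y + k) - posq y - 2 * Num.max y 0 * k)
   + (posq (y - h + k) - posq (y - h) - 2 * Num.max (y - h) 0 * k))
   / (2 * h ^+ 2).
  rewrite /bstep /tent (addrAC y k h) (addrAC y k (- h)).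
  by field; rewrite gt_eqF.
have hi : 0 <= (2 * h ^+ 2)^-1 by rewrite invr_ge0 ltW// mulr_gt0.
rewrite normrM (ger0_norm hi) [leRHS]mulrAC ler_wpM2r//.
by rewrite ler_norml; apply/andP; split; lra.
Qed.

Lemma tent_ge0 (h x : R) : 0 < h -> 0 <= tent h x.
Proof.
move=> h0; rewrite /tent divr_ge0 ?sqr_ge0//.
by have [?|?] := leP (x + h) 0; have [?|?] := leP x 0; have [?|?] := leP (x - h) 0; lra.
Qed.

Lemma tent_eq0 (h x : R) : 0 < h -> h <= `|x| -> tent h x = 0.
Proof.
move=> h0 hx; rewrite /tent.
suff -> : Num.max (x + h) 0 - 2 * Num.max x 0 + Num.max (x - h) 0 = 0 by rewrite mul0r.
move: hx; rewrite ler_normr => /orP[] hx;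
by have [?|?] := leP (x + h) 0; have [?|?] := leP x 0; have [?|?] := leP (x - h) 0; lra.
Qed.

Lemma bstep_le0 (h x : R) : 0 < h -> x <= - h -> bstep h x = 0.
Proof.
move=> h0 hx; rewrite /bstep /posq.
by rewrite !max_r ?expr0n/= ?mulr0 ?subr0 ?addr0 ?mul0r//; lra.
Qed.

Lemma bstep_ge1 (h x : R) : 0 < h -> h <= x -> bstep h x = 1.
Proof.
move=> h0 hx; rewrite /bstep /posq !max_l; [|lra..].
by field; rewrite gt_eqF.
Qed.

Lemma bstep_itv (h x : R) : 0 < h -> 0 <= bstep h x <= 1.
Proof.
move=> h0; have hh : 0 < 2 * h ^+ 2 by rewrite mulr_gt0// exprn_gt0.
rewrite /bstep divr_ge0 ?(ltW hh)//=; last first.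
  rewrite /posq; have [?|?] := leP (x + h) 0; have [?|?] := leP x 0; have [?|?] := leP (x - h) 0; nra.
rewrite ler_pdivrMr// mul1r.
by rewrite /posq; have [?|?] := leP (x + h) 0; have [?|?] := leP x 0; have [?|?] := leP (x - h) 0; nra.
Qed.

Lemma continuous_tent (h c : R) : continuous (fun x => tent h (x - c)).
Proof.
have mc a : continuous (fun x : R => Num.max (x - a) 0).
  move=> x; apply/cvgrPdist_le => e e0; apply/nbhs_ballP; exists e => //= y.
  rewrite /ball/= => /ltW; apply: le_trans; rewrite ler_normr !ler_norml.
  have [?|?] := leP (x - a) 0; have [?|?] := leP (y - a) 0;
    have [?|?] := leP x y; apply/orP; (left; lra) || (right; lra).
have -> : (fun x => tent h (x - c)) = (fun x => (Num.max (x - (c - h)) 0 -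
    2 * Num.max (x - c) 0 + Num.max (x - (c + h)) 0) / h ^+ 2).
  by apply/funext => y; rewrite /tent opprB opprD (addrC h) !addrA.
move=> x; apply: cvgMr_tmp.
apply: cvgD; [apply: cvgB; [exact: mc|]|exact: mc].
by apply: cvgMl_tmp; exact: mc.
Qed.

End QuadraticRemainder.

Section WeakFTC.
Context {R : realType}.
Variable T : R.
Hypothesis T0 : 0 < T.
Local Notation mu := (@lebesgue_measure R).

Lemma continuous_itv_integrable (f : R -> R) :
  {within `[0, T], continuous f} -> mu.-integrable `[0, T] (EFin \o f).
Proof.
move=> fc; have [M M0 fM] := continuous_bounded_itv (E := R^o) T0 fc.
apply: integrable_bounded fM => //.
apply: (@strongly_measurable_comp _ _ R^o f id); first by move=> x; exact: cvg_id.
exact: continuous_strongly_measurable.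
Qed.

Lemma is_derive_within_continuous (f df : R -> R) (a b : R) :
  (forall x : R, is_derive x 1 f (df x)) -> {within `[a, b], continuous f}.
Proof.
by move=> fd; apply: derivable_within_continuous => x _; exact: (@ex_derive _ _ _ _ _ _ _ (fd x)).
Qed.

Lemma integral_is_derive (f df : R -> R) (a b : R) : a < b ->
  (forall x : R, is_derive x 1 f (df x)) -> {within `[a, b], continuous df} ->
  \int[mu]_(x in `[a, b]) df x = f b - f a.
Proof.
move=> ab fd dfc; rewrite /Rintegral (@continuous_FTC2 _ _ f)//.
  have fc x : {for x, continuous f}.
    apply: differentiable_continuous; apply/derivable1_diffP.
    exact: (@ex_derive _ _ _ _ _ _ _ (fd x)).
  split.
  - by move=> x _; exact: (@ex_derive _ _ _ _ _ _ _ (fd x)).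
  - by apply: cvg_at_right_filter; exact: fc.
  - by apply: cvg_at_left_filter; exact: fc.
by move=> x _; rewrite derive1E; exact: (@derive_val _ _ _ _ _ _ _ (fd x)).
Qed.

(** The hat functions form an approximate identity: they are nonnegative, have
    integral 1 and support shrinking to c. *)
Lemma tent_average (lam : R -> R) (c h e : R) : 0 < h -> h < c -> c + h < T ->
  {within `[0, T], continuous lam} ->
  (forall x, x \in `[0, T] -> `|x - c| <= h -> `|lam x - lam c| <= e) ->
  `|\int[mu]_(x in `[0, T]) (tent h (x - c) * lam x) - lam c| <= e.
Proof.
move=> h0 hc chT lamc lame.
have tc : {within `[0, T], continuous (fun x => tent h (x - c))}.
  exact/continuous_subspaceT/continuous_tent.
have tint : \int[mu]_(x in `[0, T]) tent h (x - c) = 1.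
  have /= -> := integral_is_derive T0 (fun x => is_derive_bstep c x h0) tc.
  by rewrite bstep_ge1 ?bstep_le0 ?subr0//; lra.
have e0 : 0 <= e.
  apply: le_trans (lame c _ _); rewrite ?subrr ?normr0 ?(ltW h0)//.
  by rewrite in_itv/=; apply/andP; split; lra.
have i1 : mu.-integrable `[0, T] (EFin \o (fun x => tent h (x - c))).
  exact: continuous_itv_integrable.
have i2 : mu.-integrable `[0, T] (EFin \o (fun x => tent h (x - c) * lam x)).
  apply: continuous_itv_integrable => x.
  by apply: (@cvgM _ _ _ _ (fun x => tent h (x - c)) lam); [exact: tc|exact: lamc].
have i3 : mu.-integrable `[0, T] (EFin \o (fun x => tent h (x - c) * lam c)).
  apply: continuous_itv_integrable => x.
  by apply: (@cvgM _ _ _ _ (fun x => tent h (x - c)) (cst (lam c)));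
    [exact: tc|exact: cvg_cst].
have i4 : mu.-integrable `[0, T] (EFin \o (fun x => tent h (x - c) * e)).
  apply: continuous_itv_integrable => x.
  by apply: (@cvgM _ _ _ _ (fun x => tent h (x - c)) (cst e));
    [exact: tc|exact: cvg_cst].
have lamcE : lam c = \int[mu]_(x in `[0, T]) (tent h (x - c) * lam c).
  by rewrite RintegralZr// tint mul1r.
have -> : e = \int[mu]_(x in `[0, T]) (tent h (x - c) * e).
  by rewrite RintegralZr// tint mul1r.
rewrite [X in _ - X]lamcE -RintegralB//.
have bd x : x \in `[0, T] ->
    `|tent h (x - c) * lam x - tent h (x - c) * lam c| <= tent h (x - c) * e.
  move=> xT; rewrite -mulrBr normrM ger0_norm ?tent_ge0//.
  have [hx|hx] := leP h `|x - c|; first by rewrite tent_eq0// !mul0r.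
  by rewrite ler_wpM2l ?tent_ge0// lame// ltW.
have i5 : mu.-integrable `[0, T] (EFin \o (fun x => tent h (x - c) * lam x - tent h (x - c) * lam c)).
  exact: (@integrableB _ _ _ mu `[0, T]%classic (measurable_itv _) _ _ i2 i3).
rewrite (le_trans (le_normr_Rintegral _ i5))//.
apply: le_Rintegral => //.
by have := integrable_norm i5.
Qed.

Lemma bstep_homo (h a b : R) : 0 < h -> a <= b -> bstep h a <= bstep h b.
Proof.
move=> h0 ab; rewrite -(subr0 a) -(subr0 b).
have dc (x : R) := is_derive_bstep 0 x h0.
have [c _ /= bE] := MVT_segment ab (fun x _ => dc x)
  (is_derive_within_continuous dc).
by rewrite -subr_ge0 bE mulr_ge0 ?tent_ge0// subr_ge0.
Qed.

(** A C^1 approximation of the indicator of [s, t], and a test function. *)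
Definition bump (s t h x : R) := bstep h (x - s) - bstep h (x - t).

Lemma is_derive_bump (s t h x : R) : 0 < h ->
  is_derive x 1 (bump s t h) (tent h (x - s) - tent h (x - t)).
Proof.
move=> h0; exact: (is_deriveB (is_derive_bstep s x h0) (is_derive_bstep t x h0)).
Qed.

Lemma test_fun_bump (s t h : R) : 0 < h -> h < s -> t + h < T -> s <= t ->
  test_fun T (bump s t h).
Proof.
move=> h0 hs thT st; split.
- by move=> x; exact: (@ex_derive _ _ _ _ _ _ _ (is_derive_bump s t x h0)).
- have -> : derive1 (bump s t h) = (fun x => tent h (x - s) - tent h (x - t)).
    apply/funext => x; rewrite derive1E.
    exact: (@derive_val _ _ _ _ _ _ _ (is_derive_bump s t x h0)).
  by move=> x; apply: cvgB; exact: continuous_tent.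
- exists (s - h), (t + h); split => //; first by rewrite subr_gt0.
  move=> x; rewrite in_itv/= => /negP H; rewrite /bump.
  have [x1|x1] := leP x (s - h).
    by rewrite !bstep_le0 ?subrr//; lra.
  rewrite !bstep_ge1 ?subrr// leNgt; apply/negP => x2; apply: H;
  by apply/andP; split; lra.
Qed.

Lemma bump_itv (s t h x : R) : 0 < h -> s + h <= t - h ->
  x \notin `[s - h, s + h] -> x \notin `[t - h, t + h] ->
  bump s t h x = (x \in `[s, t])%:R.
Proof.
move=> h0 sht; rewrite !in_itv/= !negb_and -!ltNge => H1 H2; rewrite /bump.
have [xs|xs] := orP H1.
  rewrite !bstep_le0 ?subrr//; [|lra..].
  by rewrite (_ : (s <= x) = false)// leNgt; apply/negbF; lra.
have [xt|xt] := orP H2.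
  rewrite bstep_ge1 ?(bstep_le0 (x := x - t)) ?subr0//; [|lra..].
  by rewrite (_ : (s <= x) && (x <= t))//; apply/andP; split; lra.
rewrite !bstep_ge1 ?subrr//; [|lra..].
by rewrite (_ : (x <= t) = false) ?andbF// leNgt; apply/negbF; lra.
Qed.

Lemma bump_le1 (s t h x : R) : 0 < h -> `|bump s t h x| <= 1.
Proof.
move=> h0; have /andP[? ?] := bstep_itv (x - s) h0.
have /andP[? ?] := bstep_itv (x - t) h0.
by rewrite /bump ler_norml; apply/andP; split; lra.
Qed.

(** The two integrands differ only on the transition layers, whose measure tends
    to 0, and there by at most the modulus of [gam]: absolute continuity of the
    integral concludes. *)
Lemma bump_integral_cvg (gam : R -> R) (s t e : R) :
  mu.-integrable `[0, T] (EFin \o gam) -> 0 < s -> s < t -> t < T -> 0 < e ->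
  \forall h \near (0 : R)^'+,
  `|\int[mu]_(x in `[0, T]) (bump s t h x * gam x) - \int[mu]_(x in `[s, t]) gam x| <= e.
Proof.
move=> gami s0 st tT e0.
have gami' : mu.-integrable setT (EFin \o (gam \_ `[0, T])).
  by rewrite -restrict_EFin; apply/integrable_restrict => //=; rewrite setTI.
have [d2 [d20 hd2]] := integral_normr_continuous gami' e0.
near=> h.
have h0 : 0 < h by [].
have hst : h < (t - s) / 2 by near: h; apply: nbhs_right_lt; rewrite divr_gt0// subr_gt0.
have hd4 : h < d2 / 4 by near: h; apply: nbhs_right_lt; rewrite divr_gt0.
pose I := \int[mu]_(x in `[0, T]) (bump s t h x * gam x).
pose J := \int[mu]_(x in `[s, t]) gam x.
rewrite -/I -/J.
have JE : J = \int[mu]_(x in `[0, T]) ((gam \_ `[s, t]) x).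
  rewrite -Rintegral_mkcondr /J; congr (Rintegral _ _ _).
  rewrite setIidr// => x /=; rewrite !in_itv/= => /andP[? ?].
  by apply/andP; split; lra.
have mgam : measurable_fun `[0, T] gam.
  by apply/measurable_EFinP; exact: (measurable_int _ gami).
have mb : measurable_fun `[0, T] (bump s t h).
  apply: (@strongly_measurable_comp _ T R^o _ id); first by move=> x; exact: cvg_id.
  apply: continuous_strongly_measurable => //.
  exact: (is_derive_within_continuous (fun x => is_derive_bump s t x h0)).
have i1 : mu.-integrable `[0, T] (EFin \o (fun x => bump s t h x * gam x)).
  apply: le_integrable gami => //.
    by apply/measurable_EFinP; exact: measurable_funM.
  by move=> x _ /=; rewrite lee_fin normrM ler_piMl// bump_le1.
have i2 : mu.-integrable `[0, T] (EFin \o (gam \_ `[s, t])).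
  rewrite -restrict_EFin; apply/integrable_restrict => //=.
  by apply: integrableS gami => //; first [exact: measurableI|exact: subIsetl].
rewrite JE /I -RintegralB//.
have i3 := @integrableB _ _ _ mu `[0, T]%classic (measurable_itv _) _ _ i1 i2.
rewrite (le_trans (le_normr_Rintegral _ i3))//.
pose B : set R := `[s - h, s + h]%classic `|` `[t - h, t + h]%classic.
have mB : measurable B by apply: measurableU; exact: measurable_itv.
have muB : (mu B < d2%:E)%E.
  have e1 c : mu `[c - h, c + h]%classic = (2 * h)%:E.
    rewrite lebesgue_measure_itv/= lte_fin ifT; last by lra.
    by rewrite -EFinB; congr (_%:E); lra.
  have le12 : (mu B <= mu `[(s - h)%R, (s + h)%R]%classic +
      mu `[(t - h)%R, (t + h)%R]%classic)%E.
    by apply: measureU2; exact: measurable_itv.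
  rewrite (le_lt_trans le12)// !e1 -EFinD lte_fin; clear -hd4; lra.
have /ltW/(le_trans _) := hd2 B mB muB; apply.
have -> : \int[mu]_(x in B) `|(gam \_ `[0, T]) x| =
    \int[mu]_(x in `[0, T]) (((fun x => `|gam x|) \_ B) x).
  rewrite -Rintegral_mkcondr setIC Rintegral_mkcondr.
  apply: eq_Rintegral => x _; rewrite !patchE.
  by case: ifPn => // _; rewrite normr0.
have gamn := integrable_norm gami.
apply: le_Rintegral => //.
- by have := integrable_norm i3.
- rewrite -restrict_EFin; apply/integrable_restrict => //=.
  by apply: integrableS gamn => //; first [exact: measurableI|exact: subIsetl].
move=> x xT /=; rewrite !patchE.
have [xB|xB] := boolP (x \in B).
  have /andP[b1 b2] := bstep_itv (x - s) h0.
  have /andP[b3 b4] := bstep_itv (x - t) h0.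
  have tst : bstep h (x - t) <= bstep h (x - s).
    by apply: bstep_homo => //; rewrite lerD2l lerN2 ltW.
  have /andP[b5 b6] : 0 <= bump s t h x <= 1.
    by rewrite /bump; clear -b1 b2 b3 b4 tst; apply/andP; split; lra.
  case: ifP => _; last by rewrite subr0 normrM ler_piMl// bump_le1.
  rewrite -{2}[gam x]mul1r -mulrBl normrM ler_piMl//.
  by rewrite ler_norml; clear -b5 b6; apply/andP; split; lra.
rewrite bump_itv//; [|lra| |].
- rewrite -[x \in `[s, t]%classic]/(x \in [set` `[s, t]]) mem_setE.
  by case: ifP => _; rewrite ?mul1r ?mul0r subrr normr0.
- by apply: contraNN xB => xB; rewrite inE; left.
- by apply: contraNN xB => xB; rewrite inE; right.
Unshelve. all: by end_near. Qed.

Lemma ler_dist3 (a b I J ls lt e : R) : a - b = - I ->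
  `|a - ls| <= e -> `|b - lt| <= e -> `|I - J| <= e ->
  `|lt - ls - J| <= 3 * e.
Proof.
move=> HI; rewrite !ler_norml => /andP[? ?] /andP[? ?] /andP[? ?].
by apply/andP; split; lra.
Qed.

(** Test with [bump]: its derivative is the difference of two hat functions,
    which average [lam] near the end points, while the bump itself tends to the
    indicator of [s, t]. *)
Lemma weak_ftc_interior (lam gam : R -> R) (s t : R) :
  {within `[0, T], continuous lam} -> mu.-integrable `[0, T] (EFin \o gam) ->
  (forall phi, test_fun T phi ->
    \int[mu]_(x in `[0, T]) (derive1 phi x * lam x) =
    - \int[mu]_(x in `[0, T]) (phi x * gam x)) ->
  0 < s -> s < t -> t < T ->
  lam t - lam s = \int[mu]_(x in `[s, t]) gam x.
Proof.
move=> lamc gami H s0 st tT.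
apply/eqP; rewrite -subr_eq0 -normr_le0; apply/ler_addgt0Pr => e' e'0.
rewrite add0r.
pose e := e' / 3; have e0 : 0 < e by rewrite divr_gt0.
have [d1 d10 hd1] := heine_itv (E := R^o) lamc e0.
near (0 : R)^'+ => h.
have h0 : 0 < h by [].
have hs : h < s by near: h; exact: nbhs_right_lt.
have hd : h < d1 by near: h; exact: nbhs_right_lt.
have ht : h < T - t by near: h; apply: nbhs_right_lt; rewrite subr_gt0.
have tfb : test_fun T (bump s t h) by apply: test_fun_bump => //; lra.
have cts c : {within `[0, T], continuous (fun x => tent h (x - c))}.
  exact/continuous_subspaceT/continuous_tent.
have it c : mu.-integrable `[0, T] (EFin \o (fun x => tent h (x - c) * lam x)).
  apply: continuous_itv_integrable => x.
  by apply: (@cvgM _ _ _ _ (fun x => tent h (x - c)) lam); [exact: cts|exact: lamc].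
have avg c : h < c -> c + h < T ->
    `|\int[mu]_(x in `[0, T]) (tent h (x - c) * lam x) - lam c| <= e.
  move=> hc chT; apply: tent_average => // x xT xc.
  by apply: hd1 => //; [rewrite in_itv/=; apply/andP; split; lra|exact: le_lt_trans hd].
have E1 : \int[mu]_(x in `[0, T]) (derive1 (bump s t h) x * lam x) =
    \int[mu]_(x in `[0, T]) (tent h (x - s) * lam x) -
    \int[mu]_(x in `[0, T]) (tent h (x - t) * lam x).
  rewrite -RintegralB//; apply: eq_Rintegral => x _; rewrite -mulrBl derive1E.
  by congr (_ * _); exact: (@derive_val _ _ _ _ _ _ _ (is_derive_bump s t x h0)).
pose I := \int[mu]_(x in `[0, T]) (bump s t h x * gam x).
pose J := \int[mu]_(x in `[s, t]) gam x.
have IJ : `|I - J| <= e by rewrite /I /J; near: h; exact: bump_integral_cvg.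
have := H _ tfb; rewrite E1 -/I -/J => HI.
have htT : t + h < T by clear -ht; lra.
have hsT : s + h < T by rewrite (lt_trans _ htT)// ltrD2r.
have ht0 : h < t := lt_trans hs st.
have a1 := avg s hs hsT.
have a2 := avg t ht0 htT.
rewrite (_ : e' = 3 * e); last by rewrite /e; field.
exact: ler_dist3 HI a1 a2 IJ.
Unshelve. all: by end_near. Qed.

End WeakFTC.

Section Increments.
Context {R : realType}.
Variable T : R.
Hypothesis T0 : 0 < T.
Local Notation mu := (@lebesgue_measure R).

Lemma constant_closure (f : R -> R) : {within `[0, T], continuous f} ->
  (forall s t, 0 < s -> s < t -> t < T -> f s = f t) ->
  forall t, t \in `[0, T] -> f t = f (T / 2).
Proof.
move=> fc fE t tT.
have [_ f0 fT] := (continuous_within_itvP f T0).1 fc.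
have fi s : 0 < s -> s < T -> f s = f (T / 2).
  move=> s0 sT; have [H|H|->//] := ltgtP s (T / 2).
    by apply: fE => //; lra.
  by apply/esym; apply: fE => //; lra.
have c1 : f @ 0^'+ --> f (T / 2).
  apply: cvg_near_cst; near=> x; apply: fi; first by near: x; exact: nbhs_right_gt.
  by near: x; exact: nbhs_right_lt.
have c2 : f @ T^'- --> f (T / 2).
  apply: cvg_near_cst; near=> x; apply: fi; last by near: x; exact: nbhs_left_lt.
  by near: x; exact: nbhs_left_gt.
move: tT; rewrite in_itv/= => /andP[]; rewrite le_eqVlt => /predU1P[<- _|t0].
  exact: (cvg_unique (@Rhausdorff R) f0 c1).
rewrite le_eqVlt => /predU1P[->|tT]; last exact: fi.
exact: (cvg_unique (@Rhausdorff R) fT c2).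
Unshelve. all: by end_near. Qed.

(** The interior identity extends to the end points since both sides are
    continuous. *)
Lemma weak_ftc (lam gam : R -> R) :
  {within `[0, T], continuous lam} -> mu.-integrable `[0, T] (EFin \o gam) ->
  (forall phi, test_fun T phi ->
    \int[mu]_(x in `[0, T]) (derive1 phi x * lam x) =
    - \int[mu]_(x in `[0, T]) (phi x * gam x)) ->
  forall s t, 0 <= s -> s <= t -> t <= T ->
  lam t - lam s = \int[mu]_(x in `[s, t]) gam x.
Proof.
move=> lamc gami H.
pose G x := parameterized_integral mu 0 x gam.
have Gc : {within `[0, T], continuous G}.
  by apply: parameterized_integral_continuous => //; exact: ltW.
have GB s t : 0 <= s -> s <= t -> t <= T -> G t - G s = \int[mu]_(x in `[s, t]) gam x.
  move=> s0 st tT.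
  have i1 : mu.-integrable `[0, t] (EFin \o gam).
    by apply: integrableS gami => //; apply: subset_itvl; rewrite bnd_simp.
  rewrite /G /parameterized_integral Rintegral_itvB//= ?bnd_simp//.
  rewrite Rintegral_itv_obnd_cbnd//.
  by apply: integrableS i1 => //; apply: subset_itvr; rewrite bnd_simp.
have fc : {within `[0, T], continuous (fun x => lam x - G x)}.
  apply/subspace_continuousP => x xT.
  by apply: cvgB; [exact: (subspace_continuousP _ _).1 lamc x xT
                  |exact: (subspace_continuousP _ _).1 Gc x xT].
have cst := constant_closure fc.
move=> s t s0 st tT; rewrite -GB//.
suff : lam t - G t = lam s - G s by lra.
have H' a b : 0 < a -> a < b -> b < T -> lam a - G a = lam b - G b.
  move=> a0 ab bT.
  have := weak_ftc_interior T0 lamc gami H a0 ab bT.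
  by rewrite -GB ?(ltW a0) ?(ltW ab) ?(ltW bT)//; lra.
rewrite (cst H' t) ?(cst H' s)// in_itv/=; apply/andP; split; lra.
Qed.

Lemma integrable_le (f g : R -> R) : measurable_fun `[0, T] f ->
  (forall t, t \in `[0, T] -> `|f t| <= g t) ->
  mu.-integrable `[0, T] (EFin \o g) -> mu.-integrable `[0, T] (EFin \o f).
Proof.
move=> mf fg; apply: le_integrable => //; first exact/measurable_EFinP.
by move=> t tT; rewrite lee_fin (le_trans (fg t tT))// ler_norm.
Qed.

Lemma integrable_addr (f g : R -> R) :
  mu.-integrable `[0, T] (EFin \o f) -> mu.-integrable `[0, T] (EFin \o g) ->
  mu.-integrable `[0, T] (EFin \o (fun t => f t + g t)).
Proof. by move=> fi gi; exact: (@integrableD _ _ _ mu _ (measurable_itv _) _ _ fi gi). Qed.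

Lemma integrable_mull (c : R) (f : R -> R) :
  mu.-integrable `[0, T] (EFin \o f) ->
  mu.-integrable `[0, T] (EFin \o (fun t => c * f t)).
Proof. by move=> fi; exact: (@integrableZl _ _ _ mu _ (measurable_itv _) c _ fi). Qed.

Variable E : normedModType R.

Lemma L2_sqnorm_integrable (g : R -> E) : L2 T g ->
  mu.-integrable `[0, T] (EFin \o (fun t => `|g t| ^+ 2)).
Proof.
move=> [gm gL2]; have mn := strongly_measurable_norm gm.
have mn2 : measurable_fun `[0, T] (fun t => `|g t| ^+ 2) by exact: measurable_funX.
apply/integrableP; split; first by apply/measurable_EFinP; exact: mn2.
apply: le_lt_trans gL2; rewrite /L2normsq le_eqVlt; apply/orP; left; apply/eqP.
by apply: eq_integral => t _ /=; rewrite ger0_norm// sqr_ge0.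
Qed.

Lemma L2_functional_integrable (g : R -> E) (xi : dual E) : L2 T g ->
  mu.-integrable `[0, T] (EFin \o (fun t => xi (g t))).
Proof.
move=> [gm gL2].
have xic : continuous (xi : E -> R) := @linop_continuous _ _ _ xi.
have mxi : measurable_fun `[0, T] (fun t => xi (g t)).
  exact: strongly_measurable_comp.
have mn := strongly_measurable_norm gm.
apply: (@integrable_le _ (fun t => `|xi| * (1 + `|g t| ^+ 2))) => //.
  move=> t _ /=; rewrite (le_trans (le_norm_linop _ _))//.
  by rewrite ler_wpM2l//; have := sqr_ge0 (`|g t| - 2^-1); nra.
apply: integrable_mull; apply: integrable_addr; last exact: L2_sqnorm_integrable.
apply: (@integrable_bounded _ _ T0 (cst 1) 1); first exact: measurable_cst.
by move=> t _ /=; rewrite normr1.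
Qed.

(** The bridge from weak derivatives to increments: the composition of u with a
    functional satisfies the assumptions of [weak_ftc]. *)
Lemma wderiv_ftc (u g : R -> E) (xi : dual E) :
  {within `[0, T], continuous u} -> L2 T g -> is_wderiv T u g ->
  forall s t, 0 <= s -> s <= t -> t <= T ->
  xi (u t) - xi (u s) = \int[mu]_(x in `[s, t]) xi (g x).
Proof.
move=> uc gL2 ug.
have xic : continuous (xi : E -> R) := @linop_continuous _ _ _ xi.
apply: weak_ftc.
- apply/subspace_continuousP => x xT.
  apply: (@continuous_cvg _ _ _ _ _ _ (xi : E -> R)); first exact: xic.
  exact: (subspace_continuousP _ _).1 uc x xT.
- exact: L2_functional_integrable.
move=> phi /ug[x [bx1 bx2]].
have [_ e1] := bochner_functional T0 xi bx1.
have [_ e2] := bochner_functional T0 xi bx2.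
transitivity (xi x : R).
  by rewrite -e1; apply: eq_Rintegral => t _; rewrite linearZ.
apply/esym; rewrite -[RHS]opprK; congr (- _).
transitivity (xi (- x) : R); last by rewrite linearN.
rewrite -e2.
by apply: eq_Rintegral => t _; rewrite linearZ.
Qed.

End Increments.

(** * Discrete energy of a function of class H1, uniqueness of derivatives *)

Lemma integrable_itvS (R : realType) (T s t : R) (f : R -> R) :
  0 <= s -> t <= T ->
  lebesgue_measure.-integrable `[0, T] (EFin \o f) ->
  lebesgue_measure.-integrable `[s, t] (EFin \o f).
Proof.
move=> s0 tT; apply: integrableS => //.
by apply: subset_itv; rewrite bnd_simp.
Qed.

Section Energy.
Context {R : realType} {E : normedModType R}.
Variable T : R.
Hypothesis T0 : 0 < T.
Hypothesis nE : norming_dual E.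
Local Notation mu := (@lebesgue_measure R).

(** The energy of the piecewise affine interpolant of [u]. Its supremum over N
    is the squared L^2 norm of the weak derivative; being a finite sum of norms
    of increments, it gives elementary access to weak lower semicontinuity and to
    the construction of weak derivatives. *)
Definition discrete_energy N (u : R -> E) : R :=
  \sum_(k < N) `|u (node T N k.+1) - u (node T N k)| ^+ 2 / mesh T N.

(** Cauchy-Schwarz for the integral of the derivative, obtained from Young's
    inequality with an optimized parameter. *)
Lemma wderiv_increment (u g : R -> E) :
  {within `[0, T], continuous u} -> L2 T g -> is_wderiv T u g ->
  forall s t, 0 <= s -> s < t -> t <= T ->
  `|u t - u s| ^+ 2 <= (t - s) * \int[mu]_(x in `[s, t]) (`|g x| ^+ 2).
Proof.
move=> uc gL2 ug s t s0 st tT.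
set Q := Rintegral _ _ _; set d := `|u t - u s|.
have ts0 : 0 < t - s by rewrite subr_gt0.
have Q0 : 0 <= Q by apply: Rintegral_ge0 => x _; exact: sqr_ge0.
have key a : 0 < a -> d <= a * (t - s) / 2 + Q / (2 * a).
  move=> a0; apply/ler_addgt0Pr => e e0.
  have [xi [xile dxi]] := nE (u t - u s) e0.
  rewrite (le_trans dxi)// lerD2r linearB/= (wderiv_ftc T0 xi uc gL2 ug)// ?(ltW st)//.
  have i0 : mu.-integrable `[s, t] (EFin \o (fun x => xi (g x))).
    by apply: integrable_itvS tT _ => //; exact: L2_functional_integrable.
  have i1 : mu.-integrable `[0, T] (EFin \o (fun x => `|g x| ^+ 2)).
    exact: L2_sqnorm_integrable.
  have i2 : mu.-integrable `[s, t] (EFin \o (fun x => `|g x| ^+ 2)).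
    exact: integrable_itvS i1.
  have i3 : mu.-integrable `[s, t] (EFin \o (fun x => (2 * a)^-1 * `|g x| ^+ 2)).
    by apply: integrable_itvS tT _ => //; exact: integrable_mull.
  have i4 : mu.-integrable `[s, t] (EFin \o cst (a / 2)).
    apply: integrable_itvS tT _ => //.
    apply: (@integrable_bounded _ _ T0 (cst (a / 2)) (a / 2)); first exact: measurable_cst.
    by move=> x _; rewrite /= ger0_norm// divr_ge0// ltW.
  have i5 : mu.-integrable `[s, t] (EFin \o (fun x => a / 2 + (2 * a)^-1 * `|g x| ^+ 2)).
    apply: integrable_itvS tT _ => //.
    apply: integrable_addr; last exact: integrable_mull.
    apply: (@integrable_bounded _ _ T0 (cst (a / 2)) (a / 2)); first exact: measurable_cst.
    by move=> x _; rewrite /= ger0_norm// divr_ge0// ltW.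
  have -> : a * (t - s) / 2 + Q / (2 * a) =
      \int[mu]_(x in `[s, t]) (a / 2 + (2 * a)^-1 * `|g x| ^+ 2).
    have eC : \int[mu]_(x in `[s, t]) (a / 2) = a / 2 * (t - s).
      rewrite Rintegral_cst//; congr (_ * _).
      have em : mu `[s, t]%classic = (t - s)%:E.
        by rewrite lebesgue_measure_itv/= lte_fin st -EFinB.
      by rewrite [X in fine X]em.
    have eQ : \int[mu]_(x in `[s, t]) ((2 * a)^-1 * `|g x| ^+ 2) = (2 * a)^-1 * Q.
      by rewrite RintegralZl.
    have /= -> := @RintegralD _ _ _ mu _ _ _ (measurable_itv _) i4 i3.
    by rewrite eC eQ [Q / _]mulrC; congr (_ + _); ring.
  apply: le_Rintegral => // x _.
  rewrite (le_trans (xile _))// -subr_ge0.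
  have -> : a / 2 + (2 * a)^-1 * `|g x| ^+ 2 - `|g x| = (a - `|g x|) ^+ 2 / (2 * a).
    by field; rewrite gt_eqF.
  by rewrite divr_ge0 ?sqr_ge0// mulr_ge0// ltW.
have : 0 <= d by exact: normr_ge0.
rewrite le_eqVlt => /predU1P[<-|d0].
  by rewrite expr0n/= mulr_ge0// ltW.
have := key (d / (t - s)) (divr_gt0 d0 ts0).
have -> : d / (t - s) * (t - s) / 2 + Q / (2 * (d / (t - s))) =
  d / 2 + Q * (t - s) / (2 * d) by field; rewrite !gt_eqF.
rewrite -lerBlDl -[d - d / 2]/(d - d / 2) (_ : d - d / 2 = d / 2); last by field.
rewrite ler_pdivlMr ?mulr_gt0// => H; rewrite mulrC; apply: le_trans H.
by rewrite le_eqVlt; apply/orP; left; apply/eqP; field.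
Qed.

Lemma discrete_energy_le (u g : R -> E) N : (0 < N)%N ->
  {within `[0, T], continuous u} -> L2 T g -> is_wderiv T u g ->
  discrete_energy N u <= fine (L2normsq T g).
Proof.
move=> N0 uc gL2 ug.
have m0 := mesh_gt0 T0 N0.
have ig := L2_sqnorm_integrable gL2.
pose Q x := \int[mu]_(y in `[0, x]) (`|g y| ^+ 2).
have -> : fine (L2normsq T g) = \sum_(0 <= k < N) (Q (node T N k.+1) - Q (node T N k)).
  rewrite telescope_sumr// node_last// node0.
  by rewrite /Q set_itv1 Rintegral_set1 subr0.
rewrite big_mkord; apply: ler_sum => k _.
have /itvP a := node_itv T0 N0 (ltnW (ltn_ord k)).
have /itvP b := node_itv T0 N0 (ltn_ord k).
have ab : node T N k < node T N k.+1 by rewrite nodeS ltrDl.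
rewrite ler_pdivrMr// mulrC.
apply: le_trans (wderiv_increment uc gL2 ug _ ab _) _; rewrite ?a ?b//.
have -> : node T N k.+1 - node T N k = mesh T N by rewrite nodeS addrC addKr.
have i1 : mu.-integrable `[0, node T N k.+1] (EFin \o (fun x => `|g x| ^+ 2)).
  by apply: integrable_itvS ig; rewrite ?b.
rewrite /Q Rintegral_itvB//= ?bnd_simp ?a ?(ltW ab)//.
rewrite Rintegral_itv_obnd_cbnd//.
by apply: integrableS i1 => //; apply: subset_itvr; rewrite bnd_simp a.
Qed.

End Energy.

Section Uniqueness.
Context {R : realType}.
Variable T : R.
Hypothesis T0 : 0 < T.
Local Notation mu := (@lebesgue_measure R).

Lemma lebesgue_ae_filter : Filter (almost_everywhere mu).
Proof. exact: (ae_filter_ringOfSetsType mu). Qed.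

Lemma ae_imply (P Q : R -> Prop) : (forall x, P x -> Q x) ->
  {ae mu, forall x, P x} -> {ae mu, forall x, Q x}.
Proof. by move=> PQ; apply: (@filterS _ _ lebesgue_ae_filter). Qed.

Lemma ae_imply2 (P1 P2 Q : R -> Prop) : (forall x, P1 x -> P2 x -> Q x) ->
  {ae mu, forall x, P1 x} -> {ae mu, forall x, P2 x} -> {ae mu, forall x, Q x}.
Proof. by move=> PQ; apply: (@filterS2 _ _ lebesgue_ae_filter). Qed.

(** Lebesgue's differentiation theorem. *)
Lemma integral0_ae (gam : R -> R) : mu.-integrable `[0, T] (EFin \o gam) ->
  (forall x, x \in `[0, T] -> \int[mu]_(y in `[0, x]) gam y = 0) ->
  {ae mu, forall x, x \in `]0, T[ -> gam x = 0}.
Proof.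
move=> gami g0.
pose f := gam \_ `[0, T].
have fi : mu.-integrable setT (EFin \o f).
  by rewrite -restrict_EFin; apply/integrable_restrict => //=; rewrite setTI.
have f0 x : x \in `[0, T] -> \int[mu]_(y in `[0, x]) f y = 0.
  move=> xT; rewrite -[RHS](g0 x xT); apply: eq_Rintegral => y.
  rewrite inE/= !in_itv/= => /andP[y0 yx].
  rewrite /f patchE ifT// inE/= in_itv/= y0/=.
  by move: xT; rewrite in_itv/= => /andP[_]; exact: le_trans.
have fy y : mu.-integrable `[0, y] (EFin \o f) by exact: integrableS fi.
have /(_ fy (open_integrable_locally openT fi)) := @FTC1 R f (BLeft 0).
apply: ae_imply => x /= Fx xT.
have x0 : 0 < x < T by move: xT; rewrite in_itv.
pose G x : R := \int[mu]_(t in `[0, x]) f t.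
have -> : gam x = derive1 G x.
  have [|_ ->] := Fx; first by rewrite lte_fin; case/andP: x0.
  by rewrite /f patchE ifT// inE/= in_itv/=; case/andP: x0 => /ltW -> /ltW.
rewrite derive1E (@near_eq_derive _ _ _ _ (cst 0)); first exact: derive_cst.
have : x \in `]0, T[ by [].
move/near_in_itvoo; apply: filterS => y.
rewrite in_itv/= => /andP[/ltW ? /ltW ?].
by apply: f0; rewrite in_itv/=; apply/andP; split.
Qed.

Lemma ae_itv_closed (P : R -> Prop) : {ae mu, forall x, x \in `]0, T[ -> P x} ->
  {ae mu, forall x, x \in `[0, T] -> P x}.
Proof.
have neq (a : R) : {ae mu, forall x : R, x <> a}.
  exists [set a]; split; first exact: measurable_set1.
    exact: lebesgue_measure_set1.
  by move=> x /= /contrapT.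
move=> h; have := ae_imply2 (fun x p q => conj p q) (neq 0) (neq T).
move: h; apply: ae_imply2 => x H [x0 xT] xI; apply: H.
move: xI; rewrite !in_itv/= => /andP[h1 h2].
by rewrite !lt_neqAle h1 h2 !andbT; apply/andP; split; apply/eqP => // /esym.
Qed.

Context {E : normedModType R}.
Hypothesis nE : norming_dual E.

(** A strongly measurable function is a limit of simple functions, which take
    countably many values altogether. Norming functionals of those values are
    countably many too, so that almost everywhere all of them vanish at d x;
    then |s_n x| <= |s_n x - d x| up to a small error, and d x = 0. *)
Lemma strongly_measurable_ae0 (d : R -> E) : strongly_measurable T d ->
  (forall xi : dual E, {ae mu, forall x, x \in `]0, T[ -> xi (d x) = 0}) ->
  {ae mu, forall x, x \in `]0, T[ -> d x = 0}.
Proof.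
move=> [s sd] xid.
(* A value of s n is a sum of coefficients over a subset of the indices, so that
   the countable type [I] enumerates all the values of all the s n. *)
pose I := {n : nat & {ffun 'I_(sf_size (s n)) -> bool}}.
pose val (p : I) : E := \sum_(i | tagged p i) sf_val i.
have sfE n t : exists S : {ffun 'I_(sf_size (s n)) -> bool}, sf_eval (s n) t = val (existT _ n S : I).
  exists [ffun i => t \in sf_set i]; rewrite /val /= /sf_eval [RHS]big_mkcond/=.
  apply: eq_bigr => i _; rewrite ffunE indicE.
  by case: (_ \in _); rewrite ?scale1r ?scale0r.
have /choice[xi xiP] : forall pk : I * nat, exists xi : dual E,
    (forall y, xi y <= `|y|) /\ `|val pk.1| <= xi (val pk.1) + pk.2.+1%:R^-1.
  by move=> [p k]; apply: nE; rewrite invr_gt0.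
have : {ae mu, forall x, forall m : nat,
    x \in `]0, T[ -> if unpickle m is Some pk then xi pk (d x) = 0 else True}.
  apply: ae_foralln => m; case: (unpickle m) => [pk|]; first exact: xid.
  exact: (@nearW _ _ _ lebesgue_ae_filter).
apply: ae_imply => x H xT.
have xT' : x \in `[0, T] by move: xT; rewrite !in_itv/= => /andP[? ?]; apply/andP; split; lra.
have xi0 pk : xi pk (d x) = 0 by have := H (pickle pk) xT; rewrite pickleK.
have le n : `|sf_eval (s n) x| <= `|sf_eval (s n) x - d x|.
  have [S ->] := sfE n x; set p : I := existT _ n S.
  apply/ler_addgt0Pr => e e0.
  pose k := Num.trunc e^-1.
  have [xi1 xi2] := xiP (p, k).
  rewrite (le_trans xi2)//= lerD//.
    by rewrite -[X in X <= _]subr0 -(xi0 (p, k)) -linearB; exact: xi1.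
  by rewrite invf_ple ?posrE// ltW// truncnS_gt.
apply/eqP; rewrite -normr_le0.
have c1 : `|sf_eval (s n) x| @[n --> \oo] --> `|d x| by apply: cvg_norm; exact: sd.
have c2 : `|sf_eval (s n) x - d x| @[n --> \oo] --> 0.
  rewrite -(@normr0 _ E) -(subrr (d x)); apply: cvg_norm.
  by apply: cvgB; [exact: sd|exact: cvg_cst].
by apply: ler_cvg_to c1 c2 _; exact: nearW.
Qed.

(** Two weak derivatives have the same integrals over all the intervals [0, x]
    after composition with a functional. *)
Lemma wderiv_unique (u g1 g2 : R -> E) :
  {within `[0, T], continuous u} -> L2 T g1 -> is_wderiv T u g1 ->
  L2 T g2 -> is_wderiv T u g2 ->
  {ae mu, forall x, x \in `]0, T[ -> g1 x = g2 x}.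
Proof.
move=> uc L1 w1 L2 w2.
have := @strongly_measurable_ae0 (fun t => g1 t - g2 t) (strongly_measurableB L1.1 L2.1).
move=> H; apply: ae_imply (H _) => [x h xT|xi]; first by apply/eqP; rewrite -subr_eq0 h.
have i1 := L2_functional_integrable T0 xi L1.
have i2 := L2_functional_integrable T0 xi L2.
have i3 : mu.-integrable `[0, T] (EFin \o (fun t => xi (g1 t) - xi (g2 t))).
  exact: (@integrableB _ _ _ mu `[0, T]%classic (measurable_itv _) _ _ i1 i2).
have := @integral0_ae (fun t => xi (g1 t) - xi (g2 t)) i3.
move=> /(_ _)/wrap[].
  move=> x /[dup] xT; rewrite in_itv/= => /andP[x0 x1].
  have := wderiv_ftc T0 xi uc L1 w1 (lexx 0) x0 x1.
  rewrite (wderiv_ftc T0 xi uc L2 w2 (lexx 0) x0 x1) => e.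
  have j1 := integrable_itvS (lexx 0) x1 i1.
  have j2 := integrable_itvS (lexx 0) x1 i2.
  by rewrite RintegralB// e subrr.
by apply: ae_imply => x h xT; rewrite linearB/= h.
Qed.

Lemma wderivP (u : R -> E) : (exists g, L2 T g /\ is_wderiv T u g) ->
  L2 T (wderiv T u) /\ is_wderiv T u (wderiv T u).
Proof. by move=> [g Hg]; rewrite /wderiv; case: xgetP => [y _ []//|/(_ g)]. Qed.

Lemma sobolev1_wderiv k (u : R -> E) : sobolev T k.+1 u ->
  L2 T (wderiv T u) /\ is_wderiv T u (wderiv T u).
Proof.
move=> [_ [g ug sg]]; apply: wderivP; exists g; split => //.
by case: k sg => [|k] [].
Qed.

Lemma ae_eq_L2normsq (g1 g2 : R -> E) :
  strongly_measurable T g1 -> strongly_measurable T g2 ->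
  {ae mu, forall x, x \in `]0, T[ -> g1 x = g2 x} ->
  L2normsq T g1 = L2normsq T g2.
Proof.
move=> m1 m2 g12; rewrite /L2normsq.
have mm1 : measurable_fun `[0, T] (fun t => `|g1 t| ^+ 2).
  by apply: measurable_funX; exact: strongly_measurable_norm.
have mm2 : measurable_fun `[0, T] (fun t => `|g2 t| ^+ 2).
  by apply: measurable_funX; exact: strongly_measurable_norm.
apply: ge0_ae_eq_integral => //=.
- by apply/measurable_EFinP; exact: mm1.
- by apply/measurable_EFinP; exact: mm2.
have h : {ae mu, forall x, x \in `[0, T] -> (`|g1 x| ^+ 2)%:E = (`|g2 x| ^+ 2)%:E}.
  by apply: ae_imply (ae_itv_closed g12) => x H xT; rewrite H.
exact: h.
Qed.

End Uniqueness.

(** * Difference quotients on nested partitions *)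

Section Variance.
Context {R : realType} {E : normedModType R}.

(** The sum of the squared deviations from the mean is controlled by the
    decrease of the sum of squares. In a Hilbert space this is an identity with
    constant 1; the parallelogram inequality alone gives the constant 2, which
    suffices. *)
Lemma variance_le (p : nat) (d : nat -> E) (m : E) : parallelogram_le E ->
  \sum_(r < p) d r = p%:R *: m ->
  \sum_(r < p) `|d r - m| ^+ 2 <= 2 * (\sum_(r < p) `|d r| ^+ 2 - p%:R * `|m| ^+ 2).
Proof.
move=> pE dm.
have h1 : \sum_(r < p) `|d r - m| ^+ 2 <=
    \sum_(r < p) (2 * `|d r| ^+ 2 + 2 * `|m| ^+ 2 - `|d r + m| ^+ 2).
  by apply: ler_sum => r _; have := pE (d r) m; lra.
(* The vectors d r + m have mean 2 m: this is the tangent line bound of the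
   square at 2 |m|. *)
have h2 : \sum_(r < p) (4 * `|m| * `|d r + m| - 4 * `|m| ^+ 2) <= \sum_(r < p) `|d r + m| ^+ 2.
  by apply: ler_sum => r _; have := sqr_ge0 (`|d r + m| - 2 * `|m|); nra.
have h3 : 2 * p%:R * `|m| <= \sum_(r < p) `|d r + m|.
  apply: le_trans (ler_norm_sum _ _ _).
  have -> : \sum_(i < p) (d i + m) = (p%:R + p%:R : R) *: m.
    by rewrite big_split/= dm sumr_const card_ord scalerDl scaler_nat.
  by rewrite normrZ ger0_norm ?addr_ge0//; lra.
have h4 : 0 <= `|m| by [].
have sumc (c : R) : \sum_(r < p) c = p%:R * c.
  by rewrite sumr_const card_ord [RHS]mulr_natl.
move: h1 h2; rewrite !big_split/= !sumrN !sumc -!mulr_sumr.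
set S1 := \sum_(r < p) `|d r| ^+ 2; set S2 := \sum_(r < p) `|d r + m| ^+ 2.
set S3 := \sum_(r < p) `|d r + m| in h3 *.
move=> h1 h2.
have h5 : 4 * `|m| * (2 * p%:R * `|m|) <= 4 * `|m| * S3.
  by rewrite ler_wpM2l// mulr_ge0.
apply: le_trans h1 _; rewrite -/S1 -/S2; lra.
Qed.

Lemma sum_block (V : nmodType) N p (F : nat -> V) :
  \sum_(q < N * p) F q = \sum_(k < N) \sum_(r < p) F (k * p + r)%N.
Proof.
elim: N => [|N IH]; first by rewrite mul0n !big_ord0.
rewrite big_ord_recr/= -IH mulSn addnC -!(big_mkord xpredT).
rewrite (big_cat_nat (n := (N * p)%N)) ?leq_addr//=; congr (_ + _).
rewrite -{1}[(N * p)%N]add0n big_addn addKn big_mkord.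
by apply: eq_bigr => r _; rewrite addnC.
Qed.

End Variance.

Section DifferenceQuotient.
Context {R : realType} {E : normedModType R}.
Variable T : R.
Hypothesis T0 : 0 < T.
Local Notation mu := (@lebesgue_measure R).

Definition diff_quot (u : R -> E) N k : E :=
  (mesh T N)^-1 *: (u (node T N k.+1) - u (node T N k)).

Lemma discrete_energyE (u : R -> E) N : (0 < N)%N ->
  discrete_energy T N u = \sum_(k < N) mesh T N * `|diff_quot u N k| ^+ 2.
Proof.
move=> N0; apply: eq_bigr => k _; rewrite /diff_quot normrZ exprMn.
have m0 := mesh_gt0 T0 N0; rewrite ger0_norm ?invr_ge0 ?(ltW m0)//.
by rewrite mulrC; field; rewrite gt_eqF.
Qed.

Lemma mesh_refine N p : (0 < N)%N -> (0 < p)%N -> mesh T N = p%:R * mesh T (N * p).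
Proof.
move=> N0 p0; rewrite /mesh natrM invfM mulrCA !mulrA mulrAC mulfK//.
by rewrite pnatr_eq0 -lt0n.
Qed.

Lemma node_refine N p k : (0 < N)%N -> (0 < p)%N ->
  node T N k = node T (N * p) (k * p).
Proof.
move=> N0 p0; rewrite /node (mesh_refine N0 p0) natrM.
by rewrite !mulrA.
Qed.

Lemma diff_quot_refine (u : R -> E) N p k : (0 < N)%N -> (0 < p)%N ->
  \sum_(r < p) diff_quot u (N * p) (k * p + r) = p%:R *: diff_quot u N k.
Proof.
move=> N0 p0; rewrite /diff_quot -scaler_sumr.
rewrite -(big_mkord xpredT (fun r => u (node T (N * p) (k * p + r).+1) -
   u (node T (N * p) (k * p + r)))).
under eq_bigr do rewrite -addnS.
rewrite telescope_sumr// addn0 !(node_refine _ N0 p0) mulSn (addnC p).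
rewrite scalerA; congr (_ *: _); rewrite (mesh_refine N0 p0).
by rewrite [in RHS]invfM mulVKf// pnatr_eq0 -lt0n.
Qed.

(** The difference quotient on a coarse cell is the mean of those on the fine
    cells it contains, so [variance_le] applies on each coarse cell. Hence a
    bounded monotone sequence of energies makes the difference quotients a
    Cauchy sequence in L^2. *)
Lemma diff_quot_dist (u : R -> E) N p : parallelogram_le E ->
  (0 < N)%N -> (0 < p)%N ->
  (\int[mu]_(t in `[0%R, T])
    (`|diff_quot u (N * p) (cell_index T (N * p) t) -
       diff_quot u N (cell_index T N t)| ^+ 2)%:E <=
  (2 * (discrete_energy T (N * p) u - discrete_energy T N u))%:E)%E.
Proof.
move=> pE N0 p0; have Np0 : (0 < N * p)%N by rewrite muln_gt0 N0.
pose f q := `|diff_quot u (N * p) q - diff_quot u N (q %/ p)| ^+ 2.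
rewrite (_ : integral _ _ _ = \int[mu]_(t in `[0%R, T]) (f (cell_index T (N * p) t))%:E)%E; last first.
  apply: eq_integral => t; rewrite inE/= in_itv/= => /andP[t0 tT].
  by rewrite /f (cell_index_refine T0 N0 p0).
rewrite integral_step//; last by move=> k; exact: sqr_ge0.
rewrite lee_fin !discrete_energyE//.
rewrite (sum_block _ _ (fun q => mesh T (N * p) * f q)).
rewrite (sum_block _ _ (fun q => mesh T (N * p) * `|diff_quot u (N * p) q| ^+ 2)).
rewrite -sumrB mulr_sumr.
apply: ler_sum => k _; rewrite -!mulr_sumr.
have m0 := mesh_gt0 T0 Np0.
rewrite (mesh_refine N0 p0).
set S := \sum_(r < p) f _; set S' := \sum_(r < p) _; set b := _ ^+ 2.
rewrite (_ : 2 * _ = mesh T (N * p) * (2 * (S' - p%:R * b))); last by ring.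
rewrite ler_wpM2l ?(ltW m0)// /S /S' /b.
rewrite (eq_bigr (fun r : 'I_p => `|diff_quot u (N * p) (k * p + r) - diff_quot u N k| ^+ 2)).
  by apply: (variance_le (d := fun r => diff_quot u (N * p) (k * p + r))) => //; exact: diff_quot_refine.
by move=> r _; rewrite /f divnMDl// divn_small// addn0.
Qed.

Lemma discrete_energy_refine (u : R -> E) N p : parallelogram_le E ->
  (0 < N)%N -> (0 < p)%N -> discrete_energy T N u <= discrete_energy T (N * p) u.
Proof.
move=> pE N0 p0; have := diff_quot_dist u pE N0 p0.
move=> H; rewrite -subr_ge0 -(pmulr_rge0 _ (ltr0Sn R 1)) -lee_fin.
by apply: le_trans H; apply: integral_ge0 => t _; rewrite lee_fin sqr_ge0.
Qed.

End DifferenceQuotient.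

(** * Discrete summation by parts *)

Section ErealLimits.
Context {R : realType}.

Lemma ereal_cvg0P (a : nat -> \bar R) : (forall n, (0 <= a n)%E) ->
  a n @[n --> \oo] --> 0%E <->
  forall e : R, 0 < e -> \forall n \near \oo, (a n <= e%:E)%E.
Proof.
move=> a0; split.
  move/fine_cvgP => [af /cvgrPdist_le ac] e e0; near=> n.
  have an : a n \is a fin_num by near: n.
  rewrite -(fineK an) lee_fin -[leLHS]ger0_norm ?fine_ge0// -normrN -sub0r.
  by near: n; exact: ac.
move=> H; apply/fine_cvgP; split.
  near=> n; rewrite ge0_fin_numE// (@le_lt_trans _ _ 1%:E) ?ltry//.
  by near: n; exact: H.
apply/cvgrPdist_le => e e0; near=> n.
have an : (a n <= e%:E)%E by near: n; exact: H.
rewrite sub0r normrN ger0_norm ?fine_ge0// -lee_fin fineK//.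
by rewrite ge0_fin_numE// (le_lt_trans an)// ltry.
Unshelve. all: by end_near. Qed.

End ErealLimits.

Section BochnerOfSteps.
Context {R : realType} {E : completeNormedModType R}.
Variable T : R.
Hypothesis T0 : 0 < T.
Hypothesis nE : norming_dual E.
Local Notation mu := (@lebesgue_measure R).

Lemma integral_le_cst (h : R -> R) (e : R) : measurable_fun `[0, T] h ->
  (forall t, 0 <= h t) -> 0 <= e -> (forall t, 0 <= t -> t < T -> h t <= e) ->
  (\int[mu]_(t in `[0%R, T]) (h t)%:E <= (e * T)%:E)%E.
Proof.
move=> mh h0 e0 he.
have mh' : measurable_fun `[0, T[ h.
  by apply: measurable_funS mh => //; apply: subset_itvl; rewrite bnd_simp.
rewrite -integral_itv_bndo_bndc; last by apply/measurable_EFinP; exact: mh'.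
apply: (@le_trans _ _ (\int[mu]_(t in `[0%R, T[) (cst e%:E t))%E).
  apply: ge0_le_integral => //=.
  - by move=> t _; rewrite lee_fin.
  - by apply/measurable_EFinP; exact: mh'.
  - by move=> t /=; rewrite in_itv/= => /andP[? ?]; rewrite lee_fin he.
rewrite integral_cst//= EFinM; have -> : mu `[0, T[%classic = T%:E.
  by rewrite lebesgue_measure_itv/= lte_fin T0 -EFinB subr0.
by [].
Qed.

Lemma sf_integral_dist (s r : @simple_fun R E) :
  ((`|sf_integral T s - sf_integral T r|)%:E <=
  \int[mu]_(t in `[0%R, T]) (`|sf_eval s t - sf_eval r t|%R)%:E)%E.
Proof.
set I := integral _ _ _.
have I0 : (0 <= I)%E by exact: integral_ge0.
have [Iy|] := boolP (I == +oo%E); first by rewrite (eqP Iy) leey.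
rewrite -ltey -ge0_fin_numE// => If; rewrite -(fineK If) lee_fin.
apply/ler_addgt0Pr => e e0.
have [xi [xi1 xi2]] := nE (sf_integral T s - sf_integral T r) e0.
rewrite (le_trans xi2)// lerD2r linearB/=.
have [i1 <-] := sf_functional T0 xi s; have [i2 <-] := sf_functional T0 xi r.
rewrite -RintegralB// /Rintegral; apply: fine_le => //.
  apply: integrable_fin_num => //.
  exact: (@integrableB _ _ _ mu `[0, T]%classic (measurable_itv _) _ _ i1 i2).
have md : measurable_fun `[0, T] (fun t => `|sf_eval s t - sf_eval r t|).
  by apply: strongly_measurable_norm; apply: strongly_measurableB; exact: strongly_measurable_sf.
apply: le_integral => //.
- exact: (@integrableB _ _ _ mu `[0, T]%classic (measurable_itv _) _ _ i1 i2).
- apply/integrableP; split; first by apply/measurable_EFinP; exact: md.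
  rewrite (le_lt_trans _ (_ : I < +oo)%E)// ?ltey_eq ?If//.
  rewrite /I le_eqVlt; apply/orP; left; apply/eqP.
  by apply: eq_integral => t _ /=; rewrite normr_id.
- by move=> t _; rewrite lee_fin -linearB; exact: xi1.
Qed.

(** Convergence of the integrals is automatic: they form a Cauchy sequence. *)
Lemma bochner_of_steps (f : R -> E) (s : nat -> simple_fun) :
  strongly_measurable T f ->
  (\int[mu]_(t in `[0%R, T]) (`|f t - sf_eval (s n) t|%R)%:E)%E
    @[n --> \oo] --> 0%E ->
  exists x, is_bochner_integral T f x /\ sf_integral T (s n) @[n --> \oo] --> x.
Proof.
move=> mf sf.
suff /cvg_ex[x sx] : cvg (sf_integral T (s n) @[n --> \oo]).
  by exists x; split => //; split => //; exists s.
have mfs n : measurable_fun `[0, T] (fun t => `|f t - sf_eval (s n) t|).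
  by apply: strongly_measurable_norm; apply: strongly_measurableB => //; exact: strongly_measurable_sf.
have /ereal_cvg0P H : (forall n, 0 <= \int[mu]_(t in `[0%R, T]) (`|f t - sf_eval (s n) t|%R)%:E)%E.
  by move=> n; exact: integral_ge0.
have {}H := H.1 sf.
apply: cauchy_cvg_dist => e e0.
have [N _ HN] := H _ (gt0_half e0).
exists (sf_integral T (s N)); exists N => // n /= Nn.
rewrite -lee_fin (le_trans (sf_integral_dist _ _))//.
have -> : e%:E = ((e / 2)%:E + (e / 2)%:E)%E by rewrite -EFinD -splitr.
rewrite (le_trans _ (leeD (HN N (leqnn _)) (HN n Nn)))//.
rewrite -ge0_integralD//=; last 2 first.
- by apply/measurable_EFinP; exact: mfs.
- by apply/measurable_EFinP; exact: mfs.
apply: ge0_le_integral => //=.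
- apply/measurable_EFinP; apply: strongly_measurable_norm.
  by apply: strongly_measurableB => //; exact: strongly_measurable_sf.
- by apply: emeasurable_funD; apply/measurable_EFinP; exact: mfs.
- move=> t _; rewrite -EFinD lee_fin.
  by rewrite -(subrKA (f t)) (le_trans (ler_normD _ _))// lerD2r distrC.
Qed.

End BochnerOfSteps.

Section WeakDerivative.
Context {R : realType} {E : completeNormedModType R}.
Variable T : R.
Hypothesis T0 : 0 < T.
Hypothesis nE : norming_dual E.
Local Notation mu := (@lebesgue_measure R).

Lemma cell_index_lt N t : (0 < N)%N -> 0 <= t -> t < T -> (cell_index T N t < N)%N.
Proof.
move=> N0 t0 tT; have m0 := mesh_gt0 T0 N0.
rewrite truncn_lt_nat; last by rewrite divr_ge0// ltW.
by rewrite ltr_pdivrMr// mesh_natmul.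
Qed.

Lemma integral_le_co (f1 f2 : R -> R) : measurable_fun `[0, T] f1 ->
  measurable_fun `[0, T] f2 -> (forall t, 0 <= f1 t) ->
  (forall t, 0 <= t -> t < T -> f1 t <= f2 t) ->
  (\int[mu]_(t in `[0%R, T]) (f1 t)%:E <= \int[mu]_(t in `[0%R, T]) (f2 t)%:E)%E.
Proof.
move=> m1 m2 f10 f12.
have m f : measurable_fun `[0, T] f -> measurable_fun `[0, T[ f.
  by apply: measurable_funS => //; apply: subset_itvl; rewrite bnd_simp.
rewrite -integral_itv_bndo_bndc; last by apply/measurable_EFinP; exact: m m1.
rewrite -[leRHS]integral_itv_bndo_bndc; last by apply/measurable_EFinP; exact: m m2.
apply: ge0_le_integral => //=.
- by move=> t _; rewrite lee_fin.
- by apply/measurable_EFinP; exact: m m1.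
- by apply/measurable_EFinP; exact: m m2.
- by move=> t /=; rewrite in_itv/= => /andP[? ?]; rewrite lee_fin f12.
Qed.

Lemma test_fun_continuous (phi : R -> R) : test_fun T phi ->
  {within `[0, T], continuous phi}.
Proof.
by move=> [d _ _]; apply: derivable_within_continuous => x _; exact: d.
Qed.

Lemma test_fun_boundary (phi : R -> R) : test_fun T phi -> phi 0 = 0 /\ phi T = 0.
Proof.
move=> [_ _ [a [b [a0 bT phi0]]]]; split; apply: phi0; rewrite in_itv/=.
  by apply/negP => /andP[]; rewrite leNgt a0.
by apply/negP => /andP[_]; rewrite leNgt bT.
Qed.

Definition phi_quot (phi : R -> R) N k : R :=
  (mesh T N)^-1 * (phi (node T N k.+1) - phi (node T N k)).

Lemma phi_quot_dist (phi : R -> R) (e d : R) N t : test_fun T phi ->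
  (forall x y, x \in `[0, T] -> y \in `[0, T] -> `|x - y| < d ->
     `|derive1 phi x - derive1 phi y| <= e) ->
  (0 < N)%N -> mesh T N < d -> 0 <= t -> t < T ->
  `|derive1 phi t - phi_quot phi N (cell_index T N t)| <= e.
Proof.
move=> [phid _ _] H N0 md t0 tT.
have m0 := mesh_gt0 T0 N0.
have /andP[h1 h2] := cell_index_itv T0 N0 t0.
have kN := cell_index_lt N0 t0 tT.
set k := cell_index T N t in h1 h2 kN *.
have n01 : node T N k <= node T N k.+1 by rewrite nodeS lerDl ltW.
have [c] := @MVT_segment R phi (derive1 phi) _ _ n01
  (fun x _ => (fun d => eq_ind_r (is_derive x 1 phi) d (derive1E phi x)) (derivableP (phid x)))
  (derivable_within_continuous (fun x _ => phid x)).
rewrite in_itv/= => /andP[c1 c2] E1.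
have -> : phi_quot phi N k = derive1 phi c.
  rewrite /phi_quot E1 nodeS addrAC subrr add0r mulrCA mulVf ?mulr1// gt_eqF//.
have /itvP a := node_itv T0 N0 (ltnW kN).
have /itvP b := node_itv T0 N0 kN.
apply: H.
- by rewrite in_itv/= t0 ltW.
- by rewrite in_itv/= (le_trans _ c1) ?a// (le_trans c2) ?b.
rewrite (le_lt_trans _ md)//; move: c2 h2; rewrite nodeS => c2 h2.
by rewrite ler_norml; apply/andP; split; lra.
Qed.

(** The boundary terms vanish since test functions have compact support in
    ]0, T[. *)
Lemma summation_by_parts (phi : R -> R) (u : R -> E) N : (0 < N)%N ->
  test_fun T phi ->
  sf_integral T (step T N (fun k => phi_quot phi N k *: u (node T N k))) =
  - sf_integral T (step T N (fun k => phi (node T N k.+1) *: diff_quot T u N k)).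
Proof.
move=> N0 tphi; have m0 := mesh_gt0 T0 N0.
rewrite !sf_integral_step//; apply/eqP; rewrite -addr_eq0 -big_split/=.
rewrite (eq_bigr (fun k : 'I_N => phi (node T N k.+1) *: u (node T N k.+1) -
    phi (node T N k) *: u (node T N k))).
  rewrite -(big_mkord xpredT (fun k => phi (node T N k.+1) *: u (node T N k.+1) -
    phi (node T N k) *: u (node T N k))).
  rewrite telescope_sumr// node_last// node0.
  by have [-> ->] := test_fun_boundary tphi; rewrite !scale0r subr0.
move=> k _; rewrite /phi_quot /diff_quot.
set p1 := phi _; set p0 := phi _; set u0 := u _; set u1 := u _.
rewrite !scalerA; set m := mesh T N in m0 *.
rewrite (_ : m * (m^-1 * (p1 - p0)) = p1 - p0); last by field; rewrite gt_eqF.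
rewrite (_ : m * p1 * m^-1 = p1); last by field; rewrite gt_eqF.
by rewrite scalerBl scalerBr addrC addrA subrK.
Qed.

Variables (u g : R -> E) (N_ : nat -> nat).
Hypothesis uc : {within `[0, T], continuous u}.
Hypothesis N_gt0 : forall j, (0 < N_ j)%N.
Hypothesis N_oo : forall K, \forall j \near \oo, (K <= N_ j)%N.
Hypothesis gm : strongly_measurable T g.
Hypothesis gi : (\int[mu]_(t in `[0%R, T]) (`|g t|)%:E < +oo)%E.
Hypothesis gD : (\int[mu]_(t in `[0%R, T])
    (`|g t - sf_eval (step T (N_ n) (diff_quot T u (N_ n))) t|%R)%:E)%E
    @[n --> \oo] --> 0%E.

Lemma mesh_N_lt (d : R) : 0 < d -> \forall j \near \oo, mesh T (N_ j) < d.
Proof.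
move=> d0; have [K _ HK] := mesh_cvg0 T (gt0_half d0).
near=> j; rewrite (@le_lt_trans _ _ (d / 2))//; last by rewrite ltr_pdivrMr// ltr_pMr// ltr1n.
by apply: HK; near: j; exact: N_oo.
Unshelve. all: by end_near. Qed.

Lemma phi_quot_cvg (phi : R -> R) : test_fun T phi ->
  (\int[mu]_(t in `[0%R, T]) (`|derive1 phi t *: u t -
     sf_eval (step T (N_ n) (fun k => phi_quot phi (N_ n) k *: u (node T (N_ n) k))) t|%R)%:E)%E
    @[n --> \oo] --> 0%E.
Proof.
move=> tphi; have [phid dphic _] := tphi.
have dphiw : {within `[0, T], continuous (derive1 phi)} by exact: continuous_subspaceT.
have [K K0 HK] := continuous_bounded_itv (E := R^o) T0 dphiw.
have [M M0 HM] := continuous_bounded_itv T0 uc.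
apply/ereal_cvg0P; first by move=> n; exact: integral_ge0.
move=> e e0.
pose e' := e / (T * (M + K + 1 + 1)).
have S0 : 0 < M + K + 1 + 1 by rewrite ltr_wpDl// addr_ge0// addr_ge0.
have e'0 : 0 < e' by rewrite divr_gt0// mulr_gt0.
pose e1 := Num.min e' 1.
have e10 : 0 < e1 by rewrite lt_min e'0/=.
have [d1 d10 hd1] := heine_itv (E := R^o) dphiw e10.
have [d2 d20 hd2] := heine_itv uc e10.
near=> j.
have m1 : mesh T (N_ j) < d1 by near: j; exact: mesh_N_lt.
have m2 : mesh T (N_ j) < d2 by near: j; exact: mesh_N_lt.
have Nj := N_gt0 j.
have -> : e = (e' * (M + K + 1 + 1)) * T.
  by rewrite /e'; field; rewrite !gt_eqF.
apply: integral_le_cst => //.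
- apply: strongly_measurable_norm; apply: strongly_measurableB; last exact: strongly_measurable_sf.
  by apply: strongly_measurableZ; apply: continuous_strongly_measurable.
- by rewrite mulr_ge0// ltW.
move=> t t0 tT.
have tI : t \in `[0, T] by rewrite in_itv/= t0 ltW.
rewrite sf_eval_step//.
have h1 := phi_quot_dist tphi hd1 Nj m1 t0 tT.
have kN := cell_index_le T0 Nj tI.
have nI := node_itv T0 Nj kN.
have h2 : `|u t - u (node T (N_ j) (cell_index T (N_ j) t))| <= e1.
  by apply: hd2 => //; rewrite (le_lt_trans _ m2)// cell_index_dist.
set q := phi_quot _ _ _ in h1 *; set v := u (node _ _ _) in h2 *.
have -> : derive1 phi t *: u t - q *: v =
    (derive1 phi t - q) *: u t + q *: (u t - v).
  by rewrite scalerBl scalerBr addrA subrK.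
have q1 : `|q| <= K + 1.
  rewrite -[q](subKr (derive1 phi t)) (le_trans (ler_normB _ _))// lerD ?HK//.
  by rewrite (le_trans h1)// ge_min lexx orbT.
rewrite (le_trans (ler_normD _ _))// [`|_ *: u t|]normrZ [`|q *: _|]normrZ.
have e1e' : e1 <= e' by rewrite ge_min lexx.
have a1 : `|derive1 phi t - q| * `|u t| <= e' * M.
  by rewrite ler_pM ?HM// (le_trans h1).
have a2 : `|q| * `|u t - v| <= (K + 1) * e'.
  by rewrite ler_pM// (le_trans h2).
by lra.
Unshelve. all: by end_near. Qed.

Lemma phi_diff_quot_cvg (phi : R -> R) : test_fun T phi ->
  (\int[mu]_(t in `[0%R, T]) (`|phi t *: g t -
     sf_eval (step T (N_ n) (fun k => phi (node T (N_ n) k.+1) *: diff_quot T u (N_ n) k)) t|%R)%:E)%E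
    @[n --> \oo] --> 0%E.
Proof.
move=> tphi; have phiw := test_fun_continuous tphi.
have [K K0 HK] := continuous_bounded_itv (E := R^o) T0 phiw.
pose D n t := sf_eval (step T (N_ n) (diff_quot T u (N_ n))) t.
pose I := (\int[mu]_(t in `[0%R, T]) (`|g t|)%:E)%E.
have mg : measurable_fun `[0, T] (fun t => `|g t|) by exact: strongly_measurable_norm.
have mgD n : measurable_fun `[0, T] (fun t => `|g t - D n t|).
  by apply: strongly_measurable_norm; apply: strongly_measurableB => //; exact: strongly_measurable_sf.
have I0 : (0 <= I)%E by apply: integral_ge0 => t _; rewrite lee_fin.
have If : I \is a fin_num by rewrite ge0_fin_numE.
have fI0 : 0 <= fine I by exact: fine_ge0.
apply/ereal_cvg0P; first by move=> n; exact: integral_ge0.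
move=> e e0.
pose e' := e / (fine I + K + 1).
have S0 : 0 < fine I + K + 1 by rewrite ltr_wpDl// addr_ge0.
have e'0 : 0 < e' by rewrite divr_gt0.
have [d d0 hd] := heine_itv (E := R^o) phiw e'0.
have gD' := (ereal_cvg0P (fun n => integral_ge0 _ (fun t _ => _))).1 gD.
near=> j.
have mj : mesh T (N_ j) < d by near: j; exact: mesh_N_lt.
have Nj := N_gt0 j.
have Dj : (\int[mu]_(t in `[0%R, T]) (`|g t - D j t|%R)%:E <= e'%:E)%E.
  by near: j; apply: gD' => // n t; rewrite lee_fin.
pose f2 t := e' * `|g t| + K * `|g t - D j t|.
apply: (@le_trans _ _ (\int[mu]_(t in `[0%R, T]) (f2 t)%:E)%E).
  apply: integral_le_co => //.
  - apply: strongly_measurable_norm; apply: strongly_measurableB; last exact: strongly_measurable_sf.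
    by apply: strongly_measurableZ => //; exact: (continuous_strongly_measurable (E := R^o) T0 phiw).
  - by apply: measurable_funD; apply: measurable_funM => //; exact: mgD.
  move=> t t0 tT.
  have tI : t \in `[0, T] by rewrite in_itv/= t0 ltW.
  have kN := cell_index_lt Nj t0 tT.
  have nI := node_itv T0 Nj kN.
  rewrite /f2 /D !sf_eval_step//.
  have /andP[h1 h2] := cell_index_itv T0 Nj t0.
  set k := cell_index _ _ _ in kN nI h1 h2 *.
  set q := diff_quot _ _ _ _; set p := phi (node T (N_ j) k.+1).
  have -> : phi t *: g t - p *: q = (phi t - p) *: g t + p *: (g t - q).
    by rewrite scalerBl scalerBr addrA subrK.
  rewrite (le_trans (ler_normD _ _))// !normrZ lerD// ler_wpM2r//; last exact: HK.
  apply: hd => //; rewrite (le_lt_trans _ mj)//.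
  by move: h2; rewrite nodeS => h2; rewrite ler_norml; apply/andP; split; lra.
rewrite /f2; under eq_integral do rewrite EFinD.
rewrite ge0_integralD//=; last 4 first.
- by move=> t _; rewrite lee_fin mulr_ge0// ltW.
- by apply/measurable_EFinP; apply: measurable_funM => //; exact: mg.
- by move=> t _; rewrite lee_fin mulr_ge0.
- by apply/measurable_EFinP; apply: measurable_funM => //; exact: mgD.
under eq_integral do rewrite EFinM.
under [X in (_ + X <= _)%E]eq_integral do rewrite EFinM.
rewrite ge0_integralZl_EFin//=; last 2 first.
- by apply/measurable_EFinP; exact: mg.
- exact: ltW.
rewrite ge0_integralZl_EFin//=; last 1 first.
- by apply/measurable_EFinP; exact: mgD.
rewrite -/I -(fineK If) -EFinM.
apply: (@le_trans _ _ ((e' * fine I)%:E + K%:E * e'%:E)%E).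
  by rewrite leeD2l// lee_wpmul2l// lee_fin.
rewrite -EFinM -EFinD lee_fin.
have -> : e = e' * (fine I + K + 1) by rewrite /e'; field; rewrite gt_eqF.
by lra.
Unshelve. all: by end_near. Qed.

(** Integration by parts is passed to the limit from its discrete version, both
    sides of which are integrals of step functions converging in L^1. *)
Lemma wderiv_of_L1 : is_wderiv T u g.
Proof.
move=> phi tphi; have [phid dphic _] := tphi.
have dphiw : {within `[0, T], continuous (derive1 phi)} by exact: continuous_subspaceT.
have phiw := test_fun_continuous tphi.
have [x [bx sx]] := bochner_of_steps T0 nE
  (strongly_measurableZ (continuous_strongly_measurable (E := R^o) T0 dphiw)
    (continuous_strongly_measurable T0 uc)) (phi_quot_cvg tphi).
exists x; split => //; split.
  apply: strongly_measurableZ => //.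
  exact: (continuous_strongly_measurable (E := R^o) T0 phiw).
eexists; split; first exact: phi_diff_quot_cvg.
have -> : (fun n => sf_integral T (step T (N_ n)
    (fun k => phi (node T (N_ n) k.+1) *: diff_quot T u (N_ n) k))) =
  (fun n => - sf_integral T (step T (N_ n)
    (fun k => phi_quot phi (N_ n) k *: u (node T (N_ n) k)))).
  by apply/funext => n; rewrite summation_by_parts// opprK.
exact: cvgN.
Qed.

End WeakDerivative.

(** * Functions of bounded discrete energy are of class H1 *)

Section LimitsOfSimpleFunctions.
Context {R : realType} {E : completeNormedModType R}.
Variable T : R.
Hypothesis T0 : 0 < T.
Local Notation mu := (@lebesgue_measure R).

Lemma fatou_le (f_ : nat -> R -> R) (f : R -> R) (C : \bar R) :
  (forall n, measurable_fun `[0, T] (f_ n)) -> measurable_fun `[0, T] f ->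
  (forall n t, 0 <= f_ n t) -> (forall t, 0 <= f t) ->
  {ae mu, forall t, t \in `[0, T] -> f_ n t @[n --> \oo] --> f t} ->
  (forall n, (\int[mu]_(t in `[0%R, T]) (f_ n t)%:E <= C)%E) ->
  (\int[mu]_(t in `[0%R, T]) (f t)%:E <= C)%E.
Proof.
move=> mf_ mf f_0 f0 fcv fC.
pose g t := limn_einf (fun n => (f_ n t)%:E).
have -> : (\int[mu]_(t in `[0%R, T]) (f t)%:E = \int[mu]_(t in `[0%R, T]) g t)%E.
  apply: ge0_ae_eq_integral => //=.
  - by apply/measurable_EFinP; exact: mf.
  - have -> : g = (fun t => - limn_esup (fun n => - (f_ n t)%:E))%E.
      by apply/funext => t; rewrite -[limn_esup _]/(limn_esup (-%E \o _)) limn_esupN oppeK.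
    apply: measurableT_comp => //; apply: measurable_fun_limn_esup => n.
    by apply: measurableT_comp => //; apply/measurable_EFinP; exact: mf_.
  - by move=> t _; rewrite lee_fin.
  - move=> t _; rewrite /g limn_einf_lim; apply: lime_ge.
      exact: is_cvg_einfs.
    by apply: nearW => n; apply: le_ereal_inf_tmp => _ [k _ <-]; rewrite lee_fin.
  have h : {ae mu, forall t, t \in `[0, T] -> (f t)%:E = g t}.
    apply: ae_imply fcv => t H tT; have := H tT.
    move=> c; have c' : (f_ n t)%:E @[n --> \oo] --> (f t)%:E.
      by apply/fine_cvgP; split; [exact: nearW|exact: c].
    by rewrite /g (cvg_limn_einf_sup c').1.
  exact: h.
apply: le_trans (fatou mu _ _ _) _ => //=.
- by move=> n; apply/measurable_EFinP; exact: mf_.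
- by move=> n t _; rewrite lee_fin.
rewrite limn_einf_lim; apply: lime_le; first exact: is_cvg_einfs.
apply: nearW => n; apply: le_trans (fC n); apply: ereal_inf_lbound.
by exists n => /=.
Qed.

(** Young's inequality with a free parameter replaces the Cauchy-Schwarz
    inequality when passing from L^2 to L^1 bounds. *)
Lemma integral_norm_le_sq (h : R -> R) (a : R) : 0 < a ->
  measurable_fun `[0, T] h -> (forall t, 0 <= h t) ->
  (\int[mu]_(t in `[0%R, T]) (h t)%:E <=
   (a * T / 2)%:E + ((2 * a)^-1)%:E * \int[mu]_(t in `[0%R, T]) (h t ^+ 2)%:E)%E.
Proof.
move=> a0 mh h0.
have mh2 : measurable_fun `[0, T] (fun t => h t ^+ 2) by exact: measurable_funX.
have ia : 0 <= (2 * a)^-1 by rewrite invr_ge0 mulr_ge0// ltW.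
rewrite -ge0_integralZl_EFin//=; last 2 first.
- by move=> t _; rewrite lee_fin sqr_ge0.
- by apply/measurable_EFinP; exact: mh2.
have -> : (a * T / 2)%:E = (\int[mu]_(t in `[0%R, T]) (cst (a / 2)%:E t))%E.
  rewrite integral_cst//= mulrAC EFinM; congr (_ * _)%E.
  by rewrite -(mu_itv0T T0).
rewrite -ge0_integralD//=; last 3 first.
- by move=> t _; rewrite lee_fin divr_ge0// ltW.
- by move=> t _; rewrite mule_ge0// lee_fin ?sqr_ge0.
- by apply: emeasurable_funM => //; apply/measurable_EFinP; exact: mh2.
apply: ge0_le_integral => //=.
- by move=> t _; rewrite lee_fin.
- by apply/measurable_EFinP; exact: mh.
- apply: emeasurable_funD => //; apply: emeasurable_funM => //.
  by apply/measurable_EFinP; exact: mh2.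
move=> t _; rewrite -EFinM -EFinD lee_fin -subr_ge0.
have -> : a / 2 + (2 * a)^-1 * h t ^+ 2 - h t = (a - h t) ^+ 2 / (2 * a).
  by field; rewrite gt_eqF.
by rewrite divr_ge0 ?sqr_ge0// mulr_ge0// ltW.
Qed.

(** Summability of the L^1 distances makes the sequence absolutely convergent
    almost everywhere. Multiplying the simple functions by the indicator of the
    set of convergence makes the limit strongly measurable as it stands, since
    the products converge everywhere. *)
Lemma ae_limit_of_simple (s : nat -> @simple_fun R E) :
  (\sum_(0 <= j <oo) \int[mu]_(t in `[0%R, T])
     (`|sf_eval (s j.+1) t - sf_eval (s j) t|%R)%:E < +oo)%E ->
  exists g : R -> E, strongly_measurable T g /\
    {ae mu, forall t, t \in `[0, T] -> sf_eval (s j) t @[j --> \oo] --> g t}.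
Proof.
move=> sumy.
pose d j t := `|sf_eval (s j.+1) t - sf_eval (s j) t|.
have md j : measurable_fun setT (d j).
  have [q qE] := sf_sub_ex (s j.+1) (s j).
  have -> : d j = (fun t => `|sf_eval q t|) by apply/funext => t; rewrite /d qE.
  exact: (measurable_sf_eval (fun x => `|x|)).
pose S t := (\sum_(0 <= j <oo) (d j t)%:E)%E.
have mS : measurable_fun setT S.
  apply: ge0_emeasurable_sum => //.
  - by move=> k t _ _; rewrite lee_fin; exact: normr_ge0.
  - by move=> k _; apply/measurable_EFinP; exact: md.
pose B := [set t | S t \is a fin_num].
have mB : measurable B.
  by rewrite -[B]setTI; apply: emeasurable_fin_num.
have Bcv t : B t -> cvg (sf_eval (s j) t @[j --> \oo]).
  move=> Bt.
  pose v j := sf_eval (s j.+1) t - sf_eval (s j) t.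
  have /normed_cvg cv : cvgn [normed series v].
    apply: nondecreasing_is_cvgn.
      by apply: nondecreasing_series => j _ _; exact: normr_ge0.
    exists (fine (S t)) => _ [n _ <-] /=.
    rewrite -lee_fin fineK// /series/= -sumEFin.
    apply: (@nneseries_lim_ge _ (fun i => (d i t)%:E) xpredT 0%N) => k *.
    by rewrite lee_fin; exact: normr_ge0.
  have -> : (fun j => sf_eval (s j) t) = (fun j => sf_eval (s 0%N) t + series v j).
    by apply/funext => j; rewrite /series/= telescope_sumr// addrC subrK.
  by apply: is_cvgD => //; exact: is_cvg_cst.
pose ind : simple_fun := @SimpleFun R R^o 1 (fun=> B) (fun=> 1) (fun=> mB).
have indE t : sf_eval ind t = \1_B t.
  by rewrite /sf_eval /= big_ord1 /GRing.scale/= mulr1.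
have [q qE] := choice (fun j => sf_scale_ex ind (s j)).
pose g t := lim (sf_eval (q j) t @[j --> \oo]).
have qB t j : B t -> sf_eval (q j) t = sf_eval (s j) t.
  by move=> Bt; rewrite qE indE indicE mem_set// scale1r.
have qcv t : sf_eval (q j) t @[j --> \oo] --> g t.
  have [Bt|Bt] := pselect (B t).
    rewrite /g (_ : (fun j => sf_eval (q j) t) = (fun j => sf_eval (s j) t)).
      exact: Bcv.
    by apply/funext => j; exact: qB.
  rewrite /g (_ : (fun j => sf_eval (q j) t) = (fun=> 0)).
    exact: is_cvg_cst.
  by apply/funext => j; rewrite qE indE indicE memNset// scale0r.
exists g; split; first by exists q => t _; exact: qcv.
have iS : mu.-integrable `[0, T] S.
  apply/integrableP; split; first exact: measurable_funS mS.
  apply: le_lt_trans sumy; rewrite -integral_nneseries//=.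
  - by rewrite le_eqVlt; apply/orP; left; apply/eqP; apply: eq_integral => t _;
      rewrite gee0_abs//; apply: nneseries_ge0 => k _ _; rewrite lee_fin; exact: normr_ge0.
  - by move=> j; apply/measurable_EFinP; exact: measurable_funS (md j).
have := @integrable_ae _ _ _ mu `[0, T]%classic (measurable_itv _) _ iS.
apply: ae_imply => t H tT.
have Bt : B t := H tT.
have := qcv t; rewrite (_ : (fun j => sf_eval (q j) t) = (fun j => sf_eval (s j) t))//.
by apply/funext => j; exact: qB.
Qed.

End LimitsOfSimpleFunctions.

Section BoundedEnergy.
Context {R : realType} {E : completeNormedModType R}.
Variable T : R.
Hypothesis T0 : 0 < T.
Hypothesis nE : norming_dual E.
Hypothesis pE : parallelogram_le E.
Local Notation mu := (@lebesgue_measure R).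

Lemma diff_quot_energy (u : R -> E) N : (0 < N)%N ->
  (\int[mu]_(t in `[0%R, T]) (`|sf_eval (step T N (diff_quot T u N)) t| ^+ 2)%:E =
  (discrete_energy T N u)%:E)%E.
Proof.
move=> N0; rewrite discrete_energyE// -(integral_step T0 N0 (f := fun k => `|diff_quot T u N k| ^+ 2)).
  by apply: eq_integral => t; rewrite inE/= => tT; rewrite sf_eval_step.
by move=> k; exact: sqr_ge0.
Qed.

Lemma L2_of_sqnorm (g : R -> E) (M : R) : strongly_measurable T g ->
  (L2normsq T g <= M%:E)%E -> (\int[mu]_(t in `[0%R, T]) (`|g t|)%:E < +oo)%E.
Proof.
move=> gm gM.
have h0 t : 0 <= `|g t| by [].
rewrite (le_lt_trans (integral_norm_le_sq T0 ltr01 (strongly_measurable_norm gm) h0))//.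
rewrite (@le_lt_trans _ _ ((1 * T / 2)%:E + ((2 * 1)^-1)%:E * M%:E)%E)//.
  by rewrite leeD2l// lee_wpmul2l.
by rewrite -EFinM -EFinD ltry.
Qed.

Lemma bounded_increasing_tail (a : nat -> R) (M : R) :
  {homo a : i j / (i <= j)%N >-> i <= j} -> (forall n, a n <= M) ->
  forall e : R, 0 < e -> exists n, forall m, a m - a n <= e.
Proof.
move=> ha aM e e0.
have hs : has_sup (range a) by split; [exists (a 0%N), 0%N|exists M => _ [n _ <-]].
have [_ [n _ <-] H] := sup_adherent e0 hs.
exists n => m; have : a m <= sup (range a) by apply: ub_le_sup; [exact: hs.2|exists m].
by lra.
Qed.

(** Energies increase along the dyadic partitions and are bounded, hence the
    difference quotients are a Cauchy sequence in L^2. A subsequence with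
    summable L^1 distances converges almost everywhere; its limit is the weak
    derivative, and Fatou's lemma bounds its norm. *)
Lemma wderiv_of_bounded_energy (u : R -> E) (M : R) :
  {within `[0, T], continuous u} ->
  (forall n, discrete_energy T (2 ^ n) u <= M) ->
  exists g, [/\ L2 T g, is_wderiv T u g & (L2normsq T g <= M%:E)%E].
Proof.
move=> uc eM.
pose a n := discrete_energy T (2 ^ n) u.
have p20 n : (0 < 2 ^ n)%N by rewrite expn_gt0.
have ha : {homo a : i j / (i <= j)%N >-> i <= j}.
  move=> i j ij; rewrite /a -(subnKC ij) expnD.
  exact: discrete_energy_refine.
(* Along [n_] the energies are within c j ^+ 2 of their supremum, so that the
   L^1 distances are of order c j, a summable rate. *)
pose c j : R := 4^-1 ^+ j.
have c0 j : 0 < c j by rewrite exprn_gt0.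
have /choice[f fP] : forall j, exists n, forall m, a m - a n <= c j ^+ 2.
  by move=> j; apply: (bounded_increasing_tail ha eM); rewrite exprn_gt0.
(* The sum makes the sequence nondecreasing, the summand j makes it unbounded. *)
pose n_ j := (\sum_(i < j.+1) f i + j)%N.
have n_f j : (f j <= n_ j)%N by rewrite /n_ big_ord_recr/= -addnA addnCA leq_addr.
have n_j j : (j <= n_ j)%N by rewrite leq_addl.
have n_le i j : (i <= j)%N -> (n_ i <= n_ j)%N.
  elim: j => [|j IH]; first by rewrite leqn0 => /eqP ->.
  rewrite leq_eqVlt => /predU1P[->//|]; rewrite ltnS => /IH /leq_trans; apply.
  by rewrite /n_ [in leqRHS]big_ord_recr/= leq_add// leq_addr.
pose s j := step T (2 ^ n_ j) (diff_quot T u (2 ^ n_ j)).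
have ms i j : measurable_fun `[0, T] (fun t => `|sf_eval (s i) t - sf_eval (s j) t|).
  apply: strongly_measurable_norm.
  by apply: strongly_measurableB; exact: strongly_measurable_sf.
have sd2 i j : (j <= i)%N ->
    (\int[mu]_(t in `[0%R, T]) (`|sf_eval (s i) t - sf_eval (s j) t|%R ^+ 2)%:E <=
     (2 * c j ^+ 2)%:E)%E.
  move=> ji.
  have := diff_quot_dist T0 u pE (p20 (n_ j)) (p20 (n_ i - n_ j)%N).
  rewrite -expnD subnKC ?n_le// => H.
  apply: (le_trans _ (le_trans H _)).
    rewrite le_eqVlt; apply/orP; left; apply/eqP; apply: eq_integral => t.
    by rewrite inE/= => tT; rewrite !sf_eval_step.
  rewrite lee_fin ler_pM2l//.
  by apply: le_trans (fP j (n_ i)); rewrite lerD2l lerN2 ha.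
have sd1 i j : (j <= i)%N ->
    (\int[mu]_(t in `[0%R, T]) (`|sf_eval (s i) t - sf_eval (s j) t|%R)%:E <=
     (c j * (T / 2 + 1))%:E)%E.
  move=> ji.
  have h0 t : 0 <= `|sf_eval (s i) t - sf_eval (s j) t| by [].
  apply: le_trans (integral_norm_le_sq T0 (c0 j) (ms i j) h0) _.
  have ic : 0 <= (2 * c j)^-1 by rewrite invr_ge0 mulr_ge0// ltW.
  apply: (@le_trans _ _ ((c j * T / 2)%:E + ((2 * c j)^-1)%:E * (2 * c j ^+ 2)%:E)%E).
    by rewrite leeD2l// lee_wpmul2l// ?lee_fin// sd2.
  rewrite -EFinM -EFinD lee_fin le_eqVlt; apply/orP; left; apply/eqP.
  by field; rewrite gt_eqF.
have sumy : (\sum_(0 <= j <oo) \int[mu]_(t in `[0%R, T])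
     (`|sf_eval (s j.+1) t - sf_eval (s j) t|%R)%:E < +oo)%E.
  apply: (@le_lt_trans _ _ ((4 / 3 * (T / 2 + 1))%:E)); last exact: ltry.
  apply: lime_le.
    by apply: is_cvg_nneseries => k _ _; exact: integral_ge0.
  apply: nearW => n.
  apply: (@le_trans _ _ (\sum_(0 <= j < n) (c j * (T / 2 + 1))%:E)%E).
    by apply: lee_sum => j _; exact: sd1.
  rewrite sumEFin lee_fin -mulr_suml ler_wpM2r//.
    by rewrite addr_ge0// divr_ge0// ltW.
  have : \sum_(0 <= j < n) c j = 4 / 3 - 4 / 3 * c n.
    elim: n => [|n IH]; first by rewrite big_nil /c expr0; field.
    by rewrite big_nat_recr//= IH /c exprS; field.
  by move=> ->; have := c0 n; lra.
have [g [gm gcv]] := ae_limit_of_simple sumy.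
have gL2 : (L2normsq T g <= M%:E)%E.
  apply: (@fatou_le R T (fun j t => `|sf_eval (s j) t| ^+ 2)) => //.
  - by move=> j; apply: measurable_funX; apply: measurable_sf_eval.
  - by apply: measurable_funX; exact: strongly_measurable_norm.
  - apply: ae_imply gcv => t H tT.
    by apply: (@cvg_comp _ _ _ _ (fun x : R => x ^+ 2)); [apply: cvg_norm; exact: H|exact: exprn_continuous].
  - by move=> j; rewrite diff_quot_energy// lee_fin.
have gs j : (\int[mu]_(t in `[0%R, T]) (`|g t - sf_eval (s j) t|%R)%:E <=
     (c j * (T / 2 + 1))%:E)%E.
  apply: (@fatou_le R T (fun i t => `|sf_eval (s (i + j)%N) t - sf_eval (s j) t|)) => //.
  - by apply: strongly_measurable_norm; apply: strongly_measurableB => //; exact: strongly_measurable_sf.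
  - apply: ae_imply gcv => t H tT; apply: cvg_norm; apply: cvgB; last exact: cvg_cst.
    by have := H tT; rewrite -(cvg_shiftn j).
  - by move=> i; rewrite sd1// leq_addl.
exists g; split=> //.
  by split=> //; rewrite (le_lt_trans gL2)// ltry.
apply: (@wderiv_of_L1 _ _ _ T0 nE u g (fun j => (2 ^ n_ j)%N)) => //.
- move=> K; exists K => // j /= Kj; rewrite (leq_trans Kj)// (leq_trans (n_j j))//.
  by rewrite ltnW// ltn_expl.
- exact: L2_of_sqnorm gL2.
apply/ereal_cvg0P; first by move=> n; exact: integral_ge0.
move=> e e0.
have T21 : 0 < T / 2 + 1 by rewrite ltr_wpDl// divr_ge0// ltW.
have cc : c n @[n --> \oo] --> 0.
  by apply: cvg_expr; rewrite ger0_norm// invf_lt1// ltr1n.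
have /cvgrPdist_le/(_ _ (divr_gt0 e0 T21)) := cc.
apply: filterS => n; rewrite sub0r normrN ger0_norm ?(ltW (c0 n))// ler_pdivlMr// => cn.
by apply: le_trans (gs n) _; rewrite lee_fin.
Qed.

End BoundedEnergy.

(** * Frechet derivatives *)

Section Frechet.
Context {R : realType} {E F : normedModType R}.

Lemma is_diff_linopP (f : E -> F) (x : E) (L : linop E F) :
  is_diff x f L <->
  (forall e : R, 0 < e -> \forall h \near (0 : E), `|f (h + x) - f x - L h| <= e * `|h|).
Proof.
split.
  move=> [df dE] e e0.
  have [_ /eqaddoP H] := (diff_locallyP _ _).1 df.
  have := H e e0; apply: filterS => h /=.
  by rewrite dE opprD addrA.
move=> H.
have Lc : continuous (L : E -> F) := @linop_continuous _ _ _ L.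
have E1 : f \o shift x = cst (f x) + L +o_ (0 : E) id.
  apply/eqaddoP => e e0; have := H e e0; apply: filterS => h /=.
  by rewrite /cst/= opprD addrA.
have dE : 'd f x = L :> (E -> F) by exact: (@diff_unique _ _ _ f L).
apply: DiffDef => //; apply/diff_locallyP; rewrite dE; split => //.
Qed.

Lemma quadratic_remainder_diff (f : E -> F) (x : E) (L : linop E F) (C : R) :
  (forall h, `|f (h + x) - f x - L h| <= C * `|h| ^+ 2) -> is_diff x f L.
Proof.
move=> fC; apply/is_diff_linopP => e e0; near=> h.
rewrite (le_trans (fC h))// expr2 mulrA ler_wpM2r//.
have C1 : 0 < `|C| + 1 by rewrite ltr_wpDl.
rewrite (@le_trans _ _ ((`|C| + 1) * `|h|))//.
  by rewrite ler_wpM2r// (le_trans (ler_norm _))// lerDl.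
rewrite -ler_pdivlMl// mulrC; near: h.
apply/nbhs_ballP; exists (e / (`|C| + 1)) => /=; first by rewrite divr_gt0// ltr_wpDl.
by move=> h; rewrite -ball_normE /ball_/= sub0r normrN => /ltW.
Unshelve. all: by end_near. Qed.

(** Uniqueness of the derivative turns the choice in [frechet] into an
    equality. *)
Lemma frechet_eq (f : E -> F) (x : E) (L : linop E F) :
  is_diff x f L -> frechet f x = L.
Proof.
move=> fL; rewrite /frechet; case: xgetP => [M _ fM|/(_ L)//].
apply/val_inj/funext => y /=.
by rewrite -[LHS](f_equal (fun g => g y) (@diff_val _ _ _ _ _ _ _ fM))
  -(f_equal (fun g => g y) (@diff_val _ _ _ _ _ _ _ fL)).
Qed.

Lemma frechet_is_diff (f : E -> F) (x : E) :
  differentiable f x -> is_diff x f (frechet f x).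
Proof.
move=> df.
have LP : ('d f x : E -> F) \in is_linop.
  apply/asboolP; split; first by move=> a u v; rewrite linearP.
  exact: diff_continuous.
have fL : is_diff x f (Linop LP) by exact: DiffDef.
by rewrite (frechet_eq fL).
Qed.

End Frechet.

Section ChainRule.
Context {R : realType} {E : normedModType R}.

Lemma is_derive_along (f : E -> R^o) (z : R -> E) (t : R) (h : E) (L : dual E) :
  is_diff (z t) f L -> is_derive t 1 z h ->
  is_derive t 1 (fun s => f (z s) : R^o) (L h).
Proof.
move=> [df dfE] [dz dzE].
have dz' : differentiable z t by exact/derivable1_diffP.
have dfz : differentiable (f \o z) t by exact: differentiable_comp.
apply: DeriveDef; first exact/derivable1_diffP.
rewrite [LHS](deriveE _ dfz) diff_comp//= dfE.
by rewrite -(deriveE _ dz') dzE.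
Qed.

Lemma is_derive_curve (z : R -> E) (t : R) (h : E) :
  (forall e : R, 0 < e -> \forall s \near (0 : R), `|z (t + s) - z t - s *: h| <= e * `|s|) ->
  is_derive t 1 z h.
Proof.
move=> H.
have cv : s^-1 *: (z (s *: 1 + t) - z t) @[s --> 0^'] --> h.
  apply/cvgrPdist_le => e e0; near=> s.
  have s0 : s != 0 by near: s; exact: nbhs_dnbhs_neq.
  have Hs : `|z (t + s) - z t - s *: h| <= e * `|s|.
    by near: s; apply: nbhs_dnbhs; exact: H.
  have -> : h - s^-1 *: (z (s *: 1 + t) - z t) = - (s^-1 *: (z (t + s) - z t - s *: h)).
    rewrite [s *: 1]/GRing.scale/= mulr1 (addrC s).
    by rewrite [in RHS]scalerBr [in RHS]scalerA mulVf// scale1r opprB.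
  by rewrite normrN normrZ normfV ler_pdivrMl ?normr_gt0// mulrC.
apply: DeriveDef; first by apply/cvg_ex; exists h.
exact/cvg_lim.
Unshelve. all: by end_near. Qed.

End ChainRule.

Section QuadraticForm.
Context {R : realType} {Z : completeNormedModType R}.
Variable A : linop Z (dual Z).
Hypothesis As : symmetric_op A.

Lemma bilinear_bound (x y : Z) : `|A x y| <= `|A| * `|x| * `|y|.
Proof.
rewrite (le_trans (le_norm_linop (A x) y))// ler_wpM2r//.
exact: (@le_opnorm _ _ _ A x).
Qed.

Lemma bilinearDl (x y w : Z) : A (x + y) w = A x w + A y w.
Proof. by rewrite linearD. Qed.

Lemma bilinearNl (x w : Z) : A (- x) w = - A x w.
Proof. by rewrite linearN. Qed.

Lemma bilinearZl (a : R) (x w : Z) : A (a *: x) w = a * A x w.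
Proof. by rewrite linearZ. Qed.

Lemma quadratic_form_diff (x : Z) :
  is_diff x (fun z => 2^-1 * A z z : R^o) (A x).
Proof.
apply: (@quadratic_remainder_diff _ _ _ _ _ _ (`|A|)) => h.
have -> : (2^-1 * A (h + x) (h + x) : R) - 2^-1 * A x x - A x h = 2^-1 * A h h.
  rewrite !bilinearDl !linearD/= (As h x); lra.
rewrite normrM ger0_norm// expr2 mulrA.
have := bilinear_bound h h; have : 0 <= `|A h h| by [].
by lra.
Qed.

End QuadraticForm.

(** * The viscous resolvent *)

Section Dissipation.
Context {R : realType} {Z V X : completeNormedModType R}.
Variables (iZV : linop Z V) (iVX : linop V X) (D : Z -> R).
Hypothesis hD : dissipation iZV iVX D.

Lemma dissipation_ge0 z : 0 <= D z. Proof. by case: hD. Qed.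

Lemma dissipation_le : exists2 C : R, 0 < C & forall z, D z <= C * `|iZV z|.
Proof.
case: hD => _ _ _ _ [c [C [_ C0 H]]]; exists C => // z.
by have /andP[] := H z.
Qed.

Lemma dissipation0 : D 0 = 0.
Proof.
have [C _ H] := dissipation_le; apply/eqP; rewrite eq_le dissipation_ge0 andbT.
by have := H 0; rewrite linear0 normr0 mulr0.
Qed.

Lemma dissipation_midpoint x y : D (2^-1 *: (x + y)) <= (D x + D y) / 2.
Proof.
case: hD => _ cvx _ _ _.
have h0 : 0 <= (2^-1 : R) by lra.
have h1 : (2^-1 : R) <= 1 by lra.
have e : (1 - 2^-1 : R) = 2^-1 by lra.
have convE : conv (Itv01 h0 h1) (x : convex_lmodType Z) y = 2^-1 *: x + (1 - 2^-1) *: y.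
  by [].
have convER (a b : R) : conv (Itv01 h0 h1) (a : R^o) b = 2^-1 * a + (1 - 2^-1) * b by [].
have := cvx (Itv01 h0 h1) x y (mem_set I) (mem_set I).
by rewrite convE convER e -scalerDr => H; lra.
Qed.

Lemma dissipationD x y : D (x + y) <= D x + D y.
Proof.
have hom : forall (a : R) z, 0 < a -> D (a *: z) = a * D z by case: hD.
have := dissipation_midpoint x y; rewrite hom// => H; lra.
Qed.

Lemma dissipation_lip : exists2 C : R, 0 < C &
  forall x y, `|D x - D y| <= C * `|iZV x - iZV y|.
Proof.
have [C C0 H] := dissipation_le; exists C => // x y.
have h1 := dissipationD (x - y) y; have h2 := dissipationD (y - x) x.
rewrite !subrK in h1 h2.
have h3 := H (x - y); have h4 := H (y - x).
rewrite linearB/= in h3; rewrite linearB/= distrC in h4.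
by rewrite ler_norml; apply/andP; split; lra.
Qed.

End Dissipation.

Section Resolvent.
Context {R : realType} {Z V X : completeNormedModType R}.
Variables (iZV : linop Z V) (iVX : linop V X) (A : linop Z (dual Z)) (D : Z -> R).
Variables (eps delta alpha : R).
Hypothesis hD : dissipation iZV iVX D.
Hypothesis As : symmetric_op A.
Hypothesis alpha0 : 0 < alpha.
Hypothesis Ac : forall z, alpha * `|z| ^+ 2 <= A z z.
Hypothesis eps0 : 0 < eps.
Hypothesis delta0 : 0 < delta.

Let A_ge0 z : 0 <= A z z.
Proof. by apply: le_trans (Ac z); rewrite mulr_ge0 ?sqr_ge0// ltW. Qed.

Lemma viscE z :
  visc iZV A D eps delta z = D z + eps / 2 * `|iZV z| ^+ 2 + delta / 2 * A z z.
Proof. by rewrite /visc /Anorm sqr_sqrtr. Qed.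

Definition tilted (xi : dual Z) (z : Z) : R := visc iZV A D eps delta z - xi z.

(** Midpoint strong convexity: the quadratic form contributes the defect, all
    the other terms being convex. *)
Lemma tilted_midpoint xi x y :
  tilted xi (2^-1 *: (x + y)) <=
  (tilted xi x + tilted xi y) / 2 - delta / 8 * A (x - y) (x - y).
Proof.
rewrite /tilted !viscE.
have h1 := dissipation_midpoint hD x y.
have h2 : `|iZV (2^-1 *: (x + y))| ^+ 2 <= (`|iZV x| ^+ 2 + `|iZV y| ^+ 2) / 2.
  rewrite linearZ/= linearD/= normrZ ger0_norm//.
  have h : `|iZV x + iZV y| <= `|iZV x| + `|iZV y| by exact: ler_normD.
  have := sqr_ge0 (`|iZV x| - `|iZV y|).
  have h' : `|iZV x + iZV y| ^+ 2 <= (`|iZV x| + `|iZV y|) ^+ 2.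
    by rewrite lerXn2r// nnegrE// addr_ge0.
  by rewrite exprMn; lra.
have h3 : A (2^-1 *: (x + y)) (2^-1 *: (x + y)) =
    (A x x + A y y) / 2 - 4^-1 * A (x - y) (x - y).
  rewrite !bilinearZl linearZ/= !(bilinearDl, bilinearNl) !linearD/= !linearN/= (As y x).
  by rewrite /GRing.scale/=; lra.
have h4 : xi (2^-1 *: (x + y)) = (xi x + xi y) / 2.
  by rewrite linearZ/= linearD/= /GRing.scale/=; lra.
have h5 : eps / 2 * `|iZV (2^-1 *: (x + y))| ^+ 2 <=
    eps / 2 * ((`|iZV x| ^+ 2 + `|iZV y| ^+ 2) / 2).
  by rewrite ler_wpM2l// divr_ge0// ltW.
by rewrite h3 h4; lra.
Qed.

Lemma continuous_visc : continuous (visc iZV A D eps delta).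
Proof.
have -> : visc iZV A D eps delta = (fun z => D z + eps / 2 * `|iZV z| ^+ 2 + delta / 2 * A z z).
  by apply/funext => z; exact: viscE.
have ic : continuous (iZV : Z -> V) := @linop_continuous _ _ _ iZV.
move=> z; apply: cvgD; first apply: cvgD.
- have [C C0 H] := dissipation_lip hD.
  apply/cvgrPdist_le => e e0; near=> y; apply: le_trans (H z y) _.
  rewrite -ler_pdivlMl// mulrC; near: y.
  by move: (ic z) => /cvgrPdist_le; apply; rewrite divr_gt0.
- apply: cvgMl_tmp.
  by apply: (@cvg_comp _ _ _ _ (fun x : R => x ^+ 2)); [apply: cvg_norm; exact: ic|exact: exprn_continuous].
- have -> : (fun x => delta / 2 * A x x) = (fun x => delta * (2^-1 * A x x)).
    by apply/funext => x; rewrite mulrA.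
  have -> : delta / 2 * A z z = delta * (2^-1 * A z z) by rewrite mulrA.
  apply: cvgMl_tmp.
  exact: (@differentiable_continuous _ _ _ z (fun z => 2^-1 * A z z : R^o)
     (@ex_diff _ _ _ _ _ _ _ (quadratic_form_diff As z))).
Unshelve. all: by end_near. Qed.

Lemma tilted_lbound xi z : - (`|xi| ^+ 2 / (2 * (delta * alpha))) <= tilted xi z.
Proof.
rewrite /tilted viscE.
have da : 0 < delta * alpha by rewrite mulr_gt0.
have h1 := dissipation_ge0 hD z.
have h2 : 0 <= eps / 2 * `|iZV z| ^+ 2 by rewrite mulr_ge0 ?sqr_ge0// divr_ge0// ltW.
have h3 : delta * (alpha * `|z| ^+ 2) <= delta * A z z by rewrite ler_pM2l.
have h4 : xi z <= `|xi| * `|z|.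
  by rewrite (le_trans (ler_norm _))// le_norm_linop.
have h5 : `|xi| * `|z| <= `|xi| ^+ 2 / (2 * (delta * alpha)) + delta * alpha * `|z| ^+ 2 / 2.
  rewrite -subr_ge0.
  have -> : `|xi| ^+ 2 / (2 * (delta * alpha)) + delta * alpha * `|z| ^+ 2 / 2 - `|xi| * `|z| =
    (`|xi| - delta * alpha * `|z|) ^+ 2 / (2 * (delta * alpha)).
    by field; rewrite !gt_eqF.
  by rewrite divr_ge0 ?sqr_ge0// mulr_ge0// ltW.
by lra.
Qed.

(** By midpoint strong convexity a minimizing sequence is a Cauchy sequence. *)
Lemma tilted_min_ex xi : exists z, forall y, tilted xi z <= tilted xi y.
Proof.
pose S := range (tilted xi).
have hi : has_inf S.
  split; first by exists (tilted xi 0), 0.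
  by exists (- (`|xi| ^+ 2 / (2 * (delta * alpha)))) => _ [z _ <-]; exact: tilted_lbound.
pose m := inf S.
have mle y : m <= tilted xi y by apply: ge_inf; [exact: hi.2|exists y].
have /choice[z zP] : forall n : nat, exists z, tilted xi z <= m + n.+1%:R^-1.
  move=> n; have n0 : 0 < n.+1%:R^-1 :> R by rewrite invr_gt0.
  by have [_ [z _ <-] H] := inf_adherent n0 hi; exists z; exact: ltW.
have zd n k : delta * alpha / 8 * `|z n - z k| ^+ 2 <= (n.+1%:R^-1 + k.+1%:R^-1) / 2.
  have h1 := tilted_midpoint xi (z n) (z k).
  have h2 := mle (2^-1 *: (z n + z k)).
  have h3 := zP n; have h4 := zP k.
  have h5 : delta / 8 * (alpha * `|z n - z k| ^+ 2) <= delta / 8 * A (z n - z k) (z n - z k).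
    by rewrite ler_wpM2l// divr_ge0// ltW.
  move: h3 h4; set a := n.+1%:R^-1; set b := k.+1%:R^-1 => h3 h4.
  by clearbody a b m; lra.
have zcv : cvg (z n @[n --> \oo]).
  apply: cauchy_cvg_dist => e e0.
  have c0 : 0 < delta * alpha / 8 * e ^+ 2.
    by rewrite mulr_gt0 ?exprn_gt0// divr_gt0// mulr_gt0.
  have [N _ HN] := near_infty_natSinv_lt (PosNum c0).
  exists (z N); exists N => // n /= Nn.
  rewrite -(@ler_pXn2r _ 2%N) ?nnegrE ?(ltW e0)//.
  rewrite -(@ler_pM2l _ (delta * alpha / 8)) ?divr_gt0 ?mulr_gt0//.
  apply: le_trans (zd N n) _.
  have /= b1 := HN N (leqnn _); have /= b2 := HN n Nn.
  move: b1 b2; set a := N.+1%:R^-1; set b := n.+1%:R^-1 => b1 b2.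
  by clearbody a b; lra.
exists (lim (z n @[n --> \oo])) => y.
have cv : tilted xi (z n) @[n --> \oo] --> tilted xi (lim (z n @[n --> \oo])).
  apply: cvgB; first by apply: (@continuous_cvg _ _ _ _ _ _ (visc iZV A D eps delta)) => //; exact: continuous_visc.
  by apply: (@continuous_cvg _ _ _ _ _ _ (xi : Z -> R)); [exact: linop_continuous|exact: zcv].
apply: le_trans (mle y); apply/ler_addgt0Pr => e e0.
apply: cvgr_to_le cv _; have [N _ HN] := near_infty_natSinv_lt (PosNum e0).
exists N => // n /= Nn; apply: le_trans (zP n) _; rewrite lerD2l ltW//.
exact: (HN n Nn).
Qed.

(** The resolvent of the dissipation: the velocity that the regularized
    potential assigns to a driving force xi, defined as the minimizer of the
    potential tilted by xi. *)
Definition resolvent (xi : dual Z) : Z :=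
  xget 0 [set z | forall y, tilted xi z <= tilted xi y].

Lemma resolventP xi y : tilted xi (resolvent xi) <= tilted xi y.
Proof.
rewrite /resolvent; case: xgetP => [z _ zP|H]; first exact: zP.
by have [z zP] := tilted_min_ex xi; have := H z; case.
Qed.

(** Quadratic growth away from the minimizer, the midpoint being a competitor. *)
Lemma resolvent_growth xi y :
  delta / 4 * (alpha * `|y - resolvent xi| ^+ 2) <=
  tilted xi y - tilted xi (resolvent xi).
Proof.
set z := resolvent xi.
have h1 := tilted_midpoint xi y z.
have h2 := resolventP xi (2^-1 *: (y + z)); rewrite -/z in h2.
have h3 : delta / 4 * (alpha * `|y - z| ^+ 2) <= delta / 4 * A (y - z) (y - z).
  by rewrite ler_wpM2l// divr_ge0// ltW.
by lra.
Qed.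

Lemma resolvent_eq xi z : (forall y, tilted xi z <= tilted xi y) -> resolvent xi = z.
Proof.
move=> zP; apply/eqP; rewrite eq_sym -subr_eq0 -normr_le0.
have h := resolvent_growth xi z; have h' := zP (resolvent xi).
have c0 : 0 < delta / 4 * alpha by rewrite mulr_gt0// divr_gt0.
rewrite -(@ler_pXn2r _ 2%N) ?nnegrE// expr0n/= -(pmulr_rle0 _ c0).
by rewrite -mulrA; lra.
Qed.

(** Adding the growth inequalities at the two minimizers gives strong
    monotonicity; hence the state equation is an ordinary differential equation
    with locally Lipschitz right-hand side. *)
Lemma resolvent_lip xi eta :
  `|resolvent xi - resolvent eta| <= 2 / (delta * alpha) * `|xi - eta|.
Proof.
have h1 := resolvent_growth xi (resolvent eta).
have h2 := resolvent_growth eta (resolvent xi).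
rewrite distrC in h1; move: h1 h2; rewrite /tilted.
set x := resolvent xi; set y := resolvent eta; set d := `|x - y| => h1 h2.
have h3 : (xi - eta) (x - y) <= `|xi - eta| * d.
  by rewrite (le_trans (ler_norm _))// le_norm_linop.
have h4 : (xi - eta) (x - y) = xi x - xi y - eta x + eta y.
  by rewrite -[(xi - eta) _]/(xi (x - y) - eta (x - y)) !linearB/=; lra.
have da : 0 < delta * alpha by rewrite mulr_gt0.
have : 0 <= d by exact: normr_ge0.
rewrite le_eqVlt => /predU1P[<-|d0]; first by rewrite mulr_ge0// divr_ge0// ltW.
rewrite mulrAC ler_pdivlMr// -(ler_pM2r d0).
by move: h3; rewrite h4 => h3; lra.
Qed.

Lemma visc0 : visc iZV A D eps delta 0 = 0.
Proof.
by rewrite viscE (dissipation0 hD) linear0 normr0 expr0n/= !linear0 !mulr0 !addr0.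
Qed.

(** Comparison with the competitor 0: the energy-dissipation inequality. *)
Lemma resolvent_visc_le xi : visc iZV A D eps delta (resolvent xi) <= xi (resolvent xi).
Proof.
have := resolventP xi 0; rewrite /tilted visc0 linear0 subr0.
by rewrite subr_le0.
Qed.

Lemma conjugate_viscE xi : conjugate (EFin \o visc iZV A D eps delta) xi =
  (- tilted xi (resolvent xi))%:E.
Proof.
apply/eqP; rewrite eq_le; apply/andP; split.
  apply: ge_ereal_sup => _ [y _ <-]; rewrite -EFinB lee_fin.
  by have := resolventP xi y; rewrite /tilted; lra.
by apply: ereal_sup_ubound; exists (resolvent xi) => //; rewrite -EFinB /tilted opprB.
Qed.

(** The subdifferential of the conjugate is the set of minimizers, by Fenchel's
    equality. That it contains nothing else follows by Minty's trick: the
    subgradient inequality at xi + s zeta, divided by s, and the Lipschitz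
    continuity of the resolvent force zeta (z - resolvent xi) <= 0 for every
    zeta. *)
Lemma subdiff_conjugate_visc xi :
  subdiff_dual (conjugate (EFin \o visc iZV A D eps delta)) xi = [set resolvent xi].
Proof.
apply/seteqP; split => [z [_ zP]|_ ->]; last first.
  split; first by rewrite conjugate_viscE.
  move=> eta; rewrite !conjugate_viscE -EFinD lee_fin.
  have := resolventP eta (resolvent xi).
  by rewrite -[(eta - xi) _]/(eta (resolvent xi) - xi (resolvent xi)) /tilted; lra.
have H eta : (eta - xi) (z - resolvent eta) <= 0.
  have := zP eta; rewrite !conjugate_viscE -EFinD lee_fin.
  have := resolventP xi (resolvent eta).
  rewrite -[(eta - xi) z]/(eta z - xi z).
  rewrite -[(eta - xi) (z - _)]/(eta (z - resolvent eta) - xi (z - resolvent eta)).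
  by rewrite /tilted !linearB/=; lra.
(* Minty's trick: use H at xi + s zeta with s small. *)
have HZ (zeta : dual Z) : zeta (z - resolvent xi) <= (0 : R).
  apply/ler_addgt0Pr => e e0; rewrite add0r.
  have da : 0 < delta * alpha by rewrite mulr_gt0.
  pose K := 2 / (delta * alpha) * `|zeta| * `|zeta|.
  have d2 : 0 <= 2 / (delta * alpha) by rewrite divr_ge0// ltW.
  have K0 : 0 <= K by rewrite mulr_ge0// mulr_ge0.
  pose s := e / (K + 1).
  have s0 : 0 < s by rewrite divr_gt0// ltr_wpDl.
  have := H (xi + s *: zeta).
  rewrite addrAC subrr add0r -[(s *: zeta) _]/(s * zeta _) pmulr_rle0//.
  set r := resolvent (xi + s *: zeta) => h1.
  have h2 := resolvent_lip (xi + s *: zeta) xi.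
  rewrite addrAC subrr add0r normrZ gtr0_norm// -/r in h2.
  have h3 : zeta (r - resolvent xi) <= `|zeta| * `|r - resolvent xi|.
    by rewrite (le_trans (ler_norm _))// le_norm_linop.
  have h4 : `|zeta| * `|r - resolvent xi| <= `|zeta| * (2 / (delta * alpha) * (s * `|zeta|)).
    by rewrite ler_wpM2l.
  have h5 : `|zeta| * (2 / (delta * alpha) * (s * `|zeta|)) = s * K by rewrite /K; ring.
  have h6 : s * K <= e.
    by rewrite /s mulrAC ler_pdivrMr ?ltr_wpDl// ler_pM2l// lerDl.
  by move: h1 h3; rewrite !linearB/= => h1 h3; lra.
apply/esym/eqP; rewrite eq_sym -subr_eq0 -normr_le0.
rewrite -(@ler_pXn2r _ 2%N) ?nnegrE// expr0n/= -(pmulr_rle0 _ alpha0).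
by apply: le_trans (Ac _) _; exact: HZ.
Qed.

(** By stability the tilted dissipation is nonnegative, as are the quadratic
    terms: 0 is the minimizer. *)
Lemma resolvent_stationary xi : subdiff (EFin \o D) 0 xi -> resolvent xi = 0.
Proof.
move=> [_ xiP]; apply: resolvent_eq => y.
have := xiP y; rewrite subr0 /= (dissipation0 hD) add0r lee_fin => h.
rewrite /tilted visc0 linear0 subr0 viscE.
have h1 : 0 <= eps / 2 * `|iZV y| ^+ 2 by rewrite mulr_ge0 ?sqr_ge0// divr_ge0// ltW.
have h2 : 0 <= delta / 2 * A y y by rewrite mulr_ge0// divr_ge0// ltW.
by lra.
Qed.

End Resolvent.

(** * The driving force of the state equation *)

Section Pullback.
Context {R : realType} {Z V : completeNormedModType R}.
Variable i : linop Z V.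

Lemma pullback_subproof (l : dual V) :
  (fun z => l (i z)) \in (is_linop : pred (Z -> R^o)).
Proof.
apply: (@bounded_linear_is_linop _ _ _ _ (`|l| * `|i|)).
  by move=> a u v; rewrite !linearP.
move=> x; rewrite (le_trans (le_norm_linop l (i x)))// -mulrA ler_wpM2l//.
exact: le_norm_linop.
Qed.

(** The functional on [Z] that a load on [V] induces. The state equation only
    sees loads through it, and a compact embedding turns bounded sets of loads
    into relatively compact ones. *)
Definition pullback (l : dual V) : dual Z := Linop (pullback_subproof l).

Lemma pullback_dist l l' : `|pullback l - pullback l'| <= `|i| * `|l - l'|.
Proof.
apply: linop_norm_le => [|x]; first by rewrite mulr_ge0.
rewrite -[(pullback l - pullback l') x]/((l - l') (i x)) mulrC mulrA.
rewrite (le_trans (le_norm_linop (l - l') (i x)))// mulrC.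
by rewrite ler_wpM2l// mulrC le_norm_linop.
Qed.

End Pullback.

Section DrivingForce.
Context {R : realType} {Z V : completeNormedModType R}.
Variables (iZV : linop Z V) (A : linop Z (dual Z)) (F : Z -> R^o).
Hypothesis As : symmetric_op A.
Hypothesis FC1 : C1 F.

Lemma stored_energy_diff z :
  is_diff z (fun z => 2^-1 * A z z + F z : R^o) (A z + frechet F z : dual Z).
Proof.
have h1 := quadratic_form_diff As z; have h2 := frechet_is_diff (FC1.1 z).
exact: is_diffD h1 h2.
Qed.

Lemma DzI_E l z : - DzI iZV A F l z = pullback iZV l - (A z + frechet F z).
Proof.
have h1 := stored_energy_diff z.
have h2 : is_diff z (fun z => l (iZV z) : R^o) (pullback iZV l).
  apply/is_diff_linopP => e e0; apply: nearW => h.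
  rewrite -[pullback _ _ h]/(l (iZV h)) !linearD/= addrK subrr normr0.
  by rewrite mulr_ge0// ltW.
have h3 : is_diff z (energy iZV A F l) (A z + frechet F z - pullback iZV l : dual Z).
  exact: is_diffB h1 h2.
by rewrite /DzI (frechet_eq h3) opprB.
Qed.

Lemma DzI_dist l l' z z' (K : R) :
  `|frechet F z - frechet F z'| <= K * `|z - z'| ->
  `|(- DzI iZV A F l z) - (- DzI iZV A F l' z')| <=
  `|pullback iZV l - pullback iZV l'| + (`|A| + K) * `|z - z'|.
Proof.
move=> FK; rewrite !DzI_E.
have -> : pullback iZV l - (A z + frechet F z) - (pullback iZV l' - (A z' + frechet F z')) =
  (pullback iZV l - pullback iZV l') - (A (z - z') + (frechet F z - frechet F z')).
  have -> : A (z - z') = A z - A z' by exact: linearB.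
  set a := pullback _ l; set b := pullback _ l'.
  set p := A z; set p' := A z'; set q := frechet F z; set q' := frechet F z'.
  apply/val_inj/funext => v.
  rewrite -[LHS]/(a v - (p v + q v) - (b v - (p' v + q' v)) : R).
  rewrite -[RHS]/(a v - b v - ((p v - p' v) + (q v - q' v)) : R).
  by ring.
rewrite (le_trans (ler_normB _ _))// lerD2l (le_trans (ler_normD _ _))// mulrDl lerD//.
exact: (@le_opnorm _ _ _ A).
Qed.

Hypothesis FC1' : C1 (frechet F).
Hypothesis Flip : forall B : set Z, bounded_set B -> exists k : R, k.-lipschitz_B (frechet (frechet F)).

Lemma bounded_ball (r : R) : bounded_set [set x : Z | `|x| <= r].
Proof. by exists r; split; [exact: num_real|move=> M rM x /= /le_trans; apply; exact: ltW]. Qed.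

(** The second derivative is bounded on balls since it is Lipschitz there; the
    mean value theorem along segments concludes. *)
Lemma frechet_locally_lipschitz (r : R) : 0 <= r -> exists2 K : R, 0 <= K &
  forall x y, `|x| <= r -> `|y| <= r -> `|frechet F x - frechet F y| <= K * `|x - y|.
Proof.
move=> r0; have [k kP] := Flip (bounded_ball r).
pose K := `|frechet (frechet F) 0| + `|k| * r.
have K0 : 0 <= K by rewrite addr_ge0// mulr_ge0.
have D2 x : `|x| <= r -> `|frechet (frechet F) x| <= K.
  move=> xr; have := kP (x, 0) _; rewrite /= normr0 subr0 => /(_ (conj xr r0)) H.
  rewrite -[frechet _ x](subrK (frechet (frechet F) 0)) addrC.
  rewrite (le_trans (ler_normD _ _))// lerD2l (le_trans H)//.
  by rewrite (le_trans (ler_wpM2r _ (ler_norm k)))// ler_wpM2l.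
exists K => // x y xr yr.
apply: linop_norm_le => [|v]; first by rewrite mulr_ge0.
pose c (s : R) : Z := y + s *: (x - y).
pose D2v z (w : Z) : R^o := frechet (frechet F) z w v.
have D2vP z : D2v z \in (is_linop : pred (Z -> R^o)).
  apply: (@bounded_linear_is_linop _ _ _ _ (`|frechet (frechet F) z| * `|v|)).
    by move=> a p q; rewrite /D2v linearP.
  move=> w; rewrite /D2v (le_trans (le_norm_linop _ _))// mulrAC ler_wpM2r//.
  exact: (@le_opnorm _ _ _ (frechet (frechet F) z)).
have d1 z : is_diff z (fun z => frechet F z v : R^o) (Linop (D2vP z)).
  have /is_diff_linopP H := frechet_is_diff (FC1'.1 z).
  apply/is_diff_linopP => e e0.
  have v1 : 0 < `|v| + 1 by rewrite ltr_wpDl.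
  have := H _ (divr_gt0 e0 v1); apply: filterS => h Hh.
  rewrite -[frechet F (h + z) v - frechet F z v - Linop (D2vP z) h]/((frechet F (h + z) - frechet F z - frechet (frechet F) z h) v).
  rewrite (le_trans (le_norm_linop _ _))// (le_trans (ler_wpM2r _ Hh))//.
  rewrite mulrAC ler_wpM2r// -mulrA ler_piMr ?(ltW e0)//.
  by rewrite mulrC ler_pdivrMr// mul1r lerDl.
have d2 (s : R) : is_derive s 1 c (x - y).
  apply: is_derive_curve => e e0; apply/nbhs_ballP; exists 1 => //= h _.
  rewrite /c scalerDl addrA [_ + h *: _]addrC addrK subrr normr0.
  by rewrite mulr_ge0// ltW.
have d3 (s : R) := is_derive_along (d1 (c s)) (d2 s).
have cont : {within `[0, 1], continuous (fun s => frechet F (c s) v : R)}.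
  by apply: derivable_within_continuous => s _; exact: (@ex_derive _ _ _ _ _ _ _ (d3 s)).
have [s sI E1] := MVT (ltr01 : (0 : R) < 1) (fun s _ => d3 s) cont.
have : frechet F (c 1) v - frechet F (c 0) v = (frechet F x - frechet F y) v.
  have -> : c 1 = x by rewrite /c scale1r addrC subrK.
  by have -> : c 0 = y by rewrite /c scale0r addr0.
move=> <-; rewrite E1 subr0 mulr1 /=.
rewrite /D2v (le_trans (le_norm_linop _ _))// ler_wpM2r//.
apply: le_trans (@le_opnorm _ _ _ (frechet (frechet F) (c s)) (x - y)) _.
rewrite ler_wpM2r// D2// /c.
move: sI; rewrite in_itv/= => /andP[s0 s1].
have -> : y + s *: (x - y) = (1 - s) *: y + s *: x.
  by rewrite scalerBr scalerBl scale1r addrA addrAC.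
rewrite (le_trans (ler_normD _ _))// !normrZ !ger0_norm; [|lra..].
have h1 : (1 - s) * `|y| <= (1 - s) * r by rewrite ler_wpM2l//; lra.
have h2 : s * `|x| <= s * r by rewrite ler_wpM2l//; lra.
by lra.
Qed.

End DrivingForce.

(** * Primitives of vector-valued functions *)

Section Primitive.
Context {R : realType} {E : completeNormedModType R}.
Variable T : R.
Hypothesis T0 : 0 < T.

(** z is a primitive of h, phrased without integrals: on every interval on which
    h is within w of a constant c, the mean slope of z is within w of c. The
    condition is stable under uniform limits of h and pointwise limits of z. *)
Definition primitive (h z : R -> E) : Prop :=
  forall (s t : R) (c : E) (w : R), 0 <= s -> s <= t -> t <= T ->
  (forall x, s <= x -> x <= t -> `|h x - c| <= w) ->
  `|z t - z s - (t - s) *: c| <= (t - s) * w.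

Lemma primitive_lipschitz (h z : R -> E) (M : R) : primitive h z ->
  (forall t, t \in `[0, T] -> `|h t| <= M) ->
  forall s t, s \in `[0, T] -> t \in `[0, T] -> `|z s - z t| <= M * `|s - t|.
Proof.
move=> zh hM.
have key s t : 0 <= s -> s <= t -> t <= T -> `|z t - z s| <= M * (t - s).
  move=> s0 st tT; have := zh s t 0 M s0 st tT.
  rewrite scaler0 subr0 mulrC; apply => x sx xt.
  by rewrite subr0 hM// in_itv/=; apply/andP; split; lra.
move=> s t; rewrite !in_itv/= => /andP[s0 sT] /andP[t0 tT].
have [st|ts] := leP s t.
  by rewrite distrC [X in _ * X]ler0_norm ?opprB ?key// subr_le0.
by rewrite [X in _ * X]gtr0_norm ?subr_gt0// key// ltW.
Qed.

Lemma lipschitz_within_continuous (z : R -> E) (M : R) :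
  (forall s t, s \in `[0, T] -> t \in `[0, T] -> `|z s - z t| <= M * `|s - t|) ->
  {within `[0, T], continuous z}.
Proof.
move=> zM; apply: unif_within_continuous => e e0.
have M1 : 0 < `|M| + 1 by rewrite ltr_wpDl.
exists (e / (`|M| + 1)); first by rewrite divr_gt0.
move=> s t sT tT st; rewrite (le_trans (zM s t sT tT))//.
rewrite (@le_trans _ _ ((`|M| + 1) * `|s - t|))//.
  by rewrite ler_wpM2r// (le_trans (ler_norm _))// lerDl.
by rewrite -ler_pdivlMl// mulrC ltW.
Qed.

Lemma primitive_derive (h z : R -> E) : {within `[0, T], continuous h} ->
  primitive h z -> forall t, 0 < t -> t < T -> is_derive t 1 z (h t).
Proof.
move=> /heine_itv hc zh t t0 tT.
have tI : t \in `[0, T] by rewrite in_itv/= !ltW.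
apply: is_derive_curve => e e0.
have [d d0 hd] := hc e e0.
have near_t x : `|x - t| < d -> 0 <= x -> x <= T -> `|h x - h t| <= e.
  by move=> xt x0 xT; apply: hd => //; rewrite in_itv/= x0.
near=> s.
have sd : `|s| < d.
  near: s; apply/nbhs_ballP; exists d => //= s.
  by rewrite /ball/= sub0r normrN.
have st : `|s| < t.
  near: s; apply/nbhs_ballP; exists t => //= s.
  by rewrite /ball/= sub0r normrN.
have sT : `|s| < T - t.
  near: s; apply/nbhs_ballP; exists (T - t) => /=; first by rewrite subr_gt0.
  by move=> s; rewrite /ball/= sub0r normrN.
move: sd st sT; rewrite !ltr_norml => /andP[a1 a2] /andP[b1 b2] /andP[c1 c2].
have [s0|s0] := leP 0 s.
  have := zh t (t + s) (h t) e (ltW t0) _ _ _.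
  rewrite (_ : t + s - t = s) ?(ger0_norm s0); last by rewrite addrAC subrr add0r.
  rewrite [e * s]mulrC; apply; [by rewrite lerDl|by clear -c2; lra|] => x x1 x2.
  apply: near_t; [|by rewrite (le_trans (ltW t0))|by clear -x2 c2; lra].
  by rewrite ltr_norml; clear -x1 x2 d0 a2; apply/andP; split; lra.
have := zh (t + s) t (h t) e _ _ (ltW tT) _.
rewrite (_ : t - (t + s) = - s) ?(ltr0_norm s0); last by rewrite opprD addrA subrr add0r.
rewrite [e * _]mulrC -normrN => H.
have <- : - (z t - z (t + s) - - s *: h t) = z (t + s) - z t - s *: h t.
  by rewrite scaleNr opprK opprD opprB.
apply: H; [by clear -b1; lra|by clear -s0; lra|] => x x1 x2.
apply: near_t; [|by clear -x1 b1; lra|by rewrite (le_trans x2)// ltW].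
by rewrite ltr_norml; clear -x1 x2 d0 a1; apply/andP; split; lra.
Unshelve. all: by end_near. Qed.

Lemma primitive_cvg (I : Type) (U : set_system I) (UF : ProperFilter U)
    (h_ z_ : I -> R -> E) (h z : R -> E) :
  (forall k, primitive (h_ k) (z_ k)) ->
  (forall t, t \in `[0, T] -> z_ k t @[k --> U] --> z t) ->
  (forall e : R, 0 < e -> \forall k \near U, forall t, t \in `[0, T] -> `|h_ k t - h t| <= e) ->
  primitive h z.
Proof.
move=> zh zc hc s t c w s0 st tT hw.
have sI : s \in `[0, T] by rewrite in_itv/=; apply/andP; split; lra.
have tI : t \in `[0, T] by rewrite in_itv/=; apply/andP; split; lra.
have ts : 0 <= t - s by rewrite subr_ge0.
apply/ler_addgt0Pr => e e0.
have e1 : 0 < e / (t - s + 1) by rewrite divr_gt0// ltr_wpDl.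
have cv : `|z_ k t - z_ k s - (t - s) *: c| @[k --> U] --> `|z t - z s - (t - s) *: c|.
  apply: cvg_norm; apply: cvgB; last exact: cvg_cst.
  by apply: cvgB; exact: zc.
apply: cvgr_to_le cv _.
have := hc _ e1; apply: filterS => k hk.
have H : `|z_ k t - z_ k s - (t - s) *: c| <= (t - s) * (w + e / (t - s + 1)).
  apply: zh => // x sx xt.
  have xI : x \in `[0, T] by rewrite in_itv/=; apply/andP; split; lra.
  rewrite -(subrKA (h x)) (le_trans (ler_normD _ _))// addrC lerD//; first exact: hw.
  exact: hk.
apply: le_trans H _; rewrite mulrDr lerD2l mulrC mulrAC ler_pdivrMr ?ltr_wpDl//.
by rewrite ler_pM2l// lerDl.
Qed.

End Primitive.

Section PrimitiveAndWeakDerivative.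
Context {R : realType} {E : completeNormedModType R}.
Variable T : R.
Hypothesis T0 : 0 < T.
Local Notation mu := (@lebesgue_measure R).
Hypothesis nE : norming_dual E.

(** On a fine partition the difference quotients of z are uniformly close to
    h. *)
Lemma primitive_wderiv (h z : R -> E) : {within `[0, T], continuous h} ->
  primitive T h z -> is_wderiv T z h.
Proof.
move=> hc zh.
have [M M0 hM] := continuous_bounded_itv T0 hc.
have zc : {within `[0, T], continuous z}.
  by apply: lipschitz_within_continuous; exact: primitive_lipschitz hM.
have hm := continuous_strongly_measurable T0 hc.
apply: (@wderiv_of_L1 _ _ _ T0 nE z h (fun j => j.+1)) => //.
- by move=> K; exists K => // j /= Kj; exact: leqW.
- rewrite (@le_lt_trans _ _ (M * T)%:E) ?ltry//.
  apply: integral_le_cst => //; first exact: strongly_measurable_norm.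
  by move=> t t0 tT; rewrite hM// in_itv/= t0 ltW.
apply/ereal_cvg0P; first by move=> n; exact: integral_ge0.
move=> e e0.
have [d d0 hd] := heine_itv hc (divr_gt0 e0 T0).
have [N _ HN] := mesh_cvg0 T (gt0_half d0).
exists N => // j /= Nj.
have N0 : (0 < j.+1)%N by [].
have md : mesh T j.+1 < d.
  rewrite (le_lt_trans (HN _ _))//=; first exact: leqW.
  by rewrite ltr_pdivrMr// ltr_pMr// ltr1n.
have m0 := mesh_gt0 T0 N0.
rewrite -[e](divfK (x := T)) ?gt_eqF//.
apply: integral_le_cst => //.
- by apply: strongly_measurable_norm; apply: strongly_measurableB => //; exact: strongly_measurable_sf.
- by rewrite divr_ge0// ltW.
move=> t t0 tT.
have tI : t \in `[0, T] by rewrite in_itv/= t0 ltW.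
have kN := cell_index_lt T0 N0 t0 tT.
rewrite sf_eval_step//.
have /andP[h1 h2] := cell_index_itv T0 N0 t0.
set k := cell_index _ _ _ in kN h1 h2 *.
have /itvP a := node_itv T0 N0 (ltnW kN).
have /itvP b := node_itv T0 N0 kN.
have n01 : node T j.+1 k.+1 - node T j.+1 k = mesh T j.+1 by rewrite nodeS addrAC subrr add0r.
have := zh (node T j.+1 k) (node T j.+1 k.+1) (h t) (e / T).
rewrite a b n01 nodeS lerDl (ltW m0) => /(_ isT isT isT) H.
have -> : h t - diff_quot T z j.+1 k = - ((mesh T j.+1)^-1 *:
    (z (node T j.+1 k.+1) - z (node T j.+1 k) - mesh T j.+1 *: h t)).
  by rewrite /diff_quot [in RHS]scalerBr [in RHS]scalerA mulVf ?gt_eqF// scale1r opprB.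
rewrite normrN normrZ ger0_norm ?invr_ge0 ?(ltW m0)// ler_pdivrMl// nodeS.
apply: H => x x1 x2.
apply: hd => //.
  by rewrite in_itv/= (le_trans _ x1) ?a// (le_trans x2)// -nodeS b.
rewrite (le_lt_trans _ md)//; move: h2; rewrite nodeS => h2.
by rewrite ler_norml; apply/andP; split; lra.
Qed.

(** Since h is within r of c, xi w is almost everywhere at most xi c + r.
    Truncating it at that value changes it only on a null set and makes the bound
    hold everywhere, so that monotonicity of the integral applies. *)
Lemma wderiv_primitive (h z w : R -> E) : {within `[0, T], continuous z} ->
  L2 T w -> is_wderiv T z w -> {ae mu, forall t, t \in `]0, T[ -> w t = h t} ->
  primitive T h z.
Proof.
move=> zc wL2 zw wh s t c r s0 st tT hr.
apply/ler_addgt0Pr => e e0.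
have [xi [xi1 xi2]] := nE (z t - z s - (t - s) *: c) e0.
apply: le_trans xi2 _; rewrite lerD2r !linearB/= linearZ/=.
rewrite (wderiv_ftc T0 xi zc wL2 zw s0 st tT) /GRing.scale/=.
have ixi := integrable_itvS s0 tT (L2_functional_integrable T0 xi wL2).
pose b : R := xi c + r.
pose g x : R := Num.min (xi (w x)) b.
have mxi : measurable_fun `[s, t] (fun x => xi (w x)).
  by apply/measurable_EFinP; exact: (measurable_int _ ixi).
have mg : measurable_fun `[s, t] g by apply: measurable_minr => //; exact: measurable_cst.
have wg : {ae mu, forall x, x \in `[s, t] -> (xi (w x))%:E = (g x)%:E}.
  apply: ae_imply (ae_itv_closed wh) => x H xI; congr (_%:E).
  move: xI; rewrite in_itv/= => /andP[x1 x2].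
  have xT : x \in `[0, T] by rewrite in_itv/=; apply/andP; split; lra.
  apply/esym/min_idPl; rewrite H// /b -lerBlDl.
  by rewrite -linearB/= (le_trans (xi1 _))// hr.
have Ie : (\int[mu]_(x in `[s, t]) (xi (w x))%:E = \int[mu]_(x in `[s, t]) (g x)%:E)%E.
  by apply: ae_eq_integral => //; apply/measurable_EFinP.
have ig : mu.-integrable `[s, t] (EFin \o g).
  have ixiT := L2_functional_integrable T0 xi wL2.
  have mxiT : measurable_fun `[0, T] (fun x => xi (w x)).
    by apply/measurable_EFinP; exact: (measurable_int _ ixiT).
  apply: integrable_itvS s0 tT _.
  apply: (@integrable_le _ _ _ (fun x => `|xi (w x)| + `|b|)).
  - by apply: measurable_minr => //; exact: measurable_cst.
  - move=> x _; rewrite /g; have [_|_] := leP (xi (w x)) b.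
      by rewrite lerDl.
    by rewrite lerDr.
  - apply: integrable_addr; first exact: (@integrable_norm _ _ _ mu _ _ ixiT).
    apply: (@integrable_bounded _ _ T0 (cst `|b|) `|b|); first exact: measurable_cst.
    by move=> x _; rewrite normr_id.
have ib : mu.-integrable `[s, t] (EFin \o cst b).
  apply: integrable_itvS s0 tT _.
  by apply: (@integrable_bounded _ _ T0 (cst b) `|b|); first exact: measurable_cst.
have : \int[mu]_(x in `[s, t]) xi (w x) <= \int[mu]_(x in `[s, t]) (cst b x).
  rewrite /Rintegral Ie -!/(Rintegral mu _ _); apply: le_Rintegral => // x _.
  by rewrite /g ge_min lexx orbT.
have -> : \int[mu]_(x in `[s, t]) (cst b x) = b * (t - s).
  rewrite Rintegral_cst//; congr (_ * _).
  have em : mu `[s, t]%classic = (t - s)%:E.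
    rewrite lebesgue_measure_itv/= lte_fin; case: ifPn => [_|]; first by rewrite EFinB.
    by rewrite -leNgt => ts; congr (_%:E); lra.
  by rewrite [X in fine X]em.
by rewrite /b; lra.
Qed.

End PrimitiveAndWeakDerivative.

(** * Compactness along an ultrafilter *)

Section UltrafilterLimits.
Context {R : realType} {I : Type}.
Variable U : set_system I.
Hypothesis UU : UltraFilter U.

(** Bounded sequences converge along an ultrafilter; this replaces the extraction
    of diagonal subsequences over countable sets of times and vectors. *)
Lemma ultra_bounded_cvg (u : I -> R) (M : R) :
  (forall k, `|u k| <= M) -> cvg (u k @[k --> U]).
Proof.
move=> uM; have UP : ProperFilter U by exact: ultra_proper.
have FP : ProperFilter (u k @[k --> U]) by exact: fmap_proper_filter.
have [|x [_ xcl]] := segment_compact (a := - M) (b := M) FP.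
  have : \forall k \near U, u k \in `[- M, M].
    by apply: filterE => k; rewrite in_itv/= -ler_norml.
  by [].
apply/cvg_ex; exists x => B Bx; rewrite /nbhs/=.
have [//|UB] := in_ultra_setVsetC (u @^-1` B) UU.
by have [y [/= yB By]] := xcl (~` B) B UB Bx.
Qed.

(** The Banach-Alaoglu theorem: pointwise limits of uniformly bounded functionals
    are functionals. *)
Lemma dual_bounded_cvg (V : completeNormedModType R) (xi_ : I -> dual V) (K : R) :
  (forall k, `|xi_ k| <= K) ->
  exists xi : dual V, forall v, (xi_ k v : R) @[k --> U] --> (xi v : R).
Proof.
move=> xiK; have UP : ProperFilter U by exact: ultra_proper.
have xib v k : `|xi_ k v| <= K * `|v|.
  by rewrite (le_trans (le_norm_linop (xi_ k) v))// ler_wpM2r.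
pose f v : R := lim (xi_ k v @[k --> U]).
have fP v : xi_ k v @[k --> U] --> f v by exact: ultra_bounded_cvg (xib v).
have fL : (f : V -> R^o) \in (is_linop : pred (V -> R^o)).
  apply: (@bounded_linear_is_linop _ _ _ _ K).
    move=> a u v; apply: (@cvg_lim _ (@Rhausdorff R)).
    have -> : (fun k => xi_ k (a *: u + v) : R) = (fun k => a * xi_ k u + xi_ k v).
      by apply/funext => k; rewrite linearP.
    by apply: cvgD; [apply: cvgMl_tmp; exact: fP|exact: fP].
  move=> v; have cv : `|xi_ k v| @[k --> U] --> `|f v| by apply: cvg_norm.
  by apply: cvgr_to_le cv _; apply: filterE => k; exact: xib.
by exists (Linop fL) => v; exact: fP.
Qed.

End UltrafilterLimits.

Section WeakStarLimits.
Context {R : realType} {V : completeNormedModType R} {I : Type}.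
Variable U : set_system I.
Hypothesis UP : ProperFilter U.

Lemma dual_cvg_norm_le (xi_ : I -> dual V) (xi : dual V) (K : R) :
  (forall v, (xi_ k v : R) @[k --> U] --> (xi v : R)) ->
  (\forall k \near U, `|xi_ k| <= K) -> `|xi| <= K.
Proof.
move=> xic xiK; have K0 : 0 <= K.
  by have [k] := filter_ex xiK; apply: le_trans.
apply: linop_norm_le => // v.
have cv : `|xi_ k v| @[k --> U] --> `|xi v : R| by apply: cvg_norm; exact: xic.
apply: cvgr_to_le cv _; apply: filterS xiK => k xiK.
by rewrite (le_trans (le_norm_linop (xi_ k) v))// ler_wpM2r.
Qed.

Lemma dual_cvg_norm_lsc (xi_ : I -> dual V) (xi : dual V) :
  (forall v, (xi_ k v : R) @[k --> U] --> (xi v : R)) ->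
  forall e, 0 < e -> \forall k \near U, `|xi| <= `|xi_ k| + e.
Proof.
move=> xic e e0; have [v v1 xiv] := dual_norm_approx xi (gt0_half e0).
have : \forall k \near U, `|(xi v : R) - xi_ k v| <= e / 2.
  by move: (xic v) => /cvgrPdist_le; apply; exact: gt0_half.
apply: filterS => k; rewrite ler_norml => /andP[_ h].
have : xi_ k v <= `|xi_ k|.
  by rewrite (le_trans (ler_norm _))// (le_trans (le_norm_linop (xi_ k) v))// ler_piMr.
by lra.
Qed.

(** Pointwise convergence of equicontinuous functionals is uniform on
    precompact sets, here on the image of the unit ball of [Z]. *)
Lemma pullback_cvg0 (Z : completeNormedModType R) (i : linop Z V)
    (xi_ : I -> dual V) (xi : dual V) (K : R) : compact_op i ->
  (forall k, `|xi_ k| <= K) ->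
  (forall v, (xi_ k v : R) @[k --> U] --> (xi v : R)) ->
  forall e, 0 < e -> \forall k \near U, `|pullback i (xi_ k) - pullback i xi| <= e.
Proof.
rewrite /compact_op precompactE => /compact_near_coveringP cpt xiK xic e e0.
have xiK' : `|xi| <= K by apply: dual_cvg_norm_le xic _; exact: filterE.
have K0 : 0 <= K by apply: le_trans xiK'.
suff H : forall w, closure (i @` [set x | `|x| <= 1]) w ->
    \forall w' \near w & k \near U, `|(xi_ k - xi) w'| <= e.
  have FU : Filter U by exact: _.
  have := cpt I U (fun k v => `|(xi_ k - xi) v| <= e) FU H.
  apply: filterS => k hk.
  apply: opnorm_le => x x1; apply: (hk (i x)).
  by apply: subset_closure; exists x.
move=> v _.
have K1 : 0 < 4 * (K + 1) by rewrite mulr_gt0// ltr_wpDl.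
exists (ball v (e / (4 * (K + 1))), [set k | `|(xi v : R) - xi_ k v| <= e / 2]) => /=.
  split; first by apply: nbhsx_ballx; rewrite divr_gt0.
  by move: (xic v) => /cvgrPdist_le; apply; exact: gt0_half.
move=> [w k] /= []; rewrite -ball_normE/= => vw hk.
pose f : dual V := xi_ k - xi.
change (`|f w : R| <= e).
have -> : (f w : R) = - f (v - w) + (xi_ k v - xi v).
  by rewrite [f (v - w)]linearB opprB -[xi_ k v - xi v]/(f v) subrK.
apply: le_trans (ler_normD _ _) _; rewrite normrN [leRHS]splitr lerD//; last by rewrite distrC.
apply: le_trans (le_norm_linop _ _) _.
have h1 : `|xi_ k - xi| <= 2 * (K + 1).
  by rewrite (le_trans (ler_normB _ _))//; have := xiK k; lra.
apply: (@le_trans _ _ (2 * (K + 1) * (e / (4 * (K + 1))))).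
  by rewrite ler_pM// ltW.
by rewrite le_eqVlt; apply/orP; left; apply/eqP; field; rewrite gt_eqF// ltr_wpDl.
Qed.

End WeakStarLimits.

(** Equicontinuity and compactness of the interval make a pointwise upper bound
    along a filter uniform in time. *)
Lemma equicontinuous_near (R : realType) (T : R) (I : Type) (U : set_system I)
    (g : I -> R -> R) : Filter U ->
  (forall e, 0 < e -> exists2 d, 0 < d & forall k s t, s \in `[0, T] ->
     t \in `[0, T] -> `|s - t| < d -> g k t <= g k s + e) ->
  (forall t, t \in `[0, T] -> forall e, 0 < e -> \forall k \near U, g k t <= e) ->
  forall e, 0 < e -> \forall k \near U, forall t, t \in `[0, T] -> g k t <= e.
Proof.
move=> FU gc gU e e0.
have /compact_near_coveringP/near_covering_withinP cpt :
  compact (`[0, T]%classic : set R) by exact: segment_compact.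
have [d d0 hd] := gc _ (gt0_half e0).
suff H : forall s, `[0, T]%classic s ->
    \forall t \near s & k \near U, `[0, T]%classic t -> g k t <= e.
  have := cpt I U (fun k t => g k t <= e) FU H.
  by apply: filterS => k hk t tT; exact: hk.
move=> s sT.
exists (ball s d, [set k | g k s <= e / 2]) => /=.
  split; first exact: nbhsx_ballx.
  by apply: gU => //; exact: gt0_half.
move=> [t k] /= [st hk] tT; have := hd k s t sT tT st; lra.
Qed.

(** * The H^1 norm *)

Section H1norm.
Context {R : realType} {E : completeNormedModType R}.
Variable T : R.
Hypothesis T0 : 0 < T.
Hypothesis nE : norming_dual E.
Hypothesis pE : parallelogram_le E.
Local Notation mu := (@lebesgue_measure R).

Lemma L2normsq_fin (u : R -> E) : L2 T u -> L2normsq T u \is a fin_num.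
Proof.
move=> [_ uL2]; rewrite ge0_fin_numE//.
by apply: integral_ge0 => t _; rewrite lee_fin sqr_ge0.
Qed.

Lemma L2normsq_ge0 (u : R -> E) : (0 <= L2normsq T u)%E.
Proof. by apply: integral_ge0 => t _; rewrite lee_fin sqr_ge0. Qed.

Lemma continuous_L2 (u : R -> E) : {within `[0, T], continuous u} -> L2 T u.
Proof.
move=> uc; have um := continuous_strongly_measurable T0 uc.
have [M M0 uM] := continuous_bounded_itv T0 uc.
split => //; rewrite (@le_lt_trans _ _ (M ^+ 2 * T)%:E) ?ltry//.
apply: integral_le_cst => //.
- by apply: measurable_funX; exact: strongly_measurable_norm.
- exact: sqr_ge0.
by move=> t t0 tT; rewrite lerXn2r ?nnegrE// uM// in_itv/= t0 ltW.
Qed.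

Lemma H1normsqE (u : R -> E) : sobolev T 1 u ->
  H1normsq T u = (fine (L2normsq T u) + fine (L2normsq T (wderiv T u)))%:E.
Proof.
move=> us; have [w1 _] := sobolev1_wderiv us; have [uL2 _] := us.
by rewrite EFinD !fineK ?L2normsq_fin.
Qed.

Lemma H1normsq_wderiv (u g : R -> E) : {within `[0, T], continuous u} ->
  L2 T g -> is_wderiv T u g -> H1normsq T u = (L2normsq T u + L2normsq T g)%E.
Proof.
move=> uc gL2 ug.
have [w1 w2] : L2 T (wderiv T u) /\ is_wderiv T u (wderiv T u) by apply: wderivP; exists g.
congr (_ + _)%E; apply: ae_eq_L2normsq => //; [exact: w1.1|exact: gL2.1|].
exact: wderiv_unique w1 w2 gL2 ug.
Qed.

(** This gives the loads of a minimizing sequence a common modulus of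
    continuity. *)
Lemma H1_holder (u : R -> E) (M : R) : {within `[0, T], continuous u} ->
  sobolev T 1 u -> fine (H1normsq T u) <= M ->
  forall s t, s \in `[0, T] -> t \in `[0, T] -> `|u s - u t| ^+ 2 <= M * `|s - t|.
Proof.
move=> uc us uM.
have [w1 w2] := sobolev1_wderiv us.
have M1 : fine (L2normsq T (wderiv T u)) <= M.
  move: uM; rewrite H1normsqE//=; apply: le_trans.
  by rewrite lerDr fine_ge0// L2normsq_ge0.
have key s t : s \in `[0, T] -> t \in `[0, T] -> s < t -> `|u t - u s| ^+ 2 <= M * (t - s).
  rewrite !in_itv/= => /andP[s0 sT] /andP[t0 tT] st.
  apply: le_trans (wderiv_increment T0 nE uc w1 w2 s0 st tT) _.
  rewrite mulrC ler_pM2r ?subr_gt0//; apply: le_trans M1.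
  have iw := L2_sqnorm_integrable w1.
  rewrite fine_le ?L2normsq_fin//.
    exact: (@integrable_fin_num _ _ _ mu _ (measurable_itv _) _ (integrable_itvS s0 tT iw)).
  apply: ge0_subset_integral => //=.
  - exact: (measurable_int _ iw).
  - by apply: subset_itv; rewrite bnd_simp.
move=> s t sT tT; have [st|ts|->] := ltgtP s t.
- by rewrite distrC [`|s - t|]ltr0_norm ?subr_lt0// opprB key.
- by rewrite [`|s - t|]gtr0_norm ?subr_gt0// key.
- by rewrite !subrr !normr0 expr0n/= mulr0.
Qed.

(** Weak lower semicontinuity, through the characterization of the norm of the
    derivative as the supremum of the discrete energies, each of which only
    sees finitely many increments. *)
Lemma H1_lsc (I : Type) (U : set_system I) (UP : ProperFilter U)
    (u_ : I -> R -> E) (u : R -> E) (h : R) :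
  (forall k, sobolev T 1 (u_ k)) -> (forall k, {within `[0, T], continuous (u_ k)}) ->
  {within `[0, T], continuous u} ->
  (forall e, 0 < e -> \forall k \near U, forall t, t \in `[0, T] ->
     `|u t| ^+ 2 <= `|u_ k t| ^+ 2 + e) ->
  (forall s t, s \in `[0, T] -> t \in `[0, T] -> forall e, 0 < e ->
     \forall k \near U, `|u t - u s| ^+ 2 <= `|u_ k t - u_ k s| ^+ 2 + e) ->
  (forall e, 0 < e -> \forall k \near U, fine (H1normsq T (u_ k)) <= h + e) ->
  sobolev T 1 u /\ fine (H1normsq T u) <= h.
Proof.
move=> us_ uc_ uc uU du hU.
have uL2 := continuous_L2 uc.
set P := fine (L2normsq T u).
have Pk k e : 0 < e -> (forall t, t \in `[0, T] -> `|u t| ^+ 2 <= `|u_ k t| ^+ 2 + e) ->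
    P <= fine (L2normsq T (u_ k)) + e * T.
  move=> e0 H.
  have i1 := L2_sqnorm_integrable uL2.
  have i2 := L2_sqnorm_integrable (us_ k).1.
  have i3 : mu.-integrable `[0, T] (EFin \o cst e).
    by apply: (@integrable_bounded _ _ T0 (cst e) `|e|); first exact: measurable_cst.
  have -> : fine (L2normsq T (u_ k)) + e * T =
      \int[mu]_(t in `[0, T]) (`|u_ k t| ^+ 2 + cst e t).
    rewrite RintegralD// Rintegral_cst//.
    by have em := mu_itv0T T0; rewrite [X in _ = _ + e * fine X]em.
  by apply: le_Rintegral => //; exact: integrable_addr.
have en n : discrete_energy T (2 ^ n) u <= h - P.
  set N := (2 ^ n)%N.
  have N0 : (0 < N)%N by rewrite expn_gt0.
  have m0 := mesh_gt0 T0 N0.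
  pose c := 1 + T + N%:R / mesh T N.
  have c0 : 0 < c by rewrite addr_gt0// ?addr_gt0// divr_gt0// ltr0n.
  apply/ler_addgt0Pr => e e0; pose e' := e / c.
  have e'0 : 0 < e' by rewrite divr_gt0.
  have nodeT (k : 'I_N) : node T N k \in `[0, T] /\ node T N k.+1 \in `[0, T].
    by split; apply: node_itv => //; exact: ltnW.
  have : \forall k \near U, forall i : 'I_N,
      `|u (node T N i.+1) - u (node T N i)| ^+ 2 <=
      `|u_ k (node T N i.+1) - u_ k (node T N i)| ^+ 2 + e'.
    by apply: filter_forall => i; have [a b] := nodeT i; exact: du.
  move=> H3; have H1 := uU _ e'0; have H2 := hU _ e'0.
  have [k [[H1k H2k] H3k]] := filter_ex (filterI (filterI H1 H2) H3).
  have h1 := Pk k _ e'0 H1k.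
  have [w1 w2] := sobolev1_wderiv (us_ k).
  have h2 := discrete_energy_le T0 nE N0 (uc_ k) w1 w2.
  rewrite (H1normsqE (us_ k))/= in H2k.
  have h3 : discrete_energy T N u <= discrete_energy T N (u_ k) + e' * (N%:R / mesh T N).
    have -> : discrete_energy T N (u_ k) + e' * (N%:R / mesh T N) =
        \sum_(i < N) (`|u_ k (node T N i.+1) - u_ k (node T N i)| ^+ 2 / mesh T N + e' / mesh T N).
      rewrite big_split/= sumr_const card_ord; congr (_ + _).
      by rewrite -mulr_natl; ring.
    apply: ler_sum => i _; rewrite -mulrDl ler_pM2r ?invr_gt0//; exact: H3k.
  have ee : e = e' * 1 + e' * T + e' * (N%:R / mesh T N).
    by rewrite -!mulrDr /e' divfK// gt_eqF.
  rewrite ee; move: h1 h2 h3 H2k.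
  set a := e' * (_ / _); set q := fine (L2normsq T (u_ k)).
  set q' := fine (L2normsq T (wderiv T (u_ k))).
  by move=> h1 h2 h3 h4; lra.
have [g [gL2 ug gh]] := wderiv_of_bounded_energy T0 nE pE uc en.
have us : sobolev T 1 u by split => //; exists g.
split => //; rewrite (H1normsq_wderiv uc gL2 ug).
rewrite fineD ?L2normsq_fin// -/P -lerBrDl -lee_fin fineK ?L2normsq_fin//.
Qed.

End H1norm.

(** * The state equation *)

(** The function exp(- a t) (y t + b / a) has nonpositive derivative. *)
Lemma gronwall_itv (R : realType) (T a b : R) (y dy : R -> R) :
  0 < a -> 0 <= b -> {within `[0, T], continuous y} -> y 0 = 0 ->
  (forall t, 0 < t -> t < T -> is_derive t 1 (y : R -> R^o) (dy t)) ->
  (forall t, 0 < t -> t < T -> dy t <= a * y t + b) ->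
  forall t, t \in `[0, T] -> y t <= b / a * expR (a * T).
Proof.
move=> a0 b0 yc y0 ydy dyle t; rewrite in_itv/= => /andP[t0 tT].
have ba : 0 <= b / a by rewrite divr_ge0// ltW.
move: t0; rewrite le_eqVlt => /predU1P[<-|t0].
  by rewrite y0 mulr_ge0// expR_ge0.
pose f s : R^o := expR (- a * s) * (y s + b / a).
have fd s : s \in `]0, t[ -> is_derive s 1 f (expR (- a * s) * (dy s - a * y s - b)).
  rewrite in_itv/= => /andP[s0 st].
  have hy := ydy s s0 (lt_le_trans st tT).
  have he : is_derive s 1 (fun s : R => expR (- a * s) : R^o) (- a * expR (- a * s)).
    apply: is_derive_eq.
    by rewrite mulrC; congr (_ * _); exact: mulr1.
  have hf : is_derive s 1 f (expR (- a * s) *: (dy s + 0) + (y s + b / a) *: (- a * expR (- a * s)) : R^o).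
    have hyb : is_derive s 1 (fun s => y s + b / a : R^o) (dy s + 0).
      exact: is_deriveD.
    exact: is_deriveM.
  apply: is_derive_eq; rewrite /GRing.scale/=.
  have : b / a * a = b by rewrite divfK// gt_eqF.
  set c := b / a => ca; rewrite -[in RHS]ca; ring.
have yct : {within `[0, t], continuous y}.
  apply: continuous_subspaceW yc; apply: subset_itvl.
  by rewrite bnd_simp.
have fc : {within `[0, t], continuous f}.
  apply/subspace_continuousP => x xt.
  apply: cvgM.
    apply: cvg_within_filter; apply: continuous_cvg; first exact: continuous_expR.
    by apply: cvgMl_tmp; exact: cvg_id.
  apply: cvgD; last exact: cvg_cst.
  exact: (subspace_continuousP _ _).1 yct x xt.
have [c cI E] := MVT t0 fd fc.
have : f t - f 0 <= 0.
  rewrite E pmulr_lle0 ?subr_gt0// pmulr_rle0 ?expR_gt0//.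
  move: cI; rewrite in_itv/= => /andP[c0 ct].
  by have := dyle c c0 (lt_le_trans ct tT); lra.
rewrite /f mulr0 expR0 y0 add0r mul1r subr_le0 mulNr expRN.
rewrite mulrC ler_pdivrMr ?expR_gt0// => H.
apply: le_trans (le_trans _ H) _; first by rewrite lerDl.
by rewrite ler_wpM2l// ler_expR ler_pM2l.
Qed.

Section StateEquation.
Context {R : realType} {Z V X : completeNormedModType R}.
Variables (T : R) (iZV : linop Z V) (iVX : linop V X) (A : linop Z (dual Z)).
Variables (F : Z -> R^o) (D : Z -> R) (eps delta alpha : R).
Hypothesis T0 : 0 < T.
Hypothesis nZ : norming_dual Z.
Hypothesis hD : dissipation iZV iVX D.
Hypothesis As : symmetric_op A.
Hypothesis alpha0 : 0 < alpha.
Hypothesis Ac : forall z, alpha * `|z| ^+ 2 <= A z z.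
Hypothesis eps0 : 0 < eps.
Hypothesis delta0 : 0 < delta.
Hypothesis FC1 : C1 F.
Hypothesis FC1' : C1 (frechet F).
Hypothesis F0 : forall z, 0 <= F z.
Hypothesis Flip : forall B : set Z, bounded_set B ->
  exists k : R, k.-lipschitz_B (frechet (frechet F)).

(** The state equation is z' = speed l z; solutions are handled in the form
    [primitive T (speed l z) z]. *)
Definition speed (l : R -> dual V) (z : R -> Z) (t : R) : Z :=
  resolvent iZV A D eps delta (- DzI iZV A F (l t) (z t)).

Lemma speed_dist (r : R) : 0 <= r -> exists2 C : R, 0 < C &
  forall l z l' z' s t, `|z s| <= r -> `|z' t| <= r ->
    `|speed l z s - speed l' z' t| <=
    C * (`|pullback iZV (l s) - pullback iZV (l' t)| + `|z s - z' t|).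
Proof.
move=> r0; have [K K0 HK] := frechet_locally_lipschitz FC1' Flip r0.
have da : 0 < 2 / (delta * alpha) by rewrite divr_gt0// mulr_gt0.
have AK : 0 <= `|A| + K by rewrite addr_ge0.
exists (2 / (delta * alpha) * (1 + (`|A| + K))).
  by rewrite mulr_gt0// ltr_pwDl.
move=> l z l' z' s t zr zr'.
rewrite /speed (le_trans (resolvent_lip hD As alpha0 Ac eps0 delta0 _ _))//.
rewrite -[leRHS]mulrA ler_pM2l//.
rewrite (le_trans (DzI_dist iZV As FC1 (l s) (l' t) (HK _ _ zr zr')))//.
set a := `|pullback _ _ - _|; set b := `|z s - z' t|.
have a0 : 0 <= a by exact: normr_ge0.
have b0 : 0 <= b by exact: normr_ge0.
have : 0 <= (`|A| + K) * a by exact: mulr_ge0.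
by set k := `|A| + K; lra.
Qed.

Lemma speed_continuous l z : {within `[0, T], continuous l} ->
  {within `[0, T], continuous z} -> {within `[0, T], continuous (speed l z)}.
Proof.
move=> lc zc; have [r r0 zr] := continuous_bounded_itv T0 zc.
have [C C0 HC] := speed_dist r0.
apply: unif_within_continuous => e e0.
have i1 : 0 < `|iZV| + 1 by rewrite ltr_wpDl.
have e1 : 0 < e / (C * (`|iZV| + 1)) / 2 by rewrite !divr_gt0// mulr_gt0.
have e2 : 0 < e / C / 2 by rewrite !divr_gt0.
have [d1 d10 h1] := heine_itv lc e1.
have [d2 d20 h2] := heine_itv zc e2.
exists (Num.min d1 d2); first by rewrite lt_min d10.
move=> s t sT tT; rewrite lt_min => /andP[st1 st2].
rewrite (le_trans (HC _ _ _ _ _ _ (zr s sT) (zr t tT)))//.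
rewrite -ler_pdivlMl// mulrC [leRHS]splitr lerD//; last exact: h2.
rewrite (le_trans (pullback_dist _ _ _))//.
rewrite (@le_trans _ _ ((`|iZV| + 1) * (e / (C * (`|iZV| + 1)) / 2)))//.
  by rewrite ler_pM// ?lerDl// h1.
by rewrite le_eqVlt; apply/orP; left; apply/eqP; field; rewrite !gt_eqF.
Qed.

(** Regularity gained from the equation: the weak derivative of an admissible
    state equals almost everywhere a continuous function of time, of which the
    state is therefore a classical primitive. *)
Lemma state_primitive l z : {within `[0, T], continuous z} -> sobolev T 2 z ->
  {ae lebesgue_measure, forall t, t \in `]0, T[ ->
    subdiff_dual (conjugate (EFin \o visc iZV A D eps delta))
      (- DzI iZV A F (l t) (z t)) = [set wderiv T z t]} ->
  primitive T (speed l z) z.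
Proof.
move=> zc /sobolev1_wderiv[w1 w2] H.
apply: (wderiv_primitive T0 nZ zc w1 w2).
apply: ae_imply H => t H tT.
have := H tT; rewrite (subdiff_conjugate_visc hD As alpha0 Ac eps0 delta0).
by move=> /seteqP[_ /(_ _ erefl)].
Qed.

Definition stored_energy z : R := 2^-1 * A z z + F z.

(** Testing the equation with the velocity: the work of the load exceeds what
    the viscosity dissipates by at most K^2 / (2 eps) per unit of time, by Young's
    inequality. *)
Lemma state_bound l z K : {within `[0, T], continuous l} ->
  {within `[0, T], continuous z} -> primitive T (speed l z) z ->
  (forall t, t \in `[0, T] -> `|l t| <= K) ->
  forall t, t \in `[0, T] ->
    alpha / 2 * `|z t| ^+ 2 <= stored_energy (z 0) + T * (K ^+ 2 / (2 * eps)).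
Proof.
move=> lc zc zh lK.
have hc := speed_continuous lc zc.
pose de t := (A (z t) + frechet F (z t) : dual Z) (speed l z t).
have ed t : t \in `]0, T[ -> is_derive t 1 (fun s => stored_energy (z s) : R^o) (de t).
  rewrite in_itv/= => /andP[t0 tT].
  have h1 := stored_energy_diff As FC1 (z t).
  exact: is_derive_along h1 (primitive_derive hc zh t0 tT).
have dle t : t \in `[0, T] -> de t <= K ^+ 2 / (2 * eps).
  move=> tT; set h := speed l z t.
  have h1 := resolvent_visc_le hD As alpha0 Ac eps0 delta0 (- DzI iZV A F (l t) (z t)).
  rewrite -/(speed l z t) -/h (viscE _ _ _ _ alpha0 Ac) (DzI_E iZV As FC1) in h1.
  have h2 : 0 <= D h by exact: dissipation_ge0 hD _.
  have h3 : 0 <= delta / 2 * A h h.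
    by rewrite mulr_ge0 ?divr_ge0 ?(ltW delta0)// (le_trans _ (Ac h))// mulr_ge0 ?sqr_ge0// ltW.
  have h4 : (pullback iZV (l t) - (A (z t) + frechet F (z t))) h = l t (iZV h) - de t by [].
  have h5 : l t (iZV h) <= K * `|iZV h|.
    by rewrite (le_trans (ler_norm _))// (le_trans (le_norm_linop (l t) _))// ler_wpM2r// lK.
  have h6 : K * `|iZV h| <= K ^+ 2 / (2 * eps) + eps / 2 * `|iZV h| ^+ 2.
    rewrite -subr_ge0.
    have -> : K ^+ 2 / (2 * eps) + eps / 2 * `|iZV h| ^+ 2 - K * `|iZV h| =
      (K - eps * `|iZV h|) ^+ 2 / (2 * eps) by field; rewrite gt_eqF.
    by rewrite divr_ge0 ?sqr_ge0// mulr_ge0// ltW.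
  by rewrite h4 in h1; lra.
have Kb : 0 <= K ^+ 2 / (2 * eps) by rewrite divr_ge0 ?sqr_ge0// mulr_ge0// ltW.
have ec : {within `[0, T], continuous (fun s => stored_energy (z s) : R)}.
  apply/subspace_continuousP => x xT.
  have zx := (subspace_continuousP _ _).1 zc x xT.
  apply: (@continuous_cvg _ _ _ _ _ _ stored_energy) => //.
  have h1 := stored_energy_diff As FC1 (z x).
  exact: (@differentiable_continuous _ _ _ _ _ (@ex_diff _ _ _ _ _ _ _ h1)).
move=> t tT; have tT' := tT; move: tT; rewrite in_itv/= => /andP[t0 tT].
apply: (@le_trans _ _ (stored_energy (z t))).
  by rewrite /stored_energy; have := Ac (z t); have := F0 (z t); lra.
rewrite -lerBlDl.
move: t0; rewrite le_eqVlt => /predU1P[<-|t0].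
  by rewrite subrr mulr_ge0// ltW.
have edt s : s \in `]0, t[ -> is_derive s 1 (fun s => stored_energy (z s) : R^o) (de s).
  by rewrite in_itv/= => /andP[s0 st]; apply: ed; rewrite in_itv/= s0 (lt_le_trans st).
have ect : {within `[0, t], continuous (fun s => stored_energy (z s) : R)}.
  by apply: continuous_subspaceW ec; apply: subset_itvl; rewrite bnd_simp.
have [c cI ->] := MVT t0 edt ect.
rewrite subr0 mulrC (@le_trans _ _ (t * (K ^+ 2 / (2 * eps))))//; last by rewrite ler_wpM2r.
rewrite ler_pM2l//; apply: dle.
by move: cI; rewrite !in_itv/= => /andP[c0 ct]; apply/andP; split; lra.
Qed.

(** Only the pullbacks of the loads enter the equation, so that the state
    depends continuously on the load in the norm of the dual of [Z]. *)
Lemma state_dependence (r : R) : 0 <= r -> exists2 C : R, 0 < C &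
  forall l1 z1 l2 z2 sig,
    {within `[0, T], continuous l1} -> {within `[0, T], continuous z1} ->
    {within `[0, T], continuous l2} -> {within `[0, T], continuous z2} ->
    primitive T (speed l1 z1) z1 -> primitive T (speed l2 z2) z2 ->
    (forall t, t \in `[0, T] -> `|z1 t| <= r) ->
    (forall t, t \in `[0, T] -> `|z2 t| <= r) ->
    z1 0 = z2 0 -> 0 <= sig ->
    (forall t, t \in `[0, T] -> `|pullback iZV (l1 t) - pullback iZV (l2 t)| <= sig) ->
    forall t, t \in `[0, T] -> `|z1 t - z2 t| <= C * sig.
Proof.
move=> r0; have [C C0 HC] := speed_dist r0.
pose B := (`|A| + 1) * C.
have A1 : 0 < `|A| + 1 by rewrite ltr_wpDl.
have B0 : 0 < B by rewrite mulr_gt0.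
(* With y = A d d / 2 for the difference d of the states, coercivity and Young's
   inequality give y' <= a y + B sig^2 / 2, and [Q] is the Gronwall bound for
   |d|^2 / sig^2. *)
pose a := 3 * B / alpha.
have a0 : 0 < a by rewrite divr_gt0// mulr_gt0.
pose Q := 2 / alpha * (B / 2 / a * expR (a * T)).
have Q0 : 0 < Q by rewrite !mulr_gt0 ?expR_gt0 ?invr_gt0// !divr_gt0.
exists (Num.sqrt Q); first by rewrite sqrtr_gt0.
move=> l1 z1 l2 z2 sig lc1 zc1 lc2 zc2 zh1 zh2 zr1 zr2 z12 sig0 lsig t tT.
have hc1 := speed_continuous lc1 zc1; have hc2 := speed_continuous lc2 zc2.
pose d s := z1 s - z2 s; pose h s := speed l1 z1 s - speed l2 z2 s.
pose y s : R := 2^-1 * A (d s) (d s).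
have dc : {within `[0, T], continuous d}.
  apply/subspace_continuousP => x xT; apply: cvgB.
    exact: (subspace_continuousP _ _).1 zc1 x xT.
  exact: (subspace_continuousP _ _).1 zc2 x xT.
have yc : {within `[0, T], continuous y}.
  apply/subspace_continuousP => x xT.
  have dx := (subspace_continuousP _ _).1 dc x xT.
  apply: (@continuous_cvg _ _ _ _ _ _ (fun w => 2^-1 * A w w : R)) => //.
  have h1 := quadratic_form_diff As (d x).
  exact: (@differentiable_continuous _ _ _ _ _ (@ex_diff _ _ _ _ _ _ _ h1)).
have y0 : y 0 = 0 by rewrite /y /d z12 subrr !linear0 mulr0.
have yd s : 0 < s -> s < T -> is_derive s 1 (y : R -> R^o) (A (d s) (h s)).
  move=> s0 sT.
  have hz1 := primitive_derive hc1 zh1 s0 sT.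
  have hz2 := primitive_derive hc2 zh2 s0 sT.
  have hd : is_derive s 1 d (h s) by exact: is_deriveB hz1 hz2.
  exact: is_derive_along (quadratic_form_diff As (d s)) hd.
have dd s : `|d s| ^+ 2 <= 2 / alpha * y s.
  by rewrite mulrAC ler_pdivlMr// /y; have := Ac (d s); lra.
have yle s : 0 < s -> s < T -> A (d s) (h s) <= a * y s + B * sig ^+ 2 / 2.
  move=> s0 sT; have sI : s \in `[0, T] by rewrite in_itv/= !ltW.
  have h1 := HC l1 z1 l2 z2 s s (zr1 s sI) (zr2 s sI).
  have h2 := lsig s sI.
  have h3 : `|h s| <= C * (sig + `|d s|).
    by apply: le_trans h1 _; rewrite ler_pM2l// lerD2r.
  apply: le_trans (ler_norm _) _; apply: le_trans (bilinear_bound A _ _) _.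
  rewrite (@le_trans _ _ ((`|A| + 1) * `|d s| * (C * (sig + `|d s|))))//.
    by rewrite ler_pM// ?mulr_ge0// ler_wpM2r// lerDl.
  have -> : (`|A| + 1) * `|d s| * (C * (sig + `|d s|)) = B * (`|d s| * (sig + `|d s|)).
    by rewrite /B; ring.
  have -> : a * y s + B * sig ^+ 2 / 2 = B * (3 / 2 * (2 / alpha * y s) + sig ^+ 2 / 2).
    by rewrite /a; field; rewrite gt_eqF.
  rewrite ler_pM2l//.
  have h4 := dd s; have h5 := sqr_ge0 (`|d s| - sig).
  by set q := 2 / alpha * y s in h4 *; lra.
have Bs : 0 <= B * sig ^+ 2 / 2 by rewrite divr_ge0// mulr_ge0 ?sqr_ge0// ltW.
have H := gronwall_itv a0 Bs yc y0 yd yle tT.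
have H2 : `|d t| ^+ 2 <= Q * sig ^+ 2.
  apply: le_trans (dd t) _.
  apply: (@le_trans _ _ (2 / alpha * (B * sig ^+ 2 / 2 / a * expR (a * T)))).
    by rewrite ler_pM2l// divr_gt0.
  by rewrite /Q; lra.
rewrite -(@ler_pXn2r _ 2%N) ?nnegrE ?mulr_ge0 ?sqrtr_ge0// exprMn sqr_sqrtr ?(ltW Q0)//.
Qed.

(** Uniform convergence of the pulled back loads makes the states uniformly
    Cauchy along the filter, by continuous dependence on a ball that the energy
    bound provides; the velocities then converge uniformly too, and the equation
    passes to the limit. *)
Lemma state_limit (I : Type) (U : set_system I) (UP : ProperFilter U)
    (l_ : I -> R -> dual V) (z_ : I -> R -> Z) (l : R -> dual V) (K : R) (z0 : Z) :
  (forall k, {within `[0, T], continuous (l_ k)}) ->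
  (forall k, {within `[0, T], continuous (z_ k)}) ->
  (forall k, primitive T (speed (l_ k) (z_ k)) (z_ k)) ->
  (forall k, z_ k 0 = z0) ->
  (forall k t, t \in `[0, T] -> `|l_ k t| <= K) ->
  {within `[0, T], continuous l} ->
  (forall e, 0 < e -> \forall k \near U, forall t, t \in `[0, T] ->
     `|pullback iZV (l_ k t) - pullback iZV (l t)| <= e) ->
  exists z : R -> Z, [/\ {within `[0, T], continuous z},
    primitive T (speed l z) z, z 0 = z0 &
    forall t, t \in `[0, T] -> z_ k t @[k --> U] --> z t].
Proof.
move=> lc_ zc_ zh_ z0_ lK lc lU.
pose r := Num.sqrt (2 / alpha * (stored_energy z0 + T * (K ^+ 2 / (2 * eps)))).
have r0 : 0 <= r by exact: sqrtr_ge0.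
have zr k t : t \in `[0, T] -> `|z_ k t| <= r.
  move=> tT.
  have := state_bound (lc_ k) (zc_ k) (zh_ k) (lK k) tT.
  rewrite z0_; set S := stored_energy _ + _ => H.
  have H2 : `|z_ k t| ^+ 2 <= 2 / alpha * S.
    by rewrite mulrAC ler_pdivlMr//; lra.
  rewrite -[`|z_ k t|]ger0_norm// -sqrtr_sqr; exact: ler_wsqrtr.
have [C C0 dep] := state_dependence r0.
have zC e : 0 < e -> exists y, \forall k \near U, forall t, t \in `[0, T] ->
    `|z_ y t - z_ k t| <= e.
  move=> e0; have s0 : 0 < e / C / 2 by rewrite !divr_gt0.
  have H := lU _ s0; have [y Hy] := filter_ex H; exists y.
  apply: filterS H => k Hk.
  have -> : e = C * (e / C / 2 + e / C / 2) by rewrite -splitr mulrC divfK// gt_eqF.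
  apply: (dep _ _ _ _ _ (lc_ y) (zc_ y) (lc_ k) (zc_ k) (zh_ y) (zh_ k) (zr y) (zr k)).
  - by rewrite !z0_.
  - by rewrite addr_ge0// ltW.
  move=> t tT; rewrite -(subrKA (pullback iZV (l t))) (le_trans (ler_normD _ _))// lerD//.
    exact: Hy.
  by rewrite distrC Hk.
pose z t := if t \in `[0, T] then lim (z_ k t @[k --> U]) else 0.
have zcv t : t \in `[0, T] -> z_ k t @[k --> U] --> z t.
  move=> tT; rewrite /z tT; apply: cauchy_cvg_dist => e e0.
  have [y Hy] := zC e e0; exists (z_ y t).
  by apply: filterS Hy => k; apply.
have zU e : 0 < e -> \forall k \near U, forall t, t \in `[0, T] -> `|z_ k t - z t| <= e.
  move=> e0; have [y Hy] := zC _ (gt0_half e0).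
  have yz t : t \in `[0, T] -> `|z_ y t - z t| <= e / 2.
    move=> tT; have cv : `|z_ y t - z_ k t| @[k --> U] --> `|z_ y t - z t|.
      by apply: cvg_norm; apply: cvgB; [exact: cvg_cst|exact: zcv].
    by apply: cvgr_to_le cv _; apply: filterS Hy => k; apply.
  apply: filterS Hy => k Hk t tT.
  rewrite -(subrKA (z_ y t)) (le_trans (ler_normD _ _))// [leRHS]splitr lerD//.
    by rewrite distrC Hk.
  exact: yz.
have zc : {within `[0, T], continuous z}.
  apply: unif_within_continuous => e e0.
  have e3 : 0 < e / 3 by rewrite divr_gt0.
  have [k Hk] := filter_ex (zU _ e3).
  have [d d0 hd] := heine_itv (zc_ k) e3; exists d => // s t sT tT st.
  have h1 := Hk s sT; have h2 := Hk t tT; have h3 := hd s t sT tT st.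
  have -> : z s - z t = - (z_ k s - z s) + (z_ k s - z_ k t) + (z_ k t - z t).
    by rewrite opprB !subrKA.
  rewrite (le_trans (ler_normD _ _))// (le_trans (lerD (ler_normD _ _) (lexx _)))// normrN; lra.
have zr' t : t \in `[0, T] -> `|z t| <= r.
  move=> tT; have cv : `|z_ k t| @[k --> U] --> `|z t| by apply: cvg_norm; exact: zcv.
  by apply: cvgr_to_le cv _; apply: filterE => k; exact: zr.
have T00 : 0 \in `[0, T] by rewrite in_itv/= lexx ltW.
have [C' C'0 HC'] := speed_dist r0.
exists z; split => //.
- apply: (primitive_cvg UP zh_ zcv) => e e0.
  have s0 : 0 < e / C' / 2 by rewrite !divr_gt0.
  apply: filterS2 (lU _ s0) (zU _ s0) => k h1 h2 t tT.
  apply: le_trans (HC' _ _ _ _ _ _ (zr k t tT) (zr' t tT)) _.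
  by rewrite -ler_pdivlMl// mulrC [leRHS]splitr lerD// ?h1// h2.
- have := zcv 0 T00; have -> : z_^~ 0 = cst z0 by apply/funext => k; exact: z0_.
  by move=> /(cvg_lim (@norm_hausdorff _ _)) <-; rewrite lim_cst//; exact: norm_hausdorff.
Qed.

Hypothesis pZ : parallelogram_le Z.
Hypothesis nV : norming_dual (dual V).

(** The velocity is a Lipschitz function of the load and of the state, hence has
    bounded discrete energy as they do: this is the second order regularity of
    the state. *)
Lemma state_sobolev l z : sobolev T 1 l -> {within `[0, T], continuous l} ->
  {within `[0, T], continuous z} -> primitive T (speed l z) z ->
  sobolev T 2 z /\
  {ae lebesgue_measure, forall t, t \in `]0, T[ ->
    subdiff_dual (conjugate (EFin \o visc iZV A D eps delta))
      (- DzI iZV A F (l t) (z t)) = [set wderiv T z t]}.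
Proof.
move=> ls lc zc zh.
have hc := speed_continuous lc zc.
have zw := primitive_wderiv T0 nZ hc zh.
have hL2 := continuous_L2 T0 hc.
have [r r0 zr] := continuous_bounded_itv T0 zc.
have [M M0 hM] := continuous_bounded_itv T0 hc.
have [C C0 HC] := speed_dist r0.
have zM := primitive_lipschitz zh hM.
have [w1 w2] := sobolev1_wderiv ls.
pose L := fine (L2normsq T (wderiv T l)).
pose B := 2 * C ^+ 2 * `|iZV| ^+ 2 * L + 2 * C ^+ 2 * M ^+ 2 * T.
have hE n : discrete_energy T (2 ^ n) (speed l z) <= B.
  set N := (2 ^ n)%N; have N0 : (0 < N)%N by rewrite expn_gt0.
  have m0 := mesh_gt0 T0 N0.
  have lE := discrete_energy_le T0 nV N0 lc w1 w2.
  apply: (@le_trans _ _ (2 * C ^+ 2 * `|iZV| ^+ 2 * discrete_energy T N l + 2 * C ^+ 2 * M ^+ 2 * T)).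
    have -> : 2 * C ^+ 2 * `|iZV| ^+ 2 * discrete_energy T N l + 2 * C ^+ 2 * M ^+ 2 * T =
      \sum_(i < N) (2 * C ^+ 2 * `|iZV| ^+ 2 * (`|l (node T N i.+1) - l (node T N i)| ^+ 2 / mesh T N)
        + 2 * C ^+ 2 * M ^+ 2 * mesh T N).
      rewrite big_split/= -mulr_sumr sumr_const card_ord; congr (_ + _).
      have eT : mesh T N *+ N = T by rewrite -mulr_natr /mesh divfK// pnatr_eq0 -lt0n.
      by rewrite -[RHS]mulrnAr eT.
    apply: ler_sum => i _.
    have nT : node T N i \in `[0, T] by apply: node_itv => //; exact: ltnW.
    have nT' : node T N i.+1 \in `[0, T] by apply: node_itv.
    have h1 := HC l z l z _ _ (zr _ nT') (zr _ nT).
    have h2 := zM _ _ nT' nT.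
    have h3 := pullback_dist iZV (l (node T N i.+1)) (l (node T N i)).
    have em : `|node T N i.+1 - node T N i| = mesh T N.
      by rewrite nodeS addrAC subrr add0r ger0_norm// ltW.
    rewrite em in h2.
    set a := `|l _ - l _| in h3 *; set m := mesh T N in h2 m0 *.
    have a0 : 0 <= a by exact: normr_ge0.
    have h4 : `|speed l z (node T N i.+1) - speed l z (node T N i)| <= C * (`|iZV| * a + M * m).
      by apply: le_trans h1 _; rewrite ler_pM2l// lerD.
    have ia : 0 <= `|iZV| * a by rewrite mulr_ge0.
    have Mm : 0 <= M * m by rewrite mulr_ge0// ltW.
    have h5 : `|speed l z (node T N i.+1) - speed l z (node T N i)| ^+ 2 <= (C * (`|iZV| * a + M * m)) ^+ 2.
      by rewrite lerXn2r ?nnegrE// mulr_ge0 ?(ltW C0)// addr_ge0.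
    rewrite ler_pdivrMr//; apply: le_trans h5 _.
    have -> : (2 * C ^+ 2 * `|iZV| ^+ 2 * (a ^+ 2 / m) + 2 * C ^+ 2 * M ^+ 2 * m) * m =
      C ^+ 2 * (2 * (`|iZV| * a) ^+ 2 + 2 * (M * m) ^+ 2) by field; rewrite gt_eqF.
    rewrite exprMn ler_wpM2l ?sqr_ge0//.
    by have := sqr_ge0 (`|iZV| * a - M * m); lra.
  by rewrite lerD2r ler_wpM2l// mulr_ge0 ?sqr_ge0// mulr_ge0 ?sqr_ge0.
have [h' [h'L2 hw' _]] := wderiv_of_bounded_energy T0 nZ pZ hc hE.
split.
  split; first exact: continuous_L2.
  by exists (speed l z) => //; split => //; exists h'.
have [v1 v2] : L2 T (wderiv T z) /\ is_wderiv T z (wderiv T z).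
  by apply: wderivP; exists (speed l z).
have := wderiv_unique T0 nZ zc v1 v2 hL2 zw.
apply: ae_imply => t H tT; rewrite H//.
exact: subdiff_conjugate_visc hD As alpha0 Ac eps0 delta0 _.
Qed.

End StateEquation.

(** * Limits of loads *)

Lemma sqr_le_add (R : realType) (a b c e : R) : 0 <= a -> 0 <= b -> 0 <= e ->
  a <= c -> b <= c -> a <= b + e -> a ^+ 2 <= b ^+ 2 + 2 * c * e.
Proof.
move=> a0 b0 e0 ac bc abe; have [ab|ba] := leP a b.
  have : a ^+ 2 <= b ^+ 2 by rewrite lerXn2r ?nnegrE.
  have : 0 <= 2 * c * e by rewrite !mulr_ge0// (le_trans a0).
  by lra.
have : (a - b) * (a + b) <= e * (2 * c).
  by apply: ler_pM; lra.
by lra.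
Qed.

Lemma holder_modulus (R : realType) (E : normedModType R) (T M : R) : 0 <= M ->
  forall e, 0 < e -> exists2 d, 0 < d & forall u : R -> E,
  (forall s t, s \in `[0, T] -> t \in `[0, T] -> `|u s - u t| ^+ 2 <= M * `|s - t|) ->
  forall s t, s \in `[0, T] -> t \in `[0, T] -> `|s - t| < d -> `|u s - u t| <= e.
Proof.
move=> M0 e e0; have M1 : 0 < M + 1 by rewrite ltr_wpDl.
exists (e ^+ 2 / (M + 1)); first by rewrite divr_gt0// exprn_gt0.
move=> u uM s t sT tT st.
rewrite -(@ler_pXn2r _ 2%N) ?nnegrE ?(ltW e0)//.
apply: le_trans (uM s t sT tT) _.
have : (M + 1) * `|s - t| <= e ^+ 2 by rewrite -ler_pdivlMl// mulrC ltW.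
have : 0 <= `|s - t| by []; lra.
Qed.

Section LoadLimit.
Context {R : realType} {Z V : completeNormedModType R}.
Variables (T : R) (iZV : linop Z V).
Hypothesis iZVc : compact_op iZV.

(** The limit load is taken weakly at each time, along an ultrafilter. Uniform
    Hoelder continuity then makes the convergence of the pulled back loads and
    the lower semicontinuity of the norm uniform in time. *)
Lemma load_limit (I : Type) (U : set_system I) (UU : UltraFilter U)
    (l_ : I -> R -> dual V) (K M : R) : 0 <= M ->
  (forall k t, t \in `[0, T] -> `|l_ k t| <= K) ->
  (forall k s t, s \in `[0, T] -> t \in `[0, T] ->
     `|l_ k s - l_ k t| ^+ 2 <= M * `|s - t|) ->
  exists l : R -> dual V, [/\ {within `[0, T], continuous l},
    forall t v, t \in `[0, T] -> (l_ k t v : R) @[k --> U] --> (l t v : R),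
    forall e, 0 < e -> \forall k \near U, forall t, t \in `[0, T] ->
      `|pullback iZV (l_ k t) - pullback iZV (l t)| <= e,
    forall e, 0 < e -> \forall k \near U, forall t, t \in `[0, T] ->
      `|l t| ^+ 2 <= `|l_ k t| ^+ 2 + e &
    forall s t, s \in `[0, T] -> t \in `[0, T] -> forall e, 0 < e ->
      \forall k \near U, `|l t - l s| ^+ 2 <= `|l_ k t - l_ k s| ^+ 2 + e].
Proof.
move=> M0 lK lM; have UP : ProperFilter U by exact: ultra_proper.
have /choice[l lP] : forall t, exists xi : dual V, t \in `[0, T] ->
    forall v, (l_ k t v : R) @[k --> U] --> (xi v : R).
  move=> t; have [tT|_] := boolP (t \in `[0, T]); last by exists 0.
  by have [xi xiP] := dual_bounded_cvg UU (fun k => lK k t tT); exists xi.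
have incr s t : s \in `[0, T] -> t \in `[0, T] ->
    forall v, ((l_ k s - l_ k t) v : R) @[k --> U] --> ((l s - l t) v : R).
  move=> sT tT v; have H := cvgB (lP s sT v) (lP t tT v).
  exact: H.
have lK' t : t \in `[0, T] -> `|l t| <= K.
  by move=> tT; apply: (dual_cvg_norm_le UP (lP t tT)); apply: filterE => k; exact: lK.
have lM' s t : s \in `[0, T] -> t \in `[0, T] -> `|l s - l t| ^+ 2 <= M * `|s - t|.
  move=> sT tT; have Mst : 0 <= M * `|s - t| by rewrite mulr_ge0.
  rewrite -(sqr_sqrtr Mst) lerXn2r ?nnegrE ?sqrtr_ge0//.
  apply: (dual_cvg_norm_le UP (incr s t sT tT)); apply: filterE => k.
  rewrite -[`|_|]ger0_norm// -sqrtr_sqr; apply: ler_wsqrtr; exact: lM.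
exists l; split.
- apply: unif_within_continuous => e e0.
  by have [d d0 hd] := holder_modulus (dual V) T M0 e0; exists d => //; exact: hd.
- by move=> t v tT; exact: lP.
- apply: equicontinuous_near => [e e0|t tT e e0]; last first.
    have H := pullback_cvg0 UP iZVc (fun k => lK k t tT) (lP t tT) e0.
    exact: H.
  have i1 : 0 < `|iZV| + 1 by rewrite ltr_wpDl.
  have e'0 : 0 < e / (`|iZV| + 1) / 2 by rewrite !divr_gt0.
  have [d d0 hd] := holder_modulus (dual V) T M0 e'0; exists d => // k s t sT tT st.
  have h1 := hd _ (lM k) s t sT tT st; have h2 := hd _ lM' s t sT tT st.
  have -> : pullback iZV (l_ k t) - pullback iZV (l t) =
      (pullback iZV (l_ k s) - pullback iZV (l s)) +
      ((pullback iZV (l s) - pullback iZV (l t)) - (pullback iZV (l_ k s) - pullback iZV (l_ k t))).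
    by rewrite addrA subrKA opprB addrC subrKA.
  apply: le_trans (ler_normD _ _) _; rewrite lerD2l.
  apply: le_trans (ler_normB _ _) _.
  have h3 := le_trans (pullback_dist iZV (l s) (l t)) (ler_wpM2l (normr_ge0 iZV) h2).
  have h4 := le_trans (pullback_dist iZV (l_ k s) (l_ k t)) (ler_wpM2l (normr_ge0 iZV) h1).
  have : `|iZV| * (e / (`|iZV| + 1) / 2) <= e / 2.
    by rewrite mulrA ler_pM2r ?invr_gt0// mulrCA ler_piMr ?(ltW e0)// ler_pdivrMr// mul1r lerDl.
  by lra.
- move=> e e0.
  have K0 t : t \in `[0, T] -> 0 <= K by move=> tT; apply: le_trans (lK' t tT).
  have K1 : 0 < 2 * `|K| + 1 by rewrite ltr_wpDl// mulr_ge0.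
  have H : forall e, 0 < e -> \forall k \near U, forall t, t \in `[0, T] ->
      `|l t| ^+ 2 - `|l_ k t| ^+ 2 <= e.
    apply: equicontinuous_near => [e1 e10|t tT e1 e10].
      have e'0 : 0 < e1 / (2 * `|K| + 1) / 2 by rewrite !divr_gt0.
      have [d d0 hd] := holder_modulus (dual V) T M0 e'0; exists d => // k s t sT tT st.
      have h1 := hd _ (lM k) s t sT tT st; have h2 := hd _ lM' s t sT tT st.
      have h3 : `|l t| <= `|l s| + e1 / (2 * `|K| + 1) / 2.
        rewrite -lerBlDl (le_trans (lerB_dist _ _))// distrC//.
      have h4 : `|l_ k s| <= `|l_ k t| + e1 / (2 * `|K| + 1) / 2.
        rewrite -lerBlDl (le_trans (lerB_dist _ _))//.
      have h5 := sqr_le_add (normr_ge0 _) (normr_ge0 _) (ltW e'0) (lK' t tT) (lK' s sT) h3.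
      have h6 := sqr_le_add (normr_ge0 _) (normr_ge0 _) (ltW e'0) (lK k s sT) (lK k t tT) h4.
      have : 2 * K * (e1 / (2 * `|K| + 1) / 2) <= e1 / 2.
        rewrite mulrA ler_pM2r ?invr_gt0// mulrCA ler_piMr ?(ltW e10)// ler_pdivrMr// mul1r.
        by rewrite ger0_norm ?(K0 t)// lerDl.
      by lra.
    have e'0 : 0 < e1 / (2 * `|K| + 1) by rewrite !divr_gt0.
    have := dual_cvg_norm_lsc UP (lP t tT) e'0; apply: filterS => k hk.
    have h5 := sqr_le_add (normr_ge0 _) (normr_ge0 _) (ltW e'0) (lK' t tT) (lK k t tT) hk.
    rewrite lerBlDl; apply: le_trans h5 _; rewrite lerD2l.
    rewrite mulrCA ler_piMr ?(ltW e10)// ler_pdivrMr// mul1r.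
    by rewrite ger0_norm ?(K0 t)// lerDl.
  by have := H e e0; apply: filterS => k hk t tT; have := hk t tT; rewrite lerBlDl.
- move=> s t sT tT e e0.
  have K0 : 0 <= K by apply: le_trans (lK' t tT).
  have K1 : 0 < 2 * (2 * K) + 1 by rewrite ltr_wpDl// !mulr_ge0.
  have e'0 : 0 < e / (2 * (2 * K) + 1) by rewrite divr_gt0.
  have := dual_cvg_norm_lsc UP (incr t s tT sT) e'0; apply: filterS => k hk.
  have h1 : `|l t - l s| <= 2 * K.
    by rewrite (le_trans (ler_normB _ _))//; have := lK' t tT; have := lK' s sT; lra.
  have h2 : `|l_ k t - l_ k s| <= 2 * K.
    by rewrite (le_trans (ler_normB _ _))//; have := lK k t tT; have := lK k s sT; lra.
  have h5 := sqr_le_add (normr_ge0 _) (normr_ge0 _) (ltW e'0) h1 h2 hk.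
  apply: le_trans h5 _; rewrite lerD2l.
  by rewrite mulrCA ler_piMr ?(ltW e0)// ler_pdivrMr// mul1r lerDl.
Qed.

End LoadLimit.

(** * Existence of an optimal control *)

Section Distance.
Context {R : realType} {E : normedModType R}.

Lemma dist_ge0_lbound (x : E) (S : set E) : has_lbound [set `|x - m| | m in S].
Proof. by exists 0 => _ [m _ <-]. Qed.

Lemma dist_in (x : E) (S : set E) : S x -> dist x S <= 0.
Proof.
move=> Sx; apply: ge_inf; first exact: dist_ge0_lbound.
by exists x => //; rewrite subrr normr0.
Qed.

Lemma dist_le_add (x y : E) (S : set E) : S !=set0 ->
  dist x S <= `|x - y| + dist y S.
Proof.
move=> [m0 Sm0]; rewrite -lerBlDl; apply: lb_le_inf; first by exists `|y - m0|, m0.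
move=> _ [m Sm <-]; rewrite lerBlDl.
apply: (@le_trans _ _ `|x - m|).
  by apply: ge_inf; [exact: dist_ge0_lbound|exists m].
by rewrite -(subrKA y) ler_normD.
Qed.

End Distance.

Section Stationary.
Context {R : realType} {Z V X : completeNormedModType R}.
Variables (iZV : linop Z V) (iVX : linop V X) (A : linop Z (dual Z)).
Variables (F : Z -> R^o) (D : Z -> R).
Hypothesis hD : dissipation iZV iVX D.
Hypothesis As : symmetric_op A.
Hypothesis FC1 : C1 F.

(** Since the dissipation vanishes at 0, stability is a family of inequalities,
    each of which passes to weak limits of loads. *)
Lemma subdiff_dissipationP (xi : dual Z) :
  subdiff (EFin \o D) 0 xi <-> forall y, xi y <= D y.
Proof.
split=> [[_ H] y|H].
  by have := H y; rewrite subr0 /= (dissipation0 hD) add0r lee_fin.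
split=> // y; rewrite subr0 /= (dissipation0 hD) add0r lee_fin; exact: H.
Qed.

(** The dissipation is dominated by the norm of [V], so that stationary loads
    for the same state differ by a functional bounded on the dense range of
    the embedding. *)
Lemma stationary_load_bound (z0 : Z) : dense (range iZV) ->
  exists C : R, forall l l' : dual V,
    subdiff (EFin \o D) 0 (- DzI iZV A F l z0) ->
    subdiff (EFin \o D) 0 (- DzI iZV A F l' z0) -> `|l - l'| <= C.
Proof.
move=> dV; have [C C0 HC] := dissipation_le hD.
exists (2 * C) => l l' /subdiff_dissipationP sl /subdiff_dissipationP sl'.
have C2 : 0 <= 2 * C by rewrite mulr_ge0// ltW.
have one y : (l - l') (iZV y) <= 2 * C * `|iZV y|.
  have h1 := le_trans (sl y) (HC y).
  have h2 := le_trans (sl' (- y)) (HC (- y)).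
  rewrite !(DzI_E iZV As FC1) in h1 h2.
  set q := A z0 + frechet F z0 in h1 h2.
  rewrite -[(pullback iZV l - q) y]/(l (iZV y) - q y) in h1.
  rewrite -[(pullback iZV l' - q) (- y)]/(l' (iZV (- y)) - q (- y)) !linearN/= normrN in h2.
  rewrite -[(l - l') _]/(l (iZV y) - l' (iZV y)).
  by lra.
have rng v : range iZV v -> `|(l - l') v| <= 2 * C * `|v|.
  move=> [y _ <-]; rewrite ler_norml one andbT lerNl.
  by have := one (- y); rewrite !linearN/= normrN.
apply: linop_norm_le => // v; apply/ler_addgt0Pr => e e0.
pose c := `|l - l'| + 2 * C + 1.
have c0 : 0 < c by rewrite ltr_wpDl// addr_ge0.
have [] := dV (ball v (e / c)).
- by exists v; apply: ballxx; rewrite divr_gt0.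
- exact: ball_open.
move=> w [/= vw rw].
have {}vw : `|v - w| < e / c by move: vw; rewrite -ball_normE.
pose f : dual V := l - l'.
change (`|f v : R| <= 2 * C * `|v| + e).
have -> : (f v : R) = f (v - w) + f w by rewrite [f (v - w)]linearB subrK.
apply: le_trans (ler_normD _ _) _.
have h1 := le_norm_linop f (v - w).
have h2 := rng w rw.
have h3 : `|w| <= `|v| + `|v - w|.
  by rewrite -lerBlDl (le_trans (lerB_dist _ _))// distrC.
have h4 : c * `|v - w| <= e by rewrite -ler_pdivlMl// mulrC ltW.
have h5 : 2 * C * `|w| <= 2 * C * (`|v| + `|v - w|) by rewrite ler_wpM2l.
have h6 : 0 <= `|v - w| by [].
move: h1 h2 h4; rewrite /c -/f; set F' := `|f|; set d := `|v - w| in h3 h5 h6 *.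
by move=> h1 h2 h4; lra.
Qed.

End Stationary.

Theorem theorem5p7 (R : realType) (T : R)
    (Z V X W : completeNormedModType R)
    (iZV : linop Z V) (iVX : linop V X) (iZW : linop Z W) (iWV : linop W V)
    (A : linop Z (dual Z)) (F : Z -> R) (D : Z -> R) (j : V -> R) (beta : R)
    (hT : 0 < T)
    (hZ : is_hilbert Z) (hV : is_hilbert V)
    (hemb : embeddings iZV iVX iZW iWV)
    (hAsym : symmetric_op A) (hAcoer : coercive_op A)
    (hF : nonlinearity iZV iZW F)
    (hD : dissipation iZV iVX D)
    (hjc : continuous j) (hjb : exists m : R, forall v, m <= j v)
    (hbeta : 0 < beta)
    (z0 : Z)
    (hz0 : exists l0 : dual V, subdiff (EFin \o D) 0 (- DzI iZV A F l0 z0))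
    (eps delta : R) (heps : 0 < eps) (hdelta : 0 < delta) :
  exists (l : R -> dual V) (z : R -> Z),
    feasible T iZV A F D z0 eps delta l z /\
    forall (l' : R -> dual V) (z' : R -> Z),
      feasible T iZV A F D z0 eps delta l' z' ->
      cost T iZV j beta l z <= cost T iZV j beta l' z'.
Proof.
have [alpha alpha0 Ac] := hAcoer.
have [[FC1 FC1'] F0 _ _ Flip] := hF.
have [_ _ _ iZVd [iZVc _]] := hemb.
have [m mj] := hjb; have [l0 sl0] := hz0.
have nZ := hilbert_norming hZ.
have pZ := hilbert_parallelogram hZ.
have pV := dual_parallelogram (hilbert_parallelogram hV).
have nV : norming_dual (dual V) := @dual_norming R V.
have T00 : 0 \in `[0, T] by rewrite in_itv/= lexx ltW.
have TT0 : T \in `[0, T] by rewrite in_itv/= lexx ltW.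
pose feas := feasible T iZV A F D z0 eps delta.
pose J := cost T iZV j beta.
have H1_ge0 (l : R -> dual V) : 0 <= fine (H1normsq T l).
  by rewrite fine_ge0// adde_ge0// L2normsq_ge0.
have sobolev_state := state_sobolev hT nZ hD hAsym alpha0 Ac heps hdelta FC1 FC1' Flip pZ nV.
have [l1 [z1 f1]] : exists l z, feas l z.
  have lc : {within `[0, T], continuous (cst l0 : R -> dual V)}.
    by apply: continuous_subspaceT => x; exact: cvg_cst.
  have zc : {within `[0, T], continuous (cst z0 : R -> Z)}.
    by apply: continuous_subspaceT => x; exact: cvg_cst.
  have lE n : discrete_energy T (2 ^ n) (cst l0 : R -> dual V) <= 0.
    rewrite /discrete_energy big1// => i _.
    by rewrite /cst subrr normr0 expr0n/= mul0r.
  have [g [gL2 lg _]] := wderiv_of_bounded_energy hT nV pV lc lE.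
  have ls : sobolev T 1 (cst l0 : R -> dual V).
    by split; [exact: continuous_L2|exists g].
  have zh : primitive T (speed iZV A F D eps delta (cst l0) (cst z0)) (cst z0).
    move=> s t c w s0 st tT H.
    rewrite /cst subrr sub0r normrN normrZ ger0_norm ?subr_ge0// ler_wpM2l ?subr_ge0//.
    have := H s (lexx s) st.
    by rewrite /speed/= (resolvent_stationary hD hAsym alpha0 Ac heps hdelta sl0) sub0r normrN.
  have [zs zae] := sobolev_state _ _ ls lc zc zh.
  exists (cst l0), (cst z0); split => //; split => //=.
  apply: le_trans (dist_in sl0) _.
  by rewrite addr_ge0// powR_ge0.
pose S := [set J p.1 p.2 | p in [set p | feas p.1 p.2]].
have Sinf : has_inf S.
  split; first by exists (J l1 z1), (l1, z1).
  exists m => _ [[l z] /= _ <-]; rewrite /J /cost ler_wpDr//.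
  by rewrite mulr_ge0// divr_ge0// ltW.
have SJ l z : feas l z -> inf S <= J l z.
  by move=> f; apply: ge_inf; [exact: Sinf.2|exists (l, z)].
have /choice[p pP] : forall n : nat, exists p : (R -> dual V) * (R -> Z),
    feas p.1 p.2 /\ J p.1 p.2 <= inf S + n.+1%:R^-1.
  move=> n; have n0 : 0 < n.+1%:R^-1 :> R by rewrite invr_gt0.
  by have [_ [q qf <-] H] := inf_adherent n0 Sinf; exists q; split => //; exact: ltW.
pose l_ n := (p n).1; pose z_ n := (p n).2.
have fk n : feas (l_ n) (z_ n) by have [] := pP n.
have Jk n : J (l_ n) (z_ n) <= inf S + n.+1%:R^-1 by have [] := pP n.
(* As j >= m, the cost dominates the H^1 norm: costs are at most inf S + 1. *)
pose M := 2 / beta * (inf S + 1 - m).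
have Mk n : fine (H1normsq T (l_ n)) <= M.
  rewrite /M mulrAC ler_pdivlMr//.
  have := Jk n; have := mj (iZV (z_ n T)).
  have : n.+1%:R^-1 <= 1 :> R by rewrite invf_le1// ler1n.
  rewrite /J /cost; set a := n.+1%:R^-1; set H := fine _; set q := j _.
  by move=> h1 h2 h3; lra.
have M0 : 0 <= M by apply: le_trans (Mk 0%N).
have ls_ n : sobolev T 1 (l_ n) by have [[]] := fk n.
have lc_ n : {within `[0, T], continuous (l_ n)} by have [[]] := fk n.
have zc_ n : {within `[0, T], continuous (z_ n)} by have [_ []] := fk n.
have zh_ n : primitive T (speed iZV A F D eps delta (l_ n) (z_ n)) (z_ n).
  have [_ [zs _] zae _ _] := fk n.
  have H := state_primitive hT nZ hD hAsym alpha0 Ac heps hdelta (zc_ n) zs zae.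
  exact: H.
have z0_ n : z_ n 0 = z0 by have [] := fk n.
have sl_ n : subdiff (EFin \o D) 0 (- DzI iZV A F (l_ n 0) z0) by have [_ _ _ _ []] := fk n.
have lM n := H1_holder hT nV (lc_ n) (ls_ n) (Mk n).
have [C HC] := stationary_load_bound hD hAsym FC1 z0 iZVd.
(* Stability at time 0 bounds the initial load, the Hoelder modulus the rest. *)
pose K := `|l0| + C + Num.sqrt (M * T).
have lK n t : t \in `[0, T] -> `|l_ n t| <= K.
  move=> tT; have h1 := HC _ _ (sl_ n) sl0.
  have h2 : `|l_ n t - l_ n 0| <= Num.sqrt (M * T).
    rewrite -[leLHS]ger0_norm// -sqrtr_sqr; apply: ler_wsqrtr.
    apply: le_trans (lM n t 0 tT T00) _; rewrite ler_wpM2l// subr0.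
    by move: tT; rewrite in_itv/= => /andP[t0 tT]; rewrite ger0_norm.
  have -> : l_ n t = l0 + (l_ n 0 - l0) + (l_ n t - l_ n 0).
    by rewrite [l0 + _]addrC subrK addrC subrK.
  rewrite (le_trans (ler_normD _ _))// lerD// (le_trans (ler_normD _ _))// lerD//.
have [U [UU Uoo]] := @ultraFilterLemma nat \oo _.
have UP : ProperFilter U by exact: ultra_proper.
have [l [lcont lU lpb lsq linc]] := load_limit iZVc UU M0 lK lM.
have [z [zcont zh z00 zU]] := state_limit hT hD hAsym alpha0 Ac heps hdelta
  FC1 FC1' F0 Flip UP lc_ zc_ zh_ z0_ lK lcont lpb.
have jU : j (iZV (z_ n T)) @[n --> U] --> j (iZV (z T)).
  apply: (@continuous_cvg _ _ _ _ _ _ j); first exact: hjc.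
  apply: (@continuous_cvg _ _ _ _ _ _ (iZV : Z -> V)); first exact: linop_continuous.
  exact: zU.
(* The squared H^1 norm for which the limit pair would have cost inf S. *)
pose h := 2 / beta * (inf S - j (iZV (z T))).
have hU e : 0 < e -> \forall n \near U, fine (H1normsq T (l_ n)) <= h + e.
  move=> e0; have e'0 : 0 < beta * e / 4 by rewrite divr_gt0// mulr_gt0.
  have near1 : \forall n \near U, n.+1%:R^-1 < beta * e / 4.
    by apply: Uoo; exact: (near_infty_natSinv_lt (PosNum e'0)).
  have near2 : \forall n \near U, `|j (iZV (z T)) - j (iZV (z_ n T))| <= beta * e / 4.
    by move: jU => /cvgrPdist_le; apply.
  apply: filterS2 near1 near2 => n h1; rewrite ler_norml => /andP[h2 h3].
  have -> : h + e = (inf S - j (iZV (z T)) + beta * e / 2) * 2 / beta.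
    by rewrite /h; field; rewrite gt_eqF.
  rewrite ler_pdivlMr//.
  move: h1 h2 h3 (Jk n); rewrite /J /cost.
  set a := n.+1%:R^-1; set H := fine _; set q := j _; set q' := j _ => h1 h2 h3 h4.
  by lra.
have [ls lh] := H1_lsc hT nV pV UP ls_ lc_ lcont lsq linc hU.
have [zs zae] := sobolev_state _ _ ls lcont zcont zh.
have Jl : J l z <= inf S.
  have : beta / 2 * fine (H1normsq T l) <= beta / 2 * h by rewrite ler_wpM2l// divr_ge0// ltW.
  have -> : beta / 2 * h = inf S - j (iZV (z T)) by rewrite /h; field; rewrite gt_eqF.
  by rewrite /J /cost; lra.
exists l, z; split; last by move=> l' z' /SJ; apply: le_trans.
split => //; split.
  apply/(subdiff_dissipationP hD) => y.
  have cv : (- DzI iZV A F (l_ n 0) z0) y @[n --> U] --> ((- DzI iZV A F (l 0) z0) y : R).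
    rewrite (DzI_E iZV hAsym FC1).
    have -> : (fun n => (- DzI iZV A F (l_ n 0) z0) y) =
        (fun n => l_ n 0 (iZV y) - (A z0 + frechet F z0) y : R).
      by apply/funext => n; rewrite (DzI_E iZV hAsym FC1).
    have h1 := lU 0 (iZV y) T00.
    by have H := cvgB h1 (cvg_cst ((A z0 + frechet F z0) y : R)); exact: H.
  apply: cvgr_to_le cv _; apply: filterE => n.
  by have /(subdiff_dissipationP hD) := sl_ n; apply.
have cv : `|(- DzI iZV A F (l T) (z T)) - (- DzI iZV A F (l_ n T) (z_ n T))| @[n --> U] --> (0 : R).
  have cvx : (- DzI iZV A F (l_ n T) (z_ n T)) @[n --> U] --> (- DzI iZV A F (l T) (z T) : dual Z).
    rewrite (DzI_E iZV hAsym FC1).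
    have -> : (fun n => - DzI iZV A F (l_ n T) (z_ n T)) =
        (fun n => pullback iZV (l_ n T) - (A (z_ n T) + frechet F (z_ n T))).
      by apply/funext => n; rewrite (DzI_E iZV hAsym FC1).
    apply: cvgB; last apply: cvgD.
    - apply/cvgrPdist_le => e e0; have := lpb e e0; apply: filterS => n.
      by rewrite distrC; apply.
    - apply: (@continuous_cvg _ _ _ _ _ _ (A : Z -> dual Z)); last exact: zU.
      exact: linop_continuous.
    - apply: (@continuous_cvg _ _ _ _ _ _ (frechet F)); last exact: zU.
      exact: FC1.2.
  rewrite -(normr0 (dual Z)) -(subrr (- DzI iZV A F (l T) (z T))).
  by apply: cvg_norm; apply: cvgB; [exact: cvg_cst|exact: cvx].
apply/ler_addgt0Pr => e e0.
have [n Hn] : exists n, `|(- DzI iZV A F (l T) (z T)) - (- DzI iZV A F (l_ n T) (z_ n T))| <= e.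
  move: cv => /cvgrPdist_le /(_ _ e0) /filter_ex[n]; rewrite sub0r normrN normr_id.
  by exists n.
have S0 : subdiff (EFin \o D) 0 !=set0 by exists (- DzI iZV A F l0 z0).
apply: le_trans (dist_le_add _ (- DzI iZV A F (l_ n T) (z_ n T)) S0) _.
rewrite addrC lerD//.
by have [_ _ _ _ []] := fk n.
Qed.
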